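(* Let $H=R_{r,H}^{1/2}Z_HR_{t,H}^{1/2}$ be a random $N_R\times N_S$ matrix, where $Z_H$ is an $N_R\times N_S$ random matrix with independent, zero-mean, unit-variance, proper complex Gaussian entries, and $R_{r,H}$, $R_{t,H}$ are deterministic positive semidefinite matrices with $R_{r,H}^{1/2}=U_{r,H}\Lambda_{r,H}^{1/2}U_{r,H}^H$ and $R_{t,H}^{1/2}=U_{t,H}\Lambda_{t,H}^{1/2}U_{t,H}^H$ (eigenvalue decompositions). Let $G\in\mathbb{C}^{N_D\times N_R}$ be deterministic with singular value decomposition $G=U_G\Lambda_G^{1/2}V_G^H$. Consider the problem of maximizing, over $Q\in\mathbb{C}^{N_S\times N_S}$ and $A\in\mathbb{C}^{N_R\times N_R}$, $$\frac{\mathbb{E}_{Z_H}\left[\log\frac{\left|\sigma_D^2I_{N_D}+GA(HQH^H+\sigma_R^2I_{N_R})A^HG^H\right|}{\left|\sigma_D^2I_{N_D}+\sigma_R^2GAA^HG^H\right|}\right]}{\mathbb{E}_{Z_H}\left[\mathrm{tr}(A(HQH^H+\sigma_R^2I_{N_R})A^H)\right]+\mathrm{tr}(Q)+P_c}$$ subject to $\mathbb{E}_{Z_H}[\mathrm{tr}(A(HQH^H+\sigma_R^2I_{N_R})A^H)]\le P_R^{max}$, $\mathrm{tr}(Q)\le P_S^{max}$, $Q\succeq0$, and $$\mathbb{E}_{Z_H}\left[\log\frac{\left|\sigma_D^2I_{N_D}+GA(HQH^H+\sigma_R^2I_{N_R})A^HG^H\right|}{\left|\sigma_D^2I_{N_D}+\sigma_R^2GAA^HG^H\right|}\right]\ge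 R_S^{min}.$$ Write the eigenvalue decomposition of $Q$ as $Q=U_Q\Lambda_QU_Q^H$ and the singular value decomposition of $A$ as $A=U_A\Lambda_A^{1/2}V_A^H$. Then, for any $Q$ with the (optimal) structure $U_Q=U_{t,H}$, the optimal $A$ is such that $U_A=V_G$ and $V_A=U_{r,H}$, if either $\Lambda_G$ or $\Lambda_{r,H}$ is a scaled identity matrix.
   Context: $|\cdot|$ is the determinant, $(\cdot)^H$ the conjugate transpose, $\mathrm{tr}$ the trace, $I_n$ the $n\times n$ identity; $Q\succeq 0$ means that $Q$ is Hermitian positive semidefinite. The constants $\sigma_R^2,\sigma_D^2$ (noise variances), $P_c$ (circuit power), $P_S^{max},P_R^{max}$ (maximum powers) are positive, and $R_S^{min}\ge0$ is a minimum rate. In all eigenvalue and singular value decompositions (of $R_{r,H}^{1/2}$, $R_{t,H}^{1/2}$, $G$, $Q$ and $A$), the eigenvalues and singular values are arranged in decreasing order; $U_{r,H},U_{t,H},U_G,V_G,U_Q,U_A,V_A$ are unitary; $\Lambda_{r,H},\Lambda_{t,H},\Lambda_Q,\Lambda_A$ are diagonal with non-negative entries; $\Lambda_G^{1/2}$ is the $N_D\times N_R$ (rectangular) diagonal matrix of the singular values of $G$, and $\Lambda_G$ is the diagonal matrix of the squared singular values of $G$.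
   Formalization: The diagonal entries of Λ_A in the optimal A = V_G Λ_A^{1/2} U_{r,H}^H are not required to be in decreasing order; with that order the claim fails, e.g. for R_{r,H}=I, G=diag(2,1), N_S=1 and high relay power. *)

(* Defs.v *)
From mathcomp Require Export all_boot all_order all_algebra.
From mathcomp Require Export complex.
From mathcomp Require Export all_classical all_reals all_analysis.

Set Implicit Arguments.
Unset Strict Implicit.
Unset Printing Implicit Defensive.

Import Order.TTheory GRing.Theory Num.Theory.
Import numFieldNormedType.Exports.
Local Open Scope classical_set_scope.
Local Open Scope ring_scope.
Local Open Scope complex_scope.
Local Open Scope sesquilinear_scope.

Section LinearAlgebra.
Variable R : realType.
Local Notation C := R[i].

(* The order of R[i] makes [0 <= z] say that z is real and nonnegative. *)
Definition psdmx n (Q : 'M[C]_n) : Prop :=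
  Q \is hermsymmx /\ forall x : 'cV[C]_n, 0 <= (x ^t* *m Q *m x) 0 0.

Definition realdiag n (l : 'rV[R]_n) : 'M[C]_n :=
  diag_mx (map_mx (fun x : R => x%:C) l).

Definition sqrt_row n (l : 'rV[R]_n) : 'rV[R]_n := map_mx (@Num.sqrt R) l.

Definition nonneg_row n (l : 'rV[R]_n) : Prop := forall i, 0 <= l 0 i.

Definition decreasing_row n (l : 'rV[R]_n) : Prop :=
  forall i j : 'I_n, (i <= j)%N -> l 0 j <= l 0 i.

Definition is_evd n (M U : 'M[C]_n) (l : 'rV[R]_n) : Prop :=
  [/\ U \is unitarymx, nonneg_row l, decreasing_row l
    & M = U *m realdiag l *m U ^t*].

Definition evd_sqrt n (U : 'M[C]_n) (l : 'rV[R]_n) : 'M[C]_n :=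
  U *m realdiag (sqrt_row l) *m U ^t*.

Definition rectdiag m n (s : 'rV[R]_(minn m n)) : 'M[C]_(m, n) :=
  \sum_(k < minn m n) (s 0 k)%:C *:
    delta_mx (widen_ord (geq_minl m n) k) (widen_ord (geq_minr m n) k).

(* l lists the squares of the min(m, n) singular values of M. *)
Definition is_svd m n (M : 'M[C]_(m, n)) (U : 'M[C]_m)
    (l : 'rV[R]_(minn m n)) (V : 'M[C]_n) : Prop :=
  [/\ U \is unitarymx, V \is unitarymx, nonneg_row l, decreasing_row l
    & M = U *m rectdiag (sqrt_row l) *m V ^t*].

End LinearAlgebra.

Section GaussianMatrix.
Context {R : realType} {d : measure_display} {T : measurableType d}.
Variable P : probability T R.
Local Notation C := R[i].

(* R[i] carries no measurable structure in the library: a complex random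
   variable is handled through the pair of its real and imaginary parts. *)
Definition re_im (X : T -> C) (w : T) : measurableTypeR R * measurableTypeR R :=
  (complex.Re (X w), complex.Im (X w)).

(* Zero-mean unit-variance proper complex Gaussian variable: the real and
   imaginary parts are independent and N(0, 1/2); the second argument of
   normal_prob is the standard deviation. *)
Definition std_complex_gaussian (X : T -> C) : Prop :=
  measurable_fun setT (re_im X) /\
  forall B, measurable B ->
    P (re_im X @^-1` B) =
    (normal_prob (0 : R) (Num.sqrt 2^-1) \x normal_prob (0 : R) (Num.sqrt 2^-1))%E B.

Definition mutually_independent (I : finType) (X : I -> T -> C) : Prop :=
  forall (J : {set I}) (B : I -> set (measurableTypeR R * measurableTypeR R)),
    (forall i, measurable (B i)) ->
    P (\bigcap_(i in [set i | i \in J]) (re_im (X i) @^-1` B i)) =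
    (\prod_(i in J) P (re_im (X i) @^-1` B i))%E.

Definition iid_std_complex_gaussian m n (Z : T -> 'M[C]_(m, n)) : Prop :=
  (forall i j, std_complex_gaussian (fun w => Z w i j)) /\
  mutually_independent (fun (ij : 'I_m * 'I_n) w => Z w ij.1 ij.2).

End GaussianMatrix.

Section RelayProblem.
Context {R : realType} {d : measure_display} {T : measurableType d}.
Variables (P : probability T R) (NS NR ND : nat).
Local Notation C := R[i].
Variables (sigR2 sigD2 Pc PSmax PRmax RSmin : R).
Variables (G : 'M[C]_(ND, NR)) (H : T -> 'M[C]_(NR, NS)).

Definition relay_cov (h : 'M[C]_(NR, NS)) (Q : 'M[C]_NS) (A : 'M[C]_NR)
    : 'M[C]_NR :=
  A *m (h *m Q *m h ^t* + sigR2%:C%:M) *m A ^t*.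

(* The determinants and traces below are real numbers of R[i] whenever Q is
   positive semidefinite; complex.Re only transports them to R. *)
Definition inst_rate (h : 'M[C]_(NR, NS)) (Q : 'M[C]_NS) (A : 'M[C]_NR) : R :=
  ln (complex.Re
    (\det (sigD2%:C%:M + G *m relay_cov h Q A *m G ^t*) /
     \det (sigD2%:C%:M + sigR2%:C *: (G *m A *m A ^t* *m G ^t*)))).

Definition rate (Q : 'M[C]_NS) (A : 'M[C]_NR) : R :=
  fine 'E_P[fun w => inst_rate (H w) Q A].

Definition relay_power (Q : 'M[C]_NS) (A : 'M[C]_NR) : R :=
  fine 'E_P[fun w => complex.Re (\tr (relay_cov (H w) Q A))].

Definition source_power (Q : 'M[C]_NS) : R := complex.Re (\tr Q).

Definition energy_efficiency (Q : 'M[C]_NS) (A : 'M[C]_NR) : R :=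
  rate Q A / (relay_power Q A + source_power Q + Pc).

Definition feasible (Q : 'M[C]_NS) (A : 'M[C]_NR) : Prop :=
  [/\ relay_power Q A <= PRmax, source_power Q <= PSmax, psdmx Q
    & RSmin <= rate Q A].

Definition optimal_relay (Q : 'M[C]_NS) (A : 'M[C]_NR) : Prop :=
  feasible Q A /\
  forall A', feasible Q A' -> energy_efficiency Q A' <= energy_efficiency Q A.

End RelayProblem.

(* Main.v *)
(** With A' = V_G^H A U_r, Sylvester's identity turns the rate into
    rho(L^(1/2) f(A'^H Lambda_G A') L^(1/2)), where L = Lambda_r,
    f(M) = M (sigma_D^2 + sigma_R^2 M)^-1, rho(X) = E log |1 + W X|,
    W = Z D Z^H and D = R_t^(1/2) Q R_t^(1/2), while the relay power becomes
    sum_i (A'^H A')_ii (tau L_i + sigma_R^2) for some tau >= 0.  Since Z and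
    U Z have the same law, rho is invariant under unitary conjugation; being
    also monotone and midpoint concave, it does not decrease when X is replaced
    by its diagonal.  The diagonal of f(M) is bounded by f of the diagonal of M,
    so it suffices to bring M to a form whose diagonal is realized by a diagonal
    A' of no larger power.  If L is scalar, F^H F with F = Lambda_G^(1/2) A' can
    be traded for F F^H.  If Lambda_G is scalar (up to zero padding), the nonzero
    rows of A' can be replaced by a matrix supported on the first columns with
    the same A' L A'^H and a smaller A' A'^H.  The best diagonal A' exists by
    compactness. *)
Require Import Defs.
From HB Require Import structures.
From mathcomp Require Import measurable_realfun perm ring lra.

Set Implicit Arguments.
Unset Strict Implicit.
Unset Printing Implicit Defensive.

Import Order.TTheory GRing.Theory Num.Theory.
Import numFieldNormedType.Exports.
Local Open Scope classical_set_scope.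
Local Open Scope ring_scope.

(** * Rotation invariance of Gaussian vectors *)

Section PlaneRotation.
Context {R : realType}.
Local Notation mu := (@lebesgue_measure R).
Local Notation MR := (measurableTypeR R).
Local Notation mu2 := (mu \x mu)%E.

(** The expectation has no closed form to optimize, so the averaged rate enters only through unitary
    invariance, monotonicity and midpoint concavity. The obstacle in general is a pair of competing
    weights: the power weighs the columns of A' by Lambda_r, the inner factor Lambda_G weighs its
    rows, and the diagonal of A'^H Lambda_G A' need not be realizable by a diagonal matrix at the
    same power. A scalar weight frees one side, and the Gram matrix can then be rearranged on that
    side. Optimality is claimed against every feasible A, so a maximizer has to exist inside the
    structured family; the continuity needed for compactness comes from log|1+W(X+Y)| <= log|1+WX| +
    tr(WY), which makes the average Lipschitz in diagonal arguments. The invariance of the law of Z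
    is built from the plane: two independent centred normals of equal variance are invariant under
    rotation, phases and Givens rotations act on real and imaginary parts by such rotations, and
    every unitary matrix is a product of these. *)

Lemma lebesgue_measure_shift (a : R) (A : set MR) : measurable A ->
  mu ((fun x : MR => x + a : MR) @^-1` A) = mu A.
Proof.
move=> mA; pose f (x : MR) : MR := x + a.
have mf : measurable_fun setT f by exact: measurable_funD.
rewrite [RHS](lebesgue_measure_unique (mu := pushforward mu f))//.
move=> X /ocitvP[->|[[b c]/= bc ->]]; first by rewrite !measure0.
rewrite /pushforward.
have -> : f @^-1` `]b, c] = `]b - a, c - a]%classic.
  by apply/seteqP; split => x /=; rewrite !in_itv/= /f ltrBlDr lerBrDr.
rewrite !lebesgue_measure_itv/= !lte_fin bc ltrD2r bc.
by rewrite -!EFinB; congr EFin; ring.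
Qed.

Definition shear (a : R) (z : MR * MR) : MR * MR := (z.1, z.2 + a * z.1).

Definition rotation (c s : R) (z : MR * MR) : MR * MR :=
  (c * z.1 - s * z.2, s * z.1 + c * z.2).

Definition flip (z : MR * MR) : MR * MR := (z.2, z.1).

Lemma measurable_flip : measurable_fun setT flip.
Proof. exact: measurable_fun_pair. Qed.

Lemma measurable_shear a : measurable_fun setT (shear a).
Proof.
by apply: measurable_fun_pair => //=; apply: measurable_funD => //=; exact: measurable_funM.
Qed.

Lemma measurable_rotation c s : measurable_fun setT (rotation c s).
Proof.
apply: measurable_fun_pair => /=.
  by apply: measurable_funB => /=; exact: measurable_funM.
by apply: measurable_funD => /=; exact: measurable_funM.
Qed.

Definition preserves_area (f : MR * MR -> MR * MR) :=
  measurable_fun setT f /\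
  forall E, measurable E -> mu2 (f @^-1` E) = mu2 E.

Lemma preserves_area_comp f g :
  preserves_area f -> preserves_area g -> preserves_area (g \o f).
Proof.
move=> [mf hf] [mg hg]; split; first exact: measurableT_comp.
move=> E mE; rewrite comp_preimage hf ?hg// -[X in measurable X]setTI.
exact: mg.
Qed.

Lemma preserves_area_rect f : measurable_fun setT f ->
  (forall A B : set MR, measurable A -> measurable B ->
     mu2 (f @^-1` (A `*` B)) = (mu A * mu B)%E) -> preserves_area f.
Proof.
move=> mf h; split=> // E mE.
by rewrite [RHS](product_measure_unique (m' := pushforward mu2 f)).
Qed.

Lemma preserves_area_flip : preserves_area flip.
Proof.
apply: preserves_area_rect; first exact: measurable_flip.
move=> A B mA mB; have -> : flip @^-1` (A `*` B) = B `*` A.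
  by apply/seteqP; split => -[x y] /= [].
by rewrite product_measure1E// muleC.
Qed.

(** Cavalieri's principle: over each abscissa [x] the shear translates the vertical section by
    [a * x], and translations preserve Lebesgue measure. *)
Lemma preserves_area_shear a : preserves_area (shear a).
Proof.
apply: preserves_area_rect; first exact: measurable_shear.
move=> A B mA mB; rewrite -product_measure1E// /product_measure1.
apply: eq_integral => x _ /=.
have [xA|xA] := boolP (x \in A); last first.
  rewrite notin_xsectionX// (_ : xsection _ _ = set0)//.
  apply/seteqP; split => y //=; rewrite /xsection/= inE => -[/= Ax _].
  by move: xA; rewrite notin_setE.
rewrite in_xsectionX// -(lebesgue_measure_shift (a * x) mB); congr (mu _).
apply/seteqP; split => y /=; rewrite /xsection/= inE /shear/=.
  by case.
by move=> By; split => //; rewrite inE in xA.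
Qed.

(* A rotation is a product of three shears. *)
Lemma preserves_area_rotation c s : s != 0 -> c ^+ 2 + s ^+ 2 = 1 ->
  preserves_area (rotation c s).
Proof.
(* With c = cos t and s = sin t, [a] is -tan(t/2). The two outer shears act on the first coordinate,
   hence the conjugation by [flip]. *)
move=> s0 cs1; pose a := (c - 1) / s.
pose shx := flip \o shear a \o flip.
have pshx : preserves_area shx.
  apply: preserves_area_comp; first exact: preserves_area_flip.
  apply: preserves_area_comp; [exact: preserves_area_shear|exact: preserves_area_flip].
suff -> : rotation c s = shx \o shear s \o shx.
  apply: preserves_area_comp => //.
  by apply: preserves_area_comp => //; exact: preserves_area_shear.
have ea : a * s = c - 1 by rewrite /a divfK.
have es : a * c + a = - s.
  apply: (mulfI s0); rewrite /a.
  have -> : s * ((c - 1) / s * c + (c - 1) / s) = (c ^+ 2 - 1) by field.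
  by rewrite -cs1; ring.
apply/funext => -[x y]; rewrite /rotation /shx /shear /flip /=; congr pair.
  rewrite -[- (s * y)]mulNr -es.
  have -> : x + a * y + a * (y + s * (x + a * y)) =
    (1 + a * s) * x + (a * (1 + a * s) + a) * y by ring.
  by rewrite ea; ring.
have -> : y + s * (x + a * y) = s * x + (1 + a * s) * y by ring.
by rewrite ea; ring.
Qed.

End PlaneRotation.

(** * Rotation invariance of two independent normals *)

Section GaussianRotation.
Context {R : realType}.
Variable sg : R.
Local Notation mu := (@lebesgue_measure R).
Local Notation MR := (measurableTypeR R).
Local Notation mu2 := (mu \x mu)%E.
Local Notation N := (normal_prob (0 : R) sg).
Local Notation pdf := (normal_pdf (0 : R) sg).

Let g2 (z : MR * MR) : \bar R := (pdf z.1 * pdf z.2)%:E.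

Let g2_ge0 z : (0 <= g2 z)%E.
Proof. by rewrite lee_fin mulr_ge0// normal_pdf_ge0. Qed.

Let mg2 : measurable_fun setT g2.
Proof.
apply/measurable_EFinP; apply: measurable_funM => /=.
  by apply: measurableT_comp => //; exact: measurable_normal_pdf.
by apply: measurableT_comp => //; exact: measurable_normal_pdf.
Qed.

(** The product of two normal laws in density form with respect to area. It is made a measure so
    that uniqueness of product measures can identify it with that product. *)
Definition plane_gaussian (E : set (MR * MR)) : \bar R :=
  (\int[mu2]_(z in E) (pdf z.1 * pdf z.2)%:E)%E.

Let plane_gaussian0 : plane_gaussian set0 = 0%E.
Proof. exact: integral_set0. Qed.

Let plane_gaussian_ge0 E : (0 <= plane_gaussian E)%E.
Proof. by apply: integral_ge0 => z _; exact: g2_ge0. Qed.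

Let plane_gaussian_sigma_additive : semi_sigma_additive plane_gaussian.
Proof. exact: semi_sigma_additive_nng_induced mg2 g2_ge0. Qed.

HB.instance Definition _ := isMeasure.Build _ _ _ plane_gaussian
  plane_gaussian0 plane_gaussian_ge0 plane_gaussian_sigma_additive.

Lemma plane_gaussianE (E : set (MR * MR)) : measurable E ->
  (N \x N)%E E = plane_gaussian E.
Proof.
move=> mE; apply: product_measure_unique => // A B mA mB.
rewrite -[LHS]/(\int[mu2]_(z in A `*` B) g2 z)%E integral_mkcond.
have mAB : measurable (A `*` B) by exact: measurableX.
rewrite fubini_tonelli1//; last 2 first.
- by apply/measurable_restrict => //; exact: measurable_funTS.
- by move=> z; apply: erestrict_ge0 => ? _; exact: g2_ge0.
rewrite /fubini_F /=.
have mpdf := measurable_normal_pdf (0 : R) sg.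
transitivity (\int[mu]_x (((pdf \_ A) x)%:E * N B))%E.
  apply: eq_integral => x _.
  rewrite [in RHS]/normal_prob -ge0_integralZl//; last 3 first.
  - by apply/measurable_EFinP; exact: measurable_funTS.
  - by move=> y _; rewrite lee_fin normal_pdf_ge0.
  - by rewrite lee_fin patchE; case: ifPn => // _; exact: normal_pdf_ge0.
  rewrite [in RHS]integral_mkcond; apply: eq_integral => y _.
  rewrite !patchE in_setX /=; case: (x \in A); case: (y \in B) => //=.
  by rewrite mul0e.
rewrite ge0_integralZr//.
- by rewrite /normal_prob [in RHS]integral_mkcond; congr (_ * _)%E;
    apply: eq_integral => x _; rewrite !patchE; case: ifP.
- apply/measurable_EFinP/measurable_restrict => //; exact: measurable_funTS.
- by move=> x _; rewrite lee_fin patchE; case: ifPn => // _; exact: normal_pdf_ge0.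
Qed.

(** The joint density depends only on x^2 + y^2, and rotations preserve area. The factorization into
    shears divides by the sine, so a zero sine is treated apart. *)
Lemma gaussian_rotation (c s : R) (E : set (MR * MR)) : sg != 0 ->
  c ^+ 2 + s ^+ 2 = 1 -> measurable E ->
  (N \x N)%E (rotation c s @^-1` E) = (N \x N)%E E.
Proof.
move=> sg0 cs1 mE.
have rot c' s' : s' != 0 -> c' ^+ 2 + s' ^+ 2 = 1 -> forall F, measurable F ->
    measurable (rotation c' s' @^-1` F) /\
    (N \x N)%E (rotation c' s' @^-1` F) = (N \x N)%E F.
  move=> s0 cs F mF; have mr := measurable_rotation c' s'.
  have mrF : measurable (rotation c' s' @^-1` F).
    by rewrite -[X in measurable X]setTI; exact: mr.
  split=> //; rewrite !plane_gaussianE//.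
  transitivity (\int[mu2]_(z in rotation c' s' @^-1` F) (g2 \o rotation c' s') z)%E.
    apply: eq_integral => -[x y] _; rewrite /g2 /= !normal_pdfE//=.
    rewrite mulrACA [in RHS]mulrACA /normal_fun -!expRD; congr (_ * expR _)%:E.
    rewrite !subr0 !mulNr -!opprD -!mulrDl; congr (- (_ * _)).
    by rewrite -[LHS]mul1r -cs; ring.
  have [_ h] := preserves_area_rotation s0 cs.
  transitivity (\int[pushforward mu2 (rotation c' s')]_(z in F) g2 z)%E.
    apply: esym; apply: (@ge0_integral_pushforward _ _ _ _ R _ mr mu2 F g2 mF).
      exact: measurable_funTS.
    by move=> z _; exact: g2_ge0.
  by apply: eq_measure_integral => A mA _; exact: h.
(* A zero sine leaves the identity or its opposite; the opposite is the quarter turn applied twice,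
   and a quarter turn has sine one. *)
have [s0|s0] := eqVneq s 0; last by have [] := rot c s s0 cs1 E mE.
have [c1|c1] : c = 1 \/ c = -1.
  move: cs1; rewrite s0 expr0n addr0 => /eqP; rewrite sqrf_eq1.
  by case/orP => /eqP; [left|right].
- congr ((N \x N)%E _); apply/seteqP; split => -[x y] /=;
    by rewrite /rotation /= s0 c1 !mul1r !mul0r subr0 add0r.
- have r01 : (0 : R) ^+ 2 + 1 ^+ 2 = 1 by rewrite expr0n expr1n add0r.
  have o0 : (1 : R) != 0 by exact: oner_neq0.
  have [m1 e1] := rot 0 1 o0 r01 E mE; have [_ e2] := rot 0 1 o0 r01 _ m1.
  rewrite -e1 -e2; congr ((N \x N)%E _); apply/seteqP; split => -[x y] /=;
    by rewrite /rotation /= s0 c1 !(mul0r, mul1r, sub0r, add0r, addr0, subr0, mulN1r).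
Qed.

End GaussianRotation.

(** Rectangles form a pi-system generating the product sigma-algebra. Neither measure has to be
    given as a product, so this applies to the joint law of two variables restricted to an event. *)
Lemma finite_measure_prod_unique d1 d2 (T1 : measurableType d1)
    (T2 : measurableType d2) (R : realType)
    (m1 m2 : {measure set (T1 * T2) -> \bar R}) :
  (m1 setT < +oo)%E ->
  (forall A B, measurable A -> measurable B -> m1 (A `*` B) = m2 (A `*` B)) ->
  forall E, measurable E -> m1 E = m2 E.
Proof.
move=> fin h E mE.
pose G := [set C : set (T1 * T2) |
  exists A, measurable A /\ exists B, measurable B /\ C = A `*` B].
apply: (measure_unique G (fun=> setT)) => //.
- rewrite measurable_prod_measurableType //; congr (<<s _ >>).
  rewrite predeqE; split => [[A mA [B mB <-]]|[A [mA [B [mB ->]]]]].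
    by exists A; split => //; exists B.
  by exists A => //; exists B.
- move=> /= _ _ [X1 [mX1 [X2 [mX2 ->]]]] [Y1 [mY1 [Y2 [mY2 ->]]]].
  rewrite -setXI; exists (X1 `&` Y1); split; first exact: measurableI.
  by exists (X2 `&` Y2); split => //; exact: measurableI.
- by move=> _; exists setT; split=> //; exists setT; rewrite setXTT.
- by rewrite bigcup_const//; exists 0%N.
- by move=> A [A1 [mA1 [A2 [mA2 ->]]]]; exact: h.
Qed.

(** * Rotations inside a family of independent normals *)

Section GaussianFamily.
Context {R : realType} {d : measure_display} {T : measurableType d}.
Variables (P : probability T R) (K : finType) (sg : R).
Hypothesis sg0 : sg != 0.
Local Notation MR := (measurableTypeR R).
Local Notation N := (normal_prob (0 : R) sg).

(** Common law and independence in a single product formula over the whole index type; taking [setT]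
    at the other indices recovers marginals and subfamilies. *)
Definition iid_normal (X : K -> T -> MR) : Prop :=
  (forall k, measurable_fun setT (X k)) /\
  forall B : K -> set MR, (forall k, measurable (B k)) ->
    P (\bigcap_k (X k @^-1` B k)) = (\prod_k fine (N (B k)))%:E.

Definition rotate_pair (a b : K) (c s : R) (X : K -> T -> MR) : K -> T -> MR :=
  fun k w => if k == a then c * X a w - s * X b w
             else if k == b then s * X a w + c * X b w else X k w.

(** Restricted to an event on the remaining coordinates, the joint law of the coordinates [a] and
    [b] is a multiple of the planar Gaussian law, hence invariant under the rotation. *)
Lemma iid_normal_rotate_pair a b c s X : a != b -> c ^+ 2 + s ^+ 2 = 1 ->
  iid_normal X -> iid_normal (rotate_pair a b c s X).
Proof.
move=> ab cs1 [mX iX]; split.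
  move=> k; rewrite /rotate_pair; case: (k == a).
    by apply: measurable_funB; apply: measurable_funM => //; exact: mX.
  case: (k == b); last exact: mX.
  by apply: measurable_funD; apply: measurable_funM => //; exact: mX.
move=> B mB.
(* The event that the coordinates other than [a] and [b] fall in their sets; [cQ] below is its
   probability. *)
pose Q := \bigcap_k (X k @^-1` (if (k == a) || (k == b) then setT else B k)).
have mXk k (A : set MR) : measurable A -> measurable (X k @^-1` A).
  by move=> mA; rewrite -[X in measurable X]setTI; exact: mX.
have mQ : measurable Q.
  by apply: fin_bigcap_measurable => // k _; apply: mXk; case: ifP.
pose Y w : MR * MR := (X a w, X b w).
have mY : measurable_fun setT Y by exact: measurable_fun_pair.
pose cQ : R := \prod_(k | (k != a) && (k != b)) fine (N (B k)).
have cQ0 : 0 <= cQ by apply: prodr_ge0 => k _; exact: fine_ge0.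
have big2 (F : K -> R) : \prod_k F k =
    F a * F b * \prod_(k | (k != a) && (k != b)) F k.
  by rewrite (bigD1 a)//= (bigD1 b) ?(eq_sym b)//= mulrA.
have key E : measurable E ->
    P (Y @^-1` E `&` Q) = (cQ%:E * (N \x N) E)%E.
  pose m1 := pushforward (mrestr P mQ) Y.
  pose m2 := mscale (NngNum cQ0) (N \x N)%E.
  move=> mE; transitivity (m1 E) => //; transitivity (m2 E) => //.
  apply: finite_measure_prod_unique => //.
    rewrite /m1/= /pushforward/= /mrestr/= preimage_setT setTI.
    by rewrite (le_lt_trans (probability_le1 _ mQ)) ?ltry.
  move=> A B0 mA mB0.
  rewrite /m1 /m2/= /mscale/= /pushforward/= /mrestr/= product_measure1E//.
  have -> : Y @^-1` (A `*` B0) `&` Q =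
     \bigcap_k (X k @^-1` (if k == a then A else if k == b then B0 else B k)).
    apply/seteqP; split => w.
      move=> [[/= Aw Bw] Qw] k _ /=; have := Qw k I => /=.
      by have [->|ka]//= := eqVneq k a; have [->|kb] := eqVneq k b.
    move=> h; split; first split => /=.
    - by have /= := h a I; rewrite eqxx.
    - by have /= := h b I; rewrite eq_sym (negbTE ab) eqxx.
    - by move=> k _ /=; have /= := h k I; case: (k == a); case: (k == b).
  rewrite iX => [|k]; last by case: ifP => // _; case: ifP.
  rewrite big2 eqxx eq_sym (negbTE ab) eqxx EFinM EFinM !fineK ?fin_num_measure//.
  rewrite muleC; congr (_%:E * _)%E; apply: eq_bigr => k /andP[ka kb].
  by rewrite (negbTE ka) (negbTE kb).
have -> : \bigcap_k (rotate_pair a b c s X k @^-1` B k) =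
    Y @^-1` (rotation c s @^-1` (B a `*` B b)) `&` Q.
  apply/seteqP; split => w.
    move=> h; split.
      split; first by have := h a I; rewrite /rotate_pair /= eqxx.
      by have := h b I; rewrite /rotate_pair /= eq_sym (negbTE ab) eqxx.
    move=> k _ /=; have := h k I; rewrite /rotate_pair /=.
    by case: (k == a) => //=; case: (k == b).
  move=> [[/= h1 h2] h3] k _; have := h3 k I; rewrite /rotate_pair /=.
  by have [->|ka]//= := eqVneq k a; have [->|kb] := eqVneq k b.
have mBB : measurable (B a `*` B b) by exact: measurableX.
rewrite key; last first.
  rewrite -[X in measurable X]setTI; exact: measurable_rotation.
rewrite gaussian_rotation// product_measure1E// big2.
by rewrite [RHS]EFinM EFinM !fineK ?fin_num_measure// muleC.
Qed.

Variables (J : eqType) (col : K -> J) (al be : J -> K).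
Hypotheses (col_al : forall j, col (al j) = j) (col_be : forall j, col (be j) = j).
Hypothesis al_be : forall j, al j != be j.

(** One rotation per selected column, in the plane of the cells [al j] and [be j]. The map [col]
    keeps these pairs disjoint, so the rotations can be performed one at a time. Left multiplication
    by a phase or a Givens rotation decomposes in this way. *)
Definition rotate_columns (S : pred J) c s (X : K -> T -> MR) : K -> T -> MR :=
  fun k w => if S (col k) then
    if k == al (col k) then c * X k w - s * X (be (col k)) w
    else if k == be (col k) then s * X (al (col k)) w + c * X k w else X k w
  else X k w.

Lemma iid_normal_rotate_columns (S : seq J) c s X : c ^+ 2 + s ^+ 2 = 1 ->
  iid_normal X -> iid_normal (rotate_columns (mem S) c s X).
Proof.
move=> cs1 iX; elim: S => [|j S IH].
  by have -> : rotate_columns (mem [::]) c s X = X.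
have [jS|jS] := boolP (j \in S).
  have -> // : rotate_columns (mem (j :: S)) c s X = rotate_columns (mem S) c s X.
  apply/funext => k; apply/funext => w; rewrite /rotate_columns /= !inE.
  by case: eqVneq => [->|]//=; rewrite jS.
have -> : rotate_columns (mem (j :: S)) c s X =
    rotate_pair (al j) (be j) c s (rotate_columns (mem S) c s X).
  apply/funext => k; apply/funext => w; rewrite /rotate_columns /rotate_pair /= !inE.
  rewrite col_al col_be (negbTE jS).
  have [kj|kj] := eqVneq (col k) j.
    rewrite kj (negbTE jS) /=; have [->|ka]// := eqVneq k (al j).
    by have [->|kb] := eqVneq k (be j).
  have [e|_] := eqVneq k (al j); first by rewrite e col_al eqxx in kj.
  have [e|_] := eqVneq k (be j); first by rewrite e col_be eqxx in kj.
  by [].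
exact: iid_normal_rotate_pair.
Qed.

End GaussianFamily.

(** * The law of a family of independent normals *)

Section GaussianLaw.
Context {R : realType} {d : measure_display} {T : measurableType d}.
Variables (P : probability T R) (K : finType) (sg : R).
Local Notation MR := (measurableTypeR R).
Local Notation tup := (#|K|.-tuple MR).

Definition family_tuple (X : K -> T -> MR) (w : T) : tup :=
  [tuple X (enum_val i) w | i < #|K|].

Lemma measurable_family_tuple X : (forall k, measurable_fun setT (X k)) ->
  measurable_fun setT (family_tuple X).
Proof.
move=> mX; apply/measurable_fun_tnthP => i.
rewrite (_ : _ \o _ = X (enum_val i)); first exact: mX.
by apply/funext => w; rewrite /= tnth_mktuple.
Qed.

Let box : set (set tup) := [set C | exists2 B : 'I_#|K| -> set MR,
  (forall i, measurable (B i)) &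
  C = \bigcap_i ((@tnth _ MR)^~ i @^-1` B i)].

Let measurable_boxE : @measurable _ tup = <<s box >>.
Proof.
have coorm (i : 'I_#|K|) (B : set MR) : measurable B ->
    measurable ((fun t : tup => tnth t i) @^-1` B).
  by move=> mB; rewrite -[X in measurable X]setTI; exact: measurable_tnth.
apply/seteqP; split.
  apply: smallest_sub; first exact: smallest_sigma_algebra.
  rewrite -bigcup_seq; apply: bigcup_sub => i _ _ [B mB <-].
  apply: sub_sigma_algebra; exists (fun j => if j == i then B else setT).
    by move=> j; case: ifP.
  rewrite setTI; apply/seteqP; split => t /=.
    by move=> h j _ /=; case: eqVneq => // ->.
  by move=> h; have := h i I; rewrite /= eqxx.
apply: smallest_sub; first exact: sigma_algebra_measurable.
move=> _ [B mB ->].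
by apply: fin_bigcap_measurable => [|i _]; [exact: finite_finset|exact: coorm].
Qed.

(** Boxes are a pi-system generating the sigma-algebra of tuples, and the product formula prescribes
    the probability of every box. *)
Lemma iid_normal_law (X X' : K -> T -> MR) :
  iid_normal P sg X -> iid_normal P sg X' ->
  forall E : set tup, measurable E ->
  P (family_tuple X @^-1` E) = P (family_tuple X' @^-1` E).
Proof.
move=> [mX iX] [mX' iX'] E mE.
have mf := measurable_family_tuple mX; have mf' := measurable_family_tuple mX'.
apply: (measure_unique box (fun=> setT) _ _ _ _
  (pushforward P (family_tuple X)) (pushforward P (family_tuple X'))) => //.
- move=> _ _ [B mB ->] [B' mB' ->]; exists (fun i => B i `&` B' i).
    by move=> i; exact: measurableI.
  by rewrite -bigcapI; apply: eq_bigcapr => i _; rewrite preimage_setI.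
- by move=> _; exists (fun=> setT) => //; rewrite bigcapT.
- by rewrite bigcup_const//; exists 0%N.
- move=> _ [B mB ->]; rewrite /= /pushforward.
  have h Y : family_tuple Y @^-1` (\bigcap_i ((@tnth _ MR)^~ i @^-1` B i)) =
      \bigcap_k (Y k @^-1` B (enum_rank k)).
    apply/seteqP; split => w.
      by move=> /= h k _; have := h (enum_rank k) I; rewrite /= tnth_mktuple enum_rankK.
    move=> h i _; rewrite /= tnth_mktuple; have := h (enum_val i) I.
    by rewrite /= enum_valK.
  by rewrite !h iX// iX'.
- by rewrite /= /pushforward preimage_setT probability_setT ltry.
Qed.

Lemma iid_normal_integral (X X' : K -> T -> MR) (f : tup -> \bar R) :
  iid_normal P sg X -> iid_normal P sg X' ->
  measurable_fun setT f -> (forall t, (0 <= f t)%E) ->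
  (\int[P]_w f (family_tuple X w) = \int[P]_w f (family_tuple X' w))%E.
Proof.
move=> iX iX' mf f0.
have h Y : iid_normal P sg Y ->
    (\int[P]_w f (family_tuple Y w) = \int[pushforward P (family_tuple Y)]_t f t)%E.
  move=> [mY _]; apply: esym.
  by apply: (@ge0_integral_pushforward _ _ _ _ R _ (measurable_family_tuple mY) P
    setT f) => // t _; exact: f0.
rewrite !h//; have [mX _] := iX; have [mX' _] := iX'.
apply: eq_measure_integral => [||mX0 mX1 A mA _].
- exact: measurable_family_tuple.
- exact: measurable_family_tuple.
exact: iid_normal_law.
Qed.

End GaussianLaw.

(** * Finite second moment of a normal law *)

Section NormalMoment.
Context {R : realType}.
Variable sg : R.
Hypothesis sg0 : sg != 0.
Local Notation N := (normal_prob (0 : R) sg).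
Local Notation mu := (@lebesgue_measure R).

(** The density times x^2 is dominated by a multiple of the normal density with twice the standard
    deviation, whose integral is one. The passage to Lebesgue measure identifies the density with
    the Radon-Nikodym derivative almost everywhere. *)
Lemma normal_second_moment : (\int[N]_x (x ^+ 2)%:E < +oo)%E.
Proof.
have nd := normal_prob_dominates (0 : R) sg.
have msq : measurable_fun setT (fun x : measurableTypeR R => (x ^+ 2)%:E).
  by apply/measurable_EFinP; exact: measurable_funX.
rewrite -(Radon_Nikodym_SigmaFinite.change_of_variables nd)//; last first.
  by move=> x; rewrite lee_fin sqr_ge0.
have mpdf : measurable_fun setT (fun x => (normal_pdf (0 : R) sg x)%:E).
  by apply/measurable_EFinP; exact: measurable_normal_pdf.
have mRN : measurable_fun setT (Radon_Nikodym_SigmaFinite.f N mu).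
  exact: measurable_int (Radon_Nikodym_SigmaFinite.f_integrable nd).
have ae : ae_eq mu setT (Radon_Nikodym_SigmaFinite.f N mu)
    (fun x => (normal_pdf (0 : R) sg x)%:E).
  apply: integral_ae_eq => //.
    exact: Radon_Nikodym_SigmaFinite.f_integrable.
  by move=> E _ mE; rewrite -Radon_Nikodym_SigmaFinite.f_integral.
rewrite (ae_eq_integral (fun x : measurableTypeR R =>
  (x ^+ 2)%:E * (normal_pdf (0 : R) sg x)%:E)%E)//.
(* With y = x^2 / (4 sg^2), one has x^2 exp(-x^2 / (2 sg^2)) = 4 sg^2 y exp(-2y), y exp(-y) <= 1,
   and exp(-y) is at most the wider exponential exp(-y/2). The quotient of the peaks converts the
   normalization. *)
- pose k := 4 * sg ^+ 2 * normal_peak sg / normal_peak (2 * sg).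
  have sg20 : 2 * sg != 0 by rewrite mulf_neq0.
  have k0 : 0 <= k.
    apply: divr_ge0; last exact: normal_peak_ge0.
    by apply: mulr_ge0; [rewrite mulr_ge0// sqr_ge0|exact: normal_peak_ge0].
  apply: (@le_lt_trans _ _ (\int[mu]_x (k%:E * (normal_pdf (0 : R) (2 * sg) x)%:E))%E).
    apply: ge0_le_integral => //.
    + by move=> x _; rewrite -EFinM lee_fin mulr_ge0 ?sqr_ge0 ?normal_pdf_ge0.
    + exact: emeasurable_funM.
    + by apply: emeasurable_funM => //; apply/measurable_EFinP; exact: measurable_normal_pdf.
    move=> x _; rewrite -!EFinM lee_fin !normal_pdfE//= /normal_fun subr0.
    set p := normal_peak sg; set u := expR (- _ / _); set q := normal_peak _.
    set v := expR (- _ / _).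
    have q0 : q != 0 by rewrite gt_eqF ?normal_peak_gt0.
    have -> : k * (q * v) = p * (4 * sg ^+ 2 * v) by rewrite /k -/p -/q; field.
    rewrite mulrCA; apply: ler_wpM2l; first exact: normal_peak_ge0.
    pose y := x ^+ 2 / (4 * sg ^+ 2).
    have y0 : 0 <= y by rewrite divr_ge0 ?sqr_ge0// mulr_ge0// sqr_ge0.
    have eu : u = expR (- y) * expR (- y).
      by rewrite -expRD /u /y; congr expR; rewrite -mulr_natr; field.
    have -> : x ^+ 2 * u = 4 * sg ^+ 2 * (y * (expR (- y) * expR (- y))).
      by rewrite eu /y; field.
    apply: ler_wpM2l; first by rewrite mulr_ge0// sqr_ge0.
    rewrite mulrA -[leRHS]mul1r; apply: ler_pM.
    - by rewrite mulr_ge0// expR_ge0.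
    - exact: expR_ge0.
    - rewrite expRN ler_pdivrMr ?expR_gt0// mul1r.
      by apply: le_trans (expR_ge1Dx _); rewrite lerDr.
    rewrite /v ler_expR mulNr lerN2 /y -mulr_natr.
    apply: ler_wpM2l; first exact: sqr_ge0.
    rewrite lef_pV2 ?posrE; last 2 first.
    + by rewrite mulr_gt0// exprn_even_gt0/=.
    + by rewrite mulr_gt0// exprn_even_gt0/=.
    have := sqr_ge0 sg; rewrite exprMn; lra.
  rewrite ge0_integralZl//=.
  + by rewrite integral_normal_pdf mule1 ltry.
  + by apply/measurable_EFinP; exact: measurable_normal_pdf.
  + by move=> x _; rewrite lee_fin normal_pdf_ge0.
- exact: emeasurable_funM.
- exact: emeasurable_funM.
- exact: ae_eqe_mul2l.
Qed.

End NormalMoment.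

Local Open Scope sesquilinear_scope.

(** * Positive semidefinite matrices *)

Section Adjoint.
Variable C : numClosedFieldType.

Lemma sub_mxE m n (A B : 'M[C]_(m, n)) i j : (A - B) i j = A i j - B i j.
Proof. by rewrite !mxE. Qed.

Lemma scale_mxE m n a (A : 'M[C]_(m, n)) i j : (a *: A) i j = a * A i j.
Proof. by rewrite mxE. Qed.

Lemma adjM m n p (A : 'M[C]_(m, n)) (B : 'M[C]_(n, p)) :
  (A *m B)^t* = B^t* *m A^t*.
Proof. by rewrite trmx_mul map_mxM. Qed.

Lemma adjD m n (A B : 'M[C]_(m, n)) : (A + B)^t* = A^t* + B^t*.
Proof. by rewrite linearD /= map_mxD. Qed.

Lemma adjB m n (A B : 'M[C]_(m, n)) : (A - B)^t* = A^t* - B^t*.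
Proof. by rewrite linearB /= map_mxB. Qed.

Lemma adjZ m n a (A : 'M[C]_(m, n)) : (a *: A)^t* = a^* *: A^t*.
Proof. by rewrite linearZ /= map_mxZ. Qed.

Lemma adj1 n : (1%:M : 'M[C]_n)^t* = 1%:M.
Proof. by rewrite trmx1 map_mx1. Qed.

Lemma adj0 m n : (0 : 'M[C]_(m, n))^t* = 0.
Proof. by rewrite trmx0 map_mx0. Qed.

Lemma adj_inv n (A : 'M[C]_n) : (invmx A)^t* = invmx (A^t*).
Proof. by rewrite trmx_inv map_invmx. Qed.

Lemma adj_diag n (l : 'rV[C]_n) :
  (diag_mx l)^t* = diag_mx (map_mx Num.conj l).
Proof. by rewrite tr_diag_mx map_diag_mx. Qed.

Lemma unitarymxK n (U : 'M[C]_n) : U \is unitarymx -> U *m U^t* = 1%:M.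
Proof. exact: unitarymxP. Qed.

Lemma unitarymxV n (U : 'M[C]_n) : U \is unitarymx -> U^t* *m U = 1%:M.
Proof. by rewrite -trmxC_unitary => /unitarymxP; rewrite trmxCK. Qed.

Lemma det_conj_unitary n (U X : 'M[C]_n) : U \is unitarymx ->
  \det (U *m X *m U^t*) = \det X.
Proof.
move=> /unitarymxP/(congr1 determinant); rewrite !det_mulmx det1 => e.
by rewrite mulrAC e mul1r.
Qed.

Lemma tr_conj_unitary n (U X : 'M[C]_n) : U \is unitarymx ->
  \tr (U *m X *m U^t*) = \tr X.
Proof. by move=> /unitarymxV e; rewrite mxtrace_mulC mulmxA e mul1mx. Qed.

(** Sylvester's identity: the block matrix [X] is made triangular from the right in two ways, each
    time by a factor of determinant one. *)
Lemma det_1D_mulC m n (A : 'M[C]_(m, n)) (B : 'M[C]_(n, m)) :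
  \det (1%:M + A *m B) = \det (1%:M + B *m A).
Proof.
pose X := block_mx 1%:M (- A) B 1%:M.
have h1 : X *m block_mx 1%:M A 0 1%:M = block_mx 1%:M 0 B (1%:M + B *m A).
  by rewrite mulmx_block !mulmx1 !mulmx0 !mul1mx !addr0 subrr addrC.
have h2 : X *m block_mx 1%:M 0 (- B) 1%:M = block_mx (1%:M + A *m B) (- A) 0 1%:M.
  by rewrite mulmx_block !mulmx1 !mulmx0 !mul1mx !add0r mulNmx mulmxN opprK addrN.
have := congr1 determinant h1; have := congr1 determinant h2.
rewrite !det_mulmx !det_lblock !det_ublock !det1 !mulr1 !mul1r => -> ->.
by [].
Qed.

End Adjoint.

Section Psd.
Variable C : numClosedFieldType.

Definition psd n (Q : 'M[C]_n) : Prop :=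
  Q^t* = Q /\ forall x : 'cV[C]_n, 0 <= (x^t* *m Q *m x) 0 0.

Lemma psd_congr m n (T : 'M[C]_(m, n)) (Q : 'M[C]_m) :
  psd Q -> psd (T^t* *m Q *m T).
Proof.
move=> [h p]; split; first by rewrite !adjM trmxCK h mulmxA.
by move=> x; have := p (T *m x); rewrite adjM !mulmxA.
Qed.

Lemma psd_congr' m n (T : 'M[C]_(n, m)) (Q : 'M[C]_m) :
  psd Q -> psd (T *m Q *m T^t*).
Proof. by move=> /(psd_congr (T^t*)); rewrite trmxCK. Qed.

Lemma psdD n (P Q : 'M[C]_n) : psd P -> psd Q -> psd (P + Q).
Proof.
move=> [hP pP] [hQ pQ]; split; first by rewrite adjD hP hQ.
by move=> x; rewrite mulmxDr mulmxDl mxE addr_ge0.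
Qed.

Lemma psdZ n a (P : 'M[C]_n) : 0 <= a -> psd P -> psd (a *: P).
Proof.
move=> a0 [hP pP]; split; first by rewrite adjZ hP (CrealP _) ?ger0_real.
by move=> x; rewrite -scalemxAr -scalemxAl mxE mulr_ge0.
Qed.

Lemma cV_normE n (x : 'cV[C]_n) : (x^t* *m x) 0 0 = \sum_i `|x i 0| ^+ 2.
Proof. by rewrite mxE; apply: eq_bigr => i _; rewrite !mxE normCK mulrC. Qed.

Lemma psd1 n : psd (1%:M : 'M[C]_n).
Proof.
split; first exact: adj1.
by move=> x; rewrite mulmx1 cV_normE sumr_ge0// => i _; rewrite exprn_ge0.
Qed.

Lemma psd_gram m n (T : 'M[C]_(m, n)) : psd (T^t* *m T).
Proof. by have := psd_congr T (psd1 m); rewrite mulmx1. Qed.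

Lemma psd_gram' m n (T : 'M[C]_(m, n)) : psd (T *m T^t*).
Proof. by have := psd_gram (T^t*); rewrite trmxCK. Qed.

Lemma psd_scalar n (a : C) : 0 <= a -> psd (a%:M : 'M[C]_n).
Proof. by move=> a0; rewrite -scalemx1; exact/psdZ/psd1. Qed.

Lemma psd_diag n (l : 'rV[C]_n) : (forall i, 0 <= l 0 i) -> psd (diag_mx l).
Proof.
move=> l0; have -> : diag_mx l =
    (diag_mx (map_mx sqrtC l))^t* *m diag_mx (map_mx sqrtC l).
  rewrite adj_diag mulmx_diag; congr diag_mx; apply/rowP => i; rewrite !mxE.
  have r : 0 <= sqrtC (l 0 i) by rewrite sqrtC_ge0.
  by rewrite (CrealP _) ?ger0_real// -expr2 sqrtCK.
exact: psd_gram.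
Qed.

Lemma psd_entry_ge0 n (Q : 'M[C]_n) i : psd Q -> 0 <= Q i i.
Proof.
move=> [_ /(_ (delta_mx i 0))].
rewrite trmx_delta map_delta_mx -rowE; set a := (X in 0 <= X).
suff -> : a = Q i i by [].
by rewrite /a -colE !mxE.
Qed.

Lemma psd_tr_ge0 n (Q : 'M[C]_n) : psd Q -> 0 <= \tr Q.
Proof. by move=> pQ; apply: sumr_ge0 => i _; exact: psd_entry_ge0. Qed.

Lemma psd_spectral n (Q : 'M[C]_n) : psd Q ->
  exists U (l : 'rV[C]_n), [/\ U \is unitarymx, forall i, 0 <= l 0 i &
    Q = U *m diag_mx l *m U^t*].
Proof.
move=> [h p].
have hQ : Q \is hermsymmx by apply/is_hermitianmxP; rewrite scale1r h.
have /hermitian_normalmx /orthomx_spectralP := hQ.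
set U := spectralmx Q; set l := spectral_diag Q => e.
have uU : U \is unitarymx by exact: spectral_unitarymx.
move: U l e uU => U l e uU.
exists (U^t*), l; split; first by rewrite trmxC_unitary.
  move=> i; have := psd_entry_ge0 i (psd_congr' U (conj h p)).
  rewrite e invmx_unitary// !mulmxA. rewrite (unitarymxK uU) mul1mx -mulmxA.
  by rewrite (unitarymxK uU) mulmx1 mxE eqxx mulr1n.
by rewrite trmxCK {1}e invmx_unitary.
Qed.

Lemma psd_sqrt n (Q : 'M[C]_n) : psd Q -> exists T : 'M[C]_n, Q = T *m T^t*.
Proof.
move=> /psd_spectral[U [l [uU l0 ->]]].
exists (U *m diag_mx (map_mx sqrtC l)).
rewrite adjM !mulmxA; congr (_ *m _); rewrite -mulmxA; congr (_ *m _).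
rewrite adj_diag mulmx_diag; congr diag_mx; apply/rowP => i; rewrite !mxE.
have r : 0 <= sqrtC (l 0 i) by rewrite sqrtC_ge0.
by rewrite (CrealP _) ?ger0_real// -expr2 sqrtCK.
Qed.

Lemma psd_eigen n (Q : 'M[C]_n) : psd Q ->
  exists2 l : 'rV[C]_n, forall i, 0 <= l 0 i &
    \tr Q = \sum_i l 0 i /\
    forall a b, \det (a%:M + b *: Q) = \prod_i (a + b * l 0 i).
Proof.
move=> /psd_spectral[U [l [uU l0 ->]]]; exists l => //; split.
  by rewrite tr_conj_unitary// mxtrace_diag.
move=> a b; have -> : a%:M + b *: (U *m diag_mx l *m U^t*) =
    U *m diag_mx (const_mx a + b *: l) *m U^t*.
  rewrite linearD linearZ /= diag_const_mx mulmxDr mulmxDl scalar_mxC.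
  by rewrite mulmxtVK// -scalemxAr scalemxAl.
rewrite det_conj_unitary// det_diag; apply: eq_bigr => i _.
by rewrite !mxE.
Qed.

Lemma psd_det_ge0 n (Q : 'M[C]_n) : psd Q -> 0 <= \det Q.
Proof.
move=> /psd_eigen[l l0 [_ /(_ 0 1)]].
by rewrite raddf0 add0r scale1r => ->; apply: prodr_ge0 => i _; rewrite add0r mul1r.
Qed.

Lemma det_1D_ge1 n (Q : 'M[C]_n) : psd Q -> 1 <= \det (1%:M + Q).
Proof.
move=> /psd_eigen[l l0 [_ /(_ 1 1)]]; rewrite scale1r => ->.
by apply: (big_ind (fun x => 1 <= x)) => // [x y|i _];
  [exact: mulr_ege1|rewrite mul1r lerDl].
Qed.

Lemma det_aD_gt0 n a (Q : 'M[C]_n) : 0 < a -> psd Q -> 0 < \det (a%:M + Q).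
Proof.
move=> a0 /psd_eigen[l l0 [_ /(_ a 1)]]; rewrite scale1r => ->.
by apply: prodr_gt0 => i _; rewrite mul1r ltr_wpDr.
Qed.

Lemma unit_aD n a (Q : 'M[C]_n) : 0 < a -> psd Q -> a%:M + Q \in unitmx.
Proof. by move=> a0 pQ; rewrite unitmxE unitfE gt_eqF// det_aD_gt0. Qed.

Lemma psd_inv n (P : 'M[C]_n) : psd P -> psd (invmx P).
Proof.
move=> pP; have [u|u] := boolP (P \in unitmx); last by rewrite /invmx (negbTE u).
have := psd_congr (invmx P) pP; have [h _] := pP.
by rewrite adj_inv h mulVmx// mul1mx.
Qed.

(** P^-1 - Q^-1 = (P^-1 - Q^-1) P (P^-1 - Q^-1) + Q^-1 (Q - P) Q^-1, and both terms are congruences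
    of positive semidefinite matrices. *)
Lemma psd_inv_anti n (P Q : 'M[C]_n) : P \in unitmx -> Q \in unitmx ->
  psd P -> psd Q -> psd (Q - P) -> psd (invmx P - invmx Q).
Proof.
move=> uP uQ pP [hQ _] pQP; have [hP _] := pP.
have := psdD (psd_congr (invmx P - invmx Q) pP) (psd_congr (invmx Q) pQP).
rewrite adjB !adj_inv hP hQ; congr psd.
rewrite (mulmxBl _ _ P) mulVmx// (mulmxBr _ Q P) mulVmx//.
by rewrite -mulmxDr subrK mulmxBl mul1mx mulmxK.
Qed.

(** A Cauchy-Schwarz inequality: with e the i-th basis vector and c = 1 / P_ii, the form of P at
    P^-1 e - c e equals (P^-1)_ii - c. *)
Lemma inv_entry_ge n (P : 'M[C]_n) i : P \in unitmx -> psd P -> 0 < P i i ->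
  (P i i)^-1 <= (invmx P) i i.
Proof.
move=> uP pP p0; have [hP pos] := pP.
pose e : 'cV[C]_n := delta_mx i 0.
have he (X : 'M[C]_n) : (e^t* *m X *m e) 0 0 = X i i.
  by rewrite trmx_delta map_delta_mx -rowE -colE !mxE.
pose c := (P i i)^-1; have cc : c^* = c.
  by rewrite (CrealP _)// ger0_real// invr_ge0 ltW.
have := pos (invmx P *m e - c *: e).
rewrite adjB adjZ adjM adj_inv hP cc.
have -> : (e^t* *m invmx P - c *: e^t*) *m P *m (invmx P *m e - c *: e) =
    e^t* *m invmx P *m e - c *: (e^t* *m 1%:M *m e)
    - (c *: (e^t* *m 1%:M *m e) - c *: (c *: (e^t* *m P *m e))).
  rewrite mulmxBl mulmxKV// mulmxBl !mulmxBr -!scalemxAl -!scalemxAr.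
  by rewrite !mulmx1 !mulmxA mulmxK.
rewrite !(sub_mxE, scale_mxE, he) mxE eqxx mulr1.
by rewrite mulVf ?gt_eqF// mulr1 subrr subr0 subr_ge0.
Qed.


(** The effect of adding T T^H becomes a factor of the form |1 + psd|, from which both monotonicity
    and submultiplicativity follow. *)
Lemma det_1D_factor n (P T : 'M[C]_n) : psd P ->
  \det (1%:M + P + T *m T^t*) =
  \det (1%:M + P) * \det (1%:M + T^t* *m invmx (1%:M + P) *m T).
Proof.
move=> pP; have u := unit_aD ltr01 pP.
rewrite -[T^t* *m _ *m _]mulmxA -det_1D_mulC -det_mulmx; congr determinant.
by rewrite mulmxDr mulmx1 !mulmxA mulmxV// mul1mx.
Qed.

Lemma det_1D_le n (P Q : 'M[C]_n) : psd P -> psd Q ->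
  \det (1%:M + P) <= \det (1%:M + P + Q).
Proof.
move=> pP /psd_sqrt[T ->]; rewrite det_1D_factor// ler_peMr//.
  exact/ltW/det_aD_gt0.
by apply: det_1D_ge1; apply/psd_congr/psd_inv/psdD => //; exact: psd1.
Qed.

(** In the second factor given by [det_1D_factor], the inverse of 1 + P is at most the identity. *)
Lemma det_1D_sub n (P Q : 'M[C]_n) : psd P -> psd Q ->
  \det (1%:M + P + Q) <= \det (1%:M + P) * \det (1%:M + Q).
Proof.
move=> pP /psd_sqrt[T ->]; rewrite det_1D_factor// ler_pM2l ?det_aD_gt0//.
rewrite (det_1D_mulC T).
have p1P : psd (1%:M + P) by apply: psdD => //; exact: psd1.
have h : psd (invmx 1%:M - invmx (1%:M + P)).
  apply: psd_inv_anti; [exact: unitmx1|exact: unit_aD|exact: psd1|by []|].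
  by rewrite addrC addKr.
have := det_1D_le (psd_congr T (psd_inv p1P)) (psd_congr T h).
rewrite mulmxBr mulmxBl -addrA (addrC (T^t* *m invmx (1%:M + P) *m T)) subrK.
by rewrite invmx1 mulmx1.
Qed.

(** Writing P = T T^H and Q = T Q' T^H reduces the claim to the eigenvalues x of Q', where it is the
    inequality x <= ((1 + x) / 2)^2. *)
Lemma det_midpoint n (P Q : 'M[C]_n) : P \in unitmx -> psd P -> psd Q ->
  \det P * \det Q <= \det (2^-1 *: (P + Q)) ^+ 2.
Proof.
move=> uP pP pQ; have [T eT] := psd_sqrt pP.
have uT : T \in unitmx by move: uP; rewrite eT unitmx_mul => /andP[].
pose Q' := invmx T *m Q *m (invmx T)^t*.
have pQ' : psd Q' by exact: psd_congr'.
have eQ : Q = T *m Q' *m T^t*.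
  rewrite /Q' !mulmxA mulmxV// mul1mx -mulmxA -adjM mulmxV// adj1.
  by rewrite mulmx1.
have [l l0 [_ d]] := psd_eigen pQ'.
have -> : \det (2^-1 *: (P + Q)) =
    \det P * \det ((2^-1)%:M + 2^-1 *: Q').
  have -> : 2^-1 *: (P + Q) = T *m ((2^-1)%:M + 2^-1 *: Q') *m T^t*.
    rewrite mulmxDr mulmxDl scalar_mxC -!mulmxA mul_scalar_mx -eT.
    by rewrite -scalemxAl -scalemxAr mulmxA -eQ scalerDr.
  by rewrite !det_mulmx eT det_mulmx mulrAC.
have -> : \det Q = \det P * \det Q' by rewrite eQ eT !det_mulmx mulrAC.
have := d 0 1; rewrite raddf0 add0r scale1r => ->.
rewrite d mulrA exprMn -expr2 ler_wpM2l ?exprn_ge0 ?psd_det_ge0//.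
rewrite -prodrXl; apply: ler_prod => i _; rewrite add0r mul1r l0 /=.
rewrite -subr_ge0.
have -> : (2^-1 + 2^-1 * l 0 i) ^+ 2 - l 0 i = (2^-1 * (1 - l 0 i)) ^+ 2.
  by field.
rewrite real_exprn_even_ge0// realM// ?realB// ?ger0_real//.
Qed.

End Psd.

(** * Sorted eigenvalue decompositions and the min-max principle *)

Section SortedSpectral.
Variable C : numClosedFieldType.

(** The order of [C] is total only on its real elements, so the sorting is confined to nonnegative
    entries. *)
Lemma sort_row_exists n (l : 'rV[C]_n) : (forall i, 0 <= l 0 i) ->
  exists s : 'S_n, forall i j : 'I_n, (i <= j)%N -> l 0 (s j) <= l 0 (s i).
Proof.
move=> l0; pose t := [tuple l 0 i | i < n].
pose r : rel C := (fun x y => y <= x).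
have pt : perm_eq (sort r t) t by rewrite perm_sort.
have /tuple_permP[s es] := pt.
exists s => i j ij.
have at_ k : nth 0 (sort r t) k = if insub k is Some i then l 0 (s i) else 0.
  rewrite es; case: insubP => [u ku <-|kn].
    by rewrite -tnth_nth !tnth_mktuple.
  by rewrite nth_default// size_tuple leqNgt.
have so : sorted r (sort r t).
  apply: (@sort_sorted_in _ [pred x | 0 <= x]).
    move=> x y x0 y0; rewrite /r orbC; apply: real_leVge; exact: ger0_real.
  by apply/allP => x /tnthP[k ->]; rewrite tnth_mktuple inE.
have tr : transitive r by move=> x y z h1 h2; exact: le_trans h2 h1.
have := sorted_leq_nth tr (fun x => lexx x) 0 so.
move=> /(_ i j); rewrite !inE size_sort size_tuple => /(_ (ltn_ord i) (ltn_ord j) ij).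
by rewrite !at_ !valK.
Qed.

Lemma col_perm_conj n (s : 'S_n) (U : 'M[C]_n) (l : 'rV[C]_n) :
  col_perm s U *m diag_mx (\row_i l 0 (s i)) *m (col_perm s U)^t* =
  U *m diag_mx l *m U^t*.
Proof.
apply/matrixP => a b; rewrite !mul_mx_diag !mxE.
rewrite [RHS](reindex_inj (@perm_inj _ s)) /=.
by apply: eq_bigr => j _; rewrite !mxE.
Qed.

Lemma psd_evd n (Q : 'M[C]_n) : psd Q ->
  exists U (l : 'rV[C]_n), [/\ U \is unitarymx, forall i, 0 <= l 0 i,
    forall i j : 'I_n, (i <= j)%N -> l 0 j <= l 0 i &
    Q = U *m diag_mx l *m U^t*].
Proof.
move=> /psd_spectral[U [l [uU l0 e]]].
have [s hs] := sort_row_exists l0.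
exists (col_perm s U), (\row_i l 0 (s i)); split.
- apply/unitarymxP; have := col_perm_conj s U (const_mx 1).
  have -> : \row_i (const_mx 1 : 'rV[C]_n) 0 (s i) = const_mx 1.
    by apply/rowP => i; rewrite !mxE.
  by rewrite !diag_const_mx !mulmx1 (unitarymxK uU).
- by move=> i; rewrite mxE.
- by move=> i j ij; rewrite !mxE hs.
- by rewrite col_perm_conj.
Qed.

Lemma quad_diagE n (l : 'rV[C]_n) (w : 'cV[C]_n) :
  (w^t* *m diag_mx l *m w) 0 0 = \sum_i l 0 i * `|w i 0| ^+ 2.
Proof.
rewrite mul_mx_diag mxE; apply: eq_bigr => i _.
by rewrite !mxE normCK; ring.
Qed.

(* Courant-Fischer: the conditions on [K *m y] leave a nonzero [y] in the span of
   the eigenvectors of index at most [i]. *)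
Lemma evd_min_max n (U K : 'M[C]_n) (mu : 'rV[C]_n) (i : 'I_n) (c : C) :
  U \is unitarymx ->
  (forall i j : 'I_n, (i <= j)%N -> mu 0 j <= mu 0 i) ->
  (forall y : 'cV[C]_n,
    (forall r : 'I_n, (r < i)%N -> (K *m y) r 0 = 0) ->
    (y^t* *m (U *m diag_mx mu *m U^t*) *m y) 0 0 <= c * (y^t* *m y) 0 0) ->
  mu 0 i <= c.
Proof.
move=> uU dmu hy.
(* Row [i] is zero, which makes [A] singular. The rows before [i] express the conditions on
   [K *m U *m w], and the rows after [i] force [w] to vanish there. *)
pose A : 'M[C]_n := \matrix_(r, a)
  if (r < i)%N then (K *m U) r a else ((r != i) && (r == a))%:R.
have /eqP/det0P[v v0 vA] : \det A^T = 0.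
  rewrite det_tr (expand_det_row _ i) big1// => a _.
  by rewrite mxE ltnn eqxx mul0r.
pose w := v^T; have Aw : A *m w = 0 by rewrite -[LHS]trmxK trmx_mul trmxK vA trmx0.
have w_gt (a : 'I_n) : (i < a)%N -> w a 0 = 0.
  move=> ia; have := congr1 (fun M : 'cV[C]_n => M a 0) Aw.
  rewrite !mxE (bigD1 a)//= big1 => [|b ba]; rewrite !mxE ltnNge (ltnW ia) /=.
    have ai : (a != i) by rewrite -val_eqE gtn_eqF.
    by rewrite eqxx ai addr0 mul1r.
  by rewrite [a == b]eq_sym (negbTE ba) andbF mul0r.
have Kw (r : 'I_n) : (r < i)%N -> (K *m (U *m w)) r 0 = 0.
  move=> ri; have := congr1 (fun M : 'cV[C]_n => M r 0) Aw.
  rewrite mulmxA [X in X = _]mxE [X in _ = X]mxE => <-.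
  by rewrite mxE; apply: eq_bigr => b _; rewrite [in RHS]mxE ri.
have := hy _ Kw.
rewrite adjM !mulmxA !mulmxKtV// quad_diagE cV_normE => h.
have p0 : 0 < \sum_i `|w i 0| ^+ 2.
  rewrite lt0r sumr_ge0 ?andbT => [|a _]; last by rewrite exprn_ge0.
  apply: contra v0; rewrite psumr_eq0 => [/allP z|a _]; last by rewrite exprn_ge0.
  apply/eqP/rowP => a; have := z a (mem_index_enum _).
  by rewrite expf_eq0/= normr_eq0 !mxE => /eqP.
rewrite -(ler_pM2r p0); apply: le_trans h.
rewrite mulr_sumr; apply: ler_sum => a _.
have [ai|ia] := leqP a i; first by rewrite ler_wpM2r ?exprn_ge0// dmu.
by rewrite w_gt// normr0 expr0n !mulr0.
Qed.

End SortedSpectral.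

(** * Spectra of the two Gram matrices of a square matrix *)

Section GramSpectra.
Variable C : numClosedFieldType.

Lemma cV_norm_ge0 n (x : 'cV[C]_n) : 0 <= (x^t* *m x) 0 0.
Proof. by rewrite cV_normE sumr_ge0// => i _; rewrite exprn_ge0. Qed.

Lemma cV_norm_eq0 n (x : 'cV[C]_n) : (x^t* *m x) 0 0 = 0 -> x = 0.
Proof.
rewrite cV_normE => /eqP; rewrite psumr_eq0 => [/allP z|i _]; last first.
  by rewrite exprn_ge0.
apply/colP => i; have := z i (mem_index_enum _).
by rewrite expf_eq0/= normr_eq0 !mxE => /eqP.
Qed.

Lemma quad_diag_le n (l : 'rV[C]_n) (w : 'cV[C]_n) (i : 'I_n) :
  (forall i j : 'I_n, (i <= j)%N -> l 0 j <= l 0 i) ->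
  (forall r : 'I_n, (r < i)%N -> w r 0 = 0) ->
  (w^t* *m diag_mx l *m w) 0 0 <= l 0 i * (w^t* *m w) 0 0.
Proof.
move=> dl w0; rewrite quad_diagE cV_normE mulr_sumr.
apply: ler_sum => a _; have [ai|ia] := ltnP a i.
  by rewrite w0// normr0 expr0n !mulr0.
by rewrite ler_wpM2r ?exprn_ge0// dl.
Qed.

(** By min-max it suffices to bound the norm of z = F y when z is orthogonal to the first i
    eigenvectors of F F^H. Then |F^H z|^2 <= l_i |z|^2, and |z|^2 is the inner product of F^H z and
    y, so Cauchy-Schwarz gives |z|^2 <= l_i |y|^2. Expanding |F^H z - t y|^2 >= 0 at t = l_i
    replaces Cauchy-Schwarz without square roots. *)
Lemma gram_eigen_le n (F U U' : 'M[C]_n) (l l' : 'rV[C]_n) (i : 'I_n) :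
  U \is unitarymx -> U' \is unitarymx -> (forall i, 0 <= l 0 i) ->
  (forall i j : 'I_n, (i <= j)%N -> l 0 j <= l 0 i) ->
  (forall i j : 'I_n, (i <= j)%N -> l' 0 j <= l' 0 i) ->
  F *m F^t* = U *m diag_mx l *m U^t* ->
  F^t* *m F = U' *m diag_mx l' *m U'^t* -> l' 0 i <= l 0 i.
Proof.
move=> uU uU' l0 dl dl' e e'.
apply: (evd_min_max (K := U^t* *m F) uU' dl') => y y0; rewrite -e'.
have [z ez] : exists z, z = F *m y by exists (F *m y).
have z0 (r : 'I_n) : (r < i)%N -> (U^t* *m z) r 0 = 0 by rewrite ez mulmxA => /y0.
have ey : y^t* *m F^t* = z^t* by rewrite ez adjM.
rewrite mulmxA -mulmxA -ez ey.
have hz : (z^t* *m (F *m F^t*) *m z) 0 0 <= l 0 i * (z^t* *m z) 0 0.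
  have := quad_diag_le dl (w := U^t* *m z) (i := i).
  have -> : (U^t* *m z)^t* *m diag_mx l *m (U^t* *m z) = z^t* *m (F *m F^t*) *m z.
    by rewrite adjM trmxCK e !mulmxA.
  have -> : (U^t* *m z)^t* *m (U^t* *m z) = z^t* *m z.
    by rewrite adjM trmxCK !mulmxA mulmxtVK.
  exact.
have h t : t^* = t -> 0 <= (z^t* *m (F *m F^t*) *m z) 0 0
    - 2 * t * (z^t* *m z) 0 0 + t ^+ 2 * (y^t* *m y) 0 0.
  move=> tt; have := cV_norm_ge0 (F^t* *m z - t *: y).
  rewrite adjB adjZ tt adjM trmxCK mulmxBl !mulmxBr -!scalemxAl -!scalemxAr.
  rewrite !(sub_mxE, scale_mxE) (mulmxA (y^t*)) ey -(mulmxA _ F y) -ez.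
  rewrite -(mulmxA _ F) (mulmxA F) mulmxA => h; apply: le_trans h _.
  set a := (_ *m z) 0 0; set b := (_ *m y) 0 0; set q := (_ *m z) 0 0.
  by rewrite le_eqVlt; apply/orP; left; apply/eqP; ring.
have rl : (l 0 i)^* = l 0 i by rewrite (CrealP _)// ger0_real.
(* The expansion yields the bound only up to a factor l_i. When it vanishes, F^H z = 0 directly
   forces the norm of z to be zero. *)
have [l0i|li0] := eqVneq (l 0 i) 0.
  have : F^t* *m z = 0.
    apply: cV_norm_eq0; apply/eqP; rewrite eq_le cV_norm_ge0 andbT.
    by rewrite adjM trmxCK mulmxA -(mulmxA _ F); move: hz; rewrite l0i mul0r.
  move=> /(congr1 (mulmx (y^t*))); rewrite mulmxA ey mulmx0 l0i => ->.
  by rewrite mxE mul0r.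
have lp : 0 < l 0 i by rewrite lt0r li0 l0.
have := h _ rl; rewrite -[in X in _ -> X]subr_ge0 -(pmulr_rge0 _ lp) => h'.
move: hz h'; set a := (_ *m z) 0 0; set b := (z^t* *m z) 0 0; set q := (_ *m y) 0 0.
rewrite -subr_ge0 => hz h'.
have -> : l 0 i * (l 0 i * q - b) =
  (l 0 i * b - a) + (a - 2 * l 0 i * b + l 0 i ^+ 2 * q) by ring.
exact: addr_ge0.
Qed.

(** The previous inequality for F and for its adjoint makes the sorted spectra equal, so
    eigenvectors of one Gram matrix can be carried to those of the other. *)
Lemma gramC_unitary n (F : 'M[C]_n) :
  exists2 U : 'M[C]_n, U \is unitarymx & F^t* *m F = U *m (F *m F^t*) *m U^t*.
Proof.
have [U [l [uU l0 dl e]]] := psd_evd (psd_gram' F).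
have [U' [l' [uU' l0' dl' e']]] := psd_evd (psd_gram F).
have el : l' = l.
  apply/rowP => i; apply/eqP; rewrite eq_le (gram_eigen_le i uU uU' l0 dl dl' e e').
  by apply: (gram_eigen_le (F := F^t*) i uU' uU l0' dl' dl); rewrite ?trmxCK.
exists (U' *m U^t*); first by rewrite mul_unitarymx ?trmxC_unitary.
by rewrite e' e el adjM trmxCK !mulmxA !mulmxKtV.
Qed.

End GramSpectra.

(** * Confining a matrix to its first columns *)

Section Truncation.
Variable C : numClosedFieldType.

Lemma gram_col0 n (N : 'M[C]_n) (j : 'I_n) :
  (N^t* *m N) j j = 0 -> forall i, N i j = 0.
Proof.
move=> h i; have : col j N = 0.
  apply: cV_norm_eq0; rewrite -{}h !mxE; apply: eq_bigr => a _.
  by rewrite !mxE.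
by move=> /colP /(_ i); rewrite !mxE.
Qed.

(* The compression of [diag_mx lam] to the range of [B^t* *m B] has eigenvalues
   [mu 0 i <= lam 0 i]; [B'] has the corresponding columns scaled by the square
   root of [mu 0 i / lam 0 i] (which is [0] when [lam 0 i] vanishes). *)
Lemma truncate_columns n k (lam : 'rV[C]_n) (B : 'M[C]_n) :
  (forall i, 0 <= lam 0 i) ->
  (forall i j : 'I_n, (i <= j)%N -> lam 0 j <= lam 0 i) ->
  (forall i j : 'I_n, (k <= i)%N -> B i j = 0) ->
  exists B' : 'M[C]_n,
    [/\ forall i j : 'I_n, (k <= j)%N -> B' i j = 0,
        B' *m diag_mx lam *m B'^t* = B *m diag_mx lam *m B^t* &
        psd (B *m B^t* - B' *m B'^t*)].
Proof.
move=> l0 dl Bk.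
have [V [m [uV m0 dm e]]] := psd_evd (psd_gram B).
(* Only the first [k] rows of [B] can be nonzero, so the Gram matrix has rank at most [k]; min-max
   with [K := B] places its zero eigenvalues from index [k] on. *)
have mk (i : 'I_n) : (k <= i)%N -> m 0 i = 0.
  move=> ki; apply/eqP; rewrite eq_le m0 andbT.
  apply: (evd_min_max (K := B) uV dm) => y y0; rewrite -e mul0r.
  suff By : B *m y = 0 by rewrite mulmxA -mulmxA By mulmx0 mxE.
  apply/colP => r; have [ri|ir] := ltnP r i; first by rewrite y0// mxE.
  by rewrite !mxE big1// => a _; rewrite Bk ?mul0r// (leq_trans ki).
have [N eN] : exists N, N = B *m V by exists (B *m V).
have Nk (i j : 'I_n) : (k <= j)%N -> N i j = 0.
  move=> kj; apply: gram_col0.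
  have -> : N^t* *m N = diag_mx m.
    by rewrite eN adjM mulmxA -(mulmxA _ _ B) e !mulmxA mulmxKtV// unitarymxV// mul1mx.
  by rewrite mxE eqxx mulr1n mk.
pose ek : 'rV[C]_n := \row_i (i < k)%:R.
pose E := diag_mx ek.
have NE : N *m E = N.
  apply/matrixP => i j; rewrite mul_mx_diag mxE [ek 0 j]mxE.
  by have [jk|kj] := ltnP j k; rewrite ?mulr1 // mulr0 Nk.
have Eadj : E^t* = E.
  by rewrite adj_diag; congr diag_mx; apply/rowP => i; rewrite !mxE conjC_nat.
have NN : N *m N^t* = B *m B^t* by rewrite eN adjM mulmxA mulmxtVK.
(* [P] maps onto the span of the leading eigenvectors of [B^t* *m B], which contains the range of
   [B^t*]; this is why [P *m N^t*] gives back [B^t*]. *)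
have [P eP] : exists P, P = V *m E by exists (V *m E).
have pX : psd (P^t* *m diag_mx lam *m P) by apply/psd_congr/psd_diag.
have NXN : N *m (P^t* *m diag_mx lam *m P) *m N^t* = B *m diag_mx lam *m B^t*.
  have PN : P *m N^t* = B^t*.
    by rewrite eP -mulmxA -[E]Eadj -adjM NE eN adjM mulmxA unitarymxK// mul1mx.
  by rewrite -!mulmxA PN !mulmxA -[N *m P^t*]trmxCK adjM trmxCK PN trmxCK.
have [U [mu [uU mu0 dmu eX]]] := psd_evd pX.
have muk (i : 'I_n) : (k <= i)%N -> mu 0 i = 0.
  move=> ki; apply/eqP; rewrite eq_le mu0 andbT.
  apply: (evd_min_max (K := E) uU dmu) => y y0; rewrite -eX mul0r.
  suff Ey : E *m y = 0 by rewrite eP !mulmxA -[_ *m E *m y]mulmxA Ey mulmx0 mxE.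
  apply/colP => r; have [ri|ir] := ltnP r i; first by rewrite y0// mxE.
  by rewrite mul_diag_mx !mxE ltnNge (leq_trans ki ir) mul0r.
(* Interlacing by min-max: the test vectors are those whose image under [P] has no component before
   [i], where [diag_mx lam] is at most [lam 0 i]; moreover [P] does not increase norms. *)
have mul_ (i : 'I_n) : mu 0 i <= lam 0 i.
  apply: (evd_min_max (K := P) uU dmu) => y y0; rewrite -eX.
  have -> : y^t* *m (P^t* *m diag_mx lam *m P) *m y =
    (P *m y)^t* *m diag_mx lam *m (P *m y) by rewrite adjM !mulmxA.
  apply: le_trans (quad_diag_le dl y0) _; rewrite ler_wpM2l//.
  have -> : (P *m y)^t* *m (P *m y) = (E *m y)^t* *m (E *m y).
    by rewrite eP -mulmxA adjM !mulmxA mulmxKtV.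
  rewrite !cV_normE; apply: ler_sum => a _; rewrite mul_diag_mx !mxE.
  by case: ltnP => _; rewrite ?mul1r// mul0r normr0 expr0n exprn_ge0.
pose r : 'rV[C]_n := \row_i sqrtC (mu 0 i / lam 0 i).
have rc i : (r 0 i)^* = r 0 i.
  by rewrite (CrealP _)// ger0_real// mxE sqrtC_ge0 divr_ge0.
have Radj : (diag_mx r)^t* = diag_mx r.
  by rewrite adj_diag; congr diag_mx; apply/rowP => i; rewrite mxE rc.
have rr i : r 0 i * r 0 i = mu 0 i / lam 0 i by rewrite mxE -expr2 sqrtCK.
exists (N *m U *m diag_mx r); split.
- move=> i j kj; rewrite mul_mx_diag !mxE muk// mul0r sqrtC0 mulr0//.
- rewrite -NXN eX adjM Radj adjM !mulmxA; congr (_ *m _ *m _).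
  rewrite -!mulmxA; congr (_ *m (_ *m _)); rewrite !mulmx_diag.
  congr diag_mx; apply/rowP => i; rewrite mxE [X in _ * X]mxE mulrCA rr.
  have [li|li] := eqVneq (lam 0 i) 0; last by rewrite mulrC divfK.
  by rewrite li mul0r; apply/eqP; rewrite eq_le mu0 -li mul_.
- have -> : B *m B^t* - (N *m U *m diag_mx r) *m (N *m U *m diag_mx r)^t* =
      (N *m U) *m diag_mx (\row_i (1 - mu 0 i / lam 0 i)) *m (N *m U)^t*.
    have -> : diag_mx (\row_i (1 - mu 0 i / lam 0 i)) =
        1%:M - diag_mx r *m diag_mx r.
      rewrite -diag_const_mx mulmx_diag -linearB /=; congr diag_mx.
      by apply/rowP => i; rewrite !(sub_mxE, mxE) -expr2 sqrtCK.
    rewrite mulmxBr mulmxBl mulmx1 !adjM Radj !mulmxA mulmxtVK// NN.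
    by [].
  apply/psd_congr'/psd_diag => i; rewrite mxE subr_ge0.
  have [li|li] := eqVneq (lam 0 i) 0; first by rewrite li invr0 mulr0 ler01.
  by rewrite ler_pdivrMr ?mul1r ?mul_// lt0r li l0.
Qed.

End Truncation.

(** * Optimal structure for a unitarily invariant concave rate *)

Lemma invmx_eq (C : comUnitRingType) n (A B : 'M[C]_n) :
  A *m B = 1%:M -> invmx A = B.
Proof. by move=> AB; rewrite -[B](mulKmx (mulmx1_unit AB).1) AB mulmx1. Qed.

(** * The matrix function M (a + s M)^-1 *)

Section Gain.
Variables (C : numClosedFieldType) (a s : C).
Hypotheses (a0 : 0 < a) (s0 : 0 < s).

(** This is f(M) = M (a + s M)^-1, written with a single occurrence of M, inside the inverse, so
    that facts about inverses transfer directly. *)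
Definition gain n (M : 'M[C]_n) : 'M[C]_n :=
  s^-1 *: (1%:M - a *: invmx (a%:M + s *: M)).

Let psdZs n (M : 'M[C]_n) : psd M -> psd (s *: M).
Proof. by move=> pM; apply: psdZ => //; exact: ltW. Qed.

(** The push-through identity: F (a + s F^H F) = (a + s F F^H) F. *)
Lemma gain_gram m n (F : 'M[C]_(m, n)) :
  F^t* *m invmx (a%:M + s *: (F *m F^t*)) *m F = gain (F^t* *m F).
Proof.
have uP : a%:M + s *: (F *m F^t*) \in unitmx by exact/unit_aD/psdZs/psd_gram'.
have uQ : a%:M + s *: (F^t* *m F) \in unitmx by exact/unit_aD/psdZs/psd_gram.
rewrite /gain; set P := _ + _ in uP *; set Q := a%:M + s *: _ in uQ *.
have FQ : F *m Q = P *m F.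
  by rewrite /P /Q mulmxDl mulmxDr scalar_mxC -scalemxAr -scalemxAl mulmxA.
have -> : F^t* *m invmx P *m F = F^t* *m F *m invmx Q.
  by rewrite -!mulmxA; congr (_ *m _); rewrite -[F in LHS](mulmxK uQ) FQ -mulmxA mulKmx.
have -> : F^t* *m F = s^-1 *: (Q - a%:M).
  by rewrite /Q addrC addKr scalerA mulVf ?scale1r// gt_eqF.
by rewrite -scalemxAl mulmxBl mulmxV// mul_scalar_mx.
Qed.

Lemma psd_gain n (M : 'M[C]_n) : psd M -> psd (gain M).
Proof.
move=> /psd_sqrt[T ->]; have := gain_gram (T^t*); rewrite trmxCK => <-.
apply: psd_congr'; apply/psd_inv/psdD; first exact/psd_scalar/ltW.
exact/psdZs/psd_gram.
Qed.

Lemma gain_conj n (U M : 'M[C]_n) : U \is unitarymx -> psd M ->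
  gain (U *m M *m U^t*) = U *m gain M *m U^t*.
Proof.
move=> uU pM; have e : a%:M + s *: (U *m M *m U^t*) = U *m (a%:M + s *: M) *m U^t*.
  rewrite mulmxDr mulmxDl scalar_mxC mulmxtVK//.
  by rewrite -scalemxAr -scalemxAl.
rewrite /gain e -!scalemxAr -scalemxAl mulmxBr mulmxBl mulmx1 unitarymxK//.
rewrite -scalemxAr -scalemxAl; congr (_ *: (_ - _ *: _)).
apply: invmx_eq; rewrite !mulmxA mulmxKtV// -(mulmxA U) mulmxV.
  by rewrite mulmx1 unitarymxK.
exact/unit_aD/psdZs.
Qed.

Lemma gain_diag n (l : 'rV[C]_n) : (forall i, 0 <= l 0 i) ->
  gain (diag_mx l) = diag_mx (\row_i (l 0 i / (a + s * l 0 i))).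
Proof.
move=> l0; have pos i : a + s * l 0 i != 0.
  by rewrite gt_eqF// ltr_wpDr// mulr_ge0// ltW.
rewrite /gain -!diag_const_mx -linearZ -linearD /=.
have -> : invmx (diag_mx (const_mx a + s *: l)) =
    diag_mx (\row_i (a + s * l 0 i)^-1).
  apply: invmx_eq; rewrite mulmx_diag -diag_const_mx; congr diag_mx.
  by apply/rowP => i; rewrite !mxE divff.
rewrite -linearZ -linearB /= -linearZ /=; congr diag_mx; apply/rowP => i.
by rewrite !mxE; field; rewrite pos gt_eqF.
Qed.

Lemma gain_diag_le n (M : 'M[C]_n) i : psd M ->
  gain M i i <= M i i / (a + s * M i i).
Proof.
move=> pM; have Mi := psd_entry_ge0 i pM.
have pos : 0 < a + s * M i i by rewrite ltr_wpDr// mulr_ge0// ltW.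
have pP : psd (a%:M + s *: M) by apply/psdD/psdZs => //; exact/psd_scalar/ltW.
have eP : (a%:M + s *: M) i i = a + s * M i i by rewrite !mxE eqxx mulr1n.
have := @inv_entry_ge _ _ (a%:M + s *: M) i (unit_aD a0 (psdZs pM)) pP.
rewrite eP => /(_ pos) h.
rewrite /gain scale_mxE sub_mxE scale_mxE mxE eqxx mulr1n.
have -> : M i i / (a + s * M i i) = s^-1 * (1 - a * (a + s * M i i)^-1).
  by field; rewrite !gt_eqF.
by rewrite ler_pM2l ?invr_gt0// lerD2l lerN2 ler_pM2l.
Qed.

(** Dividing the numerator matrix by a + s F F^H and cycling F with Sylvester's identity leaves a
    determinant that depends on F only through F^H F. *)
Lemma det_ratio_gain m n (F : 'M[C]_(m, n)) (K : 'M[C]_n) :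
  \det (a%:M + F *m (K + s%:M) *m F^t*) / \det (a%:M + s *: (F *m F^t*)) =
  \det (1%:M + K *m gain (F^t* *m F)).
Proof.
have pF : psd (s *: (F *m F^t*)) by exact/psdZs/psd_gram'.
have uP := unit_aD a0 pF.
rewrite -gain_gram !mulmxA det_1D_mulC -[RHS](mulfK (lt0r_neq0 (det_aD_gt0 a0 pF))).
congr (_ / _); rewrite -det_mulmx; congr determinant.
rewrite mulmxDl mul1mx !mulmxA mulmxKV// mulmxDr mulmxDl mul_mx_scalar.
by rewrite -scalemxAl [in RHS]addrAC addrA.
Qed.

End Gain.

Section DiagonalAveraging.
Variables (C : numClosedFieldType) (R : realFieldType) (n : nat).
Variable rho : 'M[C]_n -> R.
Hypothesis rho_conj : forall U X : 'M[C]_n, U \is unitarymx -> psd X ->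
  rho (U *m X *m U^t*) = rho X.
Hypothesis rho_mid : forall X Y : 'M[C]_n, psd X -> psd Y ->
  (rho X + rho Y) / 2 <= rho (2^-1 *: (X + Y)).

(* Flipping the sign of one coordinate and averaging kills the off-diagonal
   entries of one row and column. *)
Lemma concave_invariant_le_diag (X : 'M[C]_n) : psd X ->
  rho X <= rho (diag_mx (\row_i X i i)).
Proof.
(* [Xj j] is [X] with the off-diagonal entries of its first [j] rows and columns cleared; it
   interpolates between [X] and its diagonal. *)
move=> pX; pose Xj (j : nat) : 'M[C]_n :=
  \matrix_(a, b) if (a == b) || ((j <= a) && (j <= b))%N then X a b else 0.
have X0 : Xj 0 = X by apply/matrixP => a b; rewrite mxE !leq0n orbT.
have Xn : Xj n = diag_mx (\row_i X i i).
  apply/matrixP => a b; rewrite !mxE leqNgt ltn_ord/= orbF.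
  by case: eqVneq => [->|]; rewrite ?mulr1n ?mulr0n.
have step (j : nat) : psd (Xj j) -> (j < n)%N ->
    psd (Xj j.+1) /\ rho (Xj j) <= rho (Xj j.+1).
  move=> pj jn; pose S : 'M[C]_n := diag_mx (\row_i (-1) ^+ (i == j :> nat)).
  have Sadj : S^t* = S.
    rewrite adj_diag; congr diag_mx; apply/rowP => i; rewrite !mxE.
    by rewrite rmorph_sign.
  have uS : S \is unitarymx.
    apply/unitarymxP; rewrite Sadj mulmx_diag -diag_const_mx; congr diag_mx.
    by apply/rowP => i; rewrite !mxE -expr2 sqrr_sign.
  have eS : Xj j.+1 = 2^-1 *: (Xj j + S *m Xj j *m S^t*).
    rewrite Sadj; apply/matrixP => a b; rewrite mul_mx_diag mul_diag_mx !mxE.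
    have [<-|ab] /= := eqVneq a b.
      by rewrite mulrAC -expr2 sqrr_sign mul1r; field.
    have : ~~ ((a == j :> nat) && (b == j :> nat)).
      by apply: contra ab => /andP[/eqP aj /eqP bj]; apply/eqP/val_inj; rewrite /= aj.
    rewrite !(ltn_neqAle j) ![j == _]eq_sym.
    case: (j <= a)%N; case: (j <= b)%N; case: (a == j :> nat);
      case: (b == j :> nat) => //= _; rewrite ?expr0 ?expr1; by field.
  have pSX : psd (S *m Xj j *m S^t*) by exact: psd_congr'.
  split; first by rewrite eS; apply/psdZ/psdD => //; rewrite invr_ge0.
  have := rho_mid pj pSX; rewrite -eS rho_conj//.
  by apply: le_trans; lra.
have main (j : nat) : (j <= n)%N -> psd (Xj j) /\ rho X <= rho (Xj j).
  elim: j => [|j IH] jn; first by rewrite X0.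
  have [pj le] := IH (ltnW jn); have [pj' le'] := step j pj jn.
  by split => //; exact: le_trans le'.
by have [_] := main n (leqnn n); rewrite Xn.
Qed.
End DiagonalAveraging.

(** * Reduction to a diagonal matrix for an abstract invariant rate *)

Section Structure.
Variables (C : numClosedFieldType) (R : realFieldType) (n : nat).
Variable rho : 'M[C]_n -> R.
Hypothesis rho_conj : forall U X : 'M[C]_n, U \is unitarymx -> psd X ->
  rho (U *m X *m U^t*) = rho X.
Hypothesis rho_mid : forall X Y : 'M[C]_n, psd X -> psd Y ->
  (rho X + rho Y) / 2 <= rho (2^-1 *: (X + Y)).
Hypothesis rho_mono : forall X Y : 'M[C]_n, psd X -> psd Y ->
  rho X <= rho (X + Y).
Variables (a s tau : C) (lam : 'rV[C]_n).
Hypotheses (a0 : 0 < a) (s0 : 0 < s) (tau0 : 0 <= tau).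
Hypotheses (lam0 : forall i, 0 <= lam 0 i).
Hypothesis lam_dec : forall i j : 'I_n, (i <= j)%N -> lam 0 j <= lam 0 i.

Let Lh : 'M[C]_n := diag_mx (map_mx sqrtC lam).

Let Lh_adj : Lh^t* = Lh.
Proof.
rewrite adj_diag; congr diag_mx; apply/rowP => i; rewrite !mxE.
by rewrite (CrealP _)// ger0_real// sqrtC_ge0.
Qed.

Let LhLh : Lh *m Lh = diag_mx lam.
Proof.
by rewrite mulmx_diag; congr diag_mx; apply/rowP => i; rewrite !mxE -expr2 sqrtCK.
Qed.

Lemma rho_gramC (F : 'M[C]_n) : rho (F^t* *m F) = rho (F *m F^t*).
Proof.
by have [U uU ->] := gramC_unitary F; rewrite rho_conj//; exact: psd_gram'.
Qed.

Lemma rho_gain_le_diag (M : 'M[C]_n) : psd M ->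
  rho (Lh *m gain a s M *m Lh) <=
  rho (diag_mx (\row_i (lam 0 i * (M i i / (a + s * M i i))))).
Proof.
move=> pM; have pG := psd_gain a0 s0 pM.
have pX : psd (Lh *m gain a s M *m Lh).
  by rewrite -[X in _ *m X]Lh_adj; exact: psd_congr'.
apply: le_trans (concave_invariant_le_diag rho_conj rho_mid pX) _.
set l1 := \row_i _; set l2 := \row_i _.
have l1E i : l1 0 i = lam 0 i * gain a s M i i.
  by rewrite mxE mul_mx_diag mxE mul_diag_mx !mxE mulrAC -expr2 sqrtCK.
have -> : diag_mx l2 = diag_mx l1 + diag_mx (l2 - l1).
  by rewrite -linearD addrC subrK.
apply: rho_mono; apply: psd_diag => i.
  by rewrite l1E mulr_ge0// psd_entry_ge0.
by rewrite sub_mxE l1E mxE -mulrBr mulr_ge0// subr_ge0 gain_diag_le.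
Qed.

(* [Lh] commutes with every unitary matrix, so that [F^t* *m F] can be traded for
   [F *m F^t*], whose diagonal only involves that of [A *m A^t*]. *)
Lemma structure_scalar_correlation (S : 'rV[C]_n) (c : C) (A : 'M[C]_n) :
  (forall i, 0 <= S 0 i) -> (forall i, lam 0 i = c) ->
  exists2 l : 'rV[C]_n, forall i, 0 <= l 0 i &
  \sum_i l 0 i * (tau * lam 0 i + s) <=
    \tr (A *m diag_mx (tau *: lam + const_mx s) *m A^t*) /\
  rho (Lh *m gain a s (A^t* *m diag_mx S *m A) *m Lh) <=
    rho (diag_mx (\row_i (lam 0 i * (S 0 i * l 0 i / (a + s * (S 0 i * l 0 i)))))).
Proof.
move=> S0 lamc; pose l : 'rV[C]_n := \row_i (A *m A^t*) i i.
exists l => [i|]; first by rewrite mxE; exact/psd_entry_ge0/psd_gram'.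
have elam : lam = const_mx c by apply/rowP => i; rewrite lamc mxE.
split.
  have -> : tau *: lam + const_mx s = const_mx (tau * c + s).
    by apply/rowP => i; rewrite !mxE lamc.
  rewrite diag_const_mx mul_mx_scalar -scalemxAl mxtraceZ mulr_sumr.
  by apply: ler_sum => i _; rewrite lamc mulrC mxE.
pose Sh : 'M[C]_n := diag_mx (map_mx sqrtC S).
have Sh_adj : Sh^t* = Sh.
  rewrite adj_diag; congr diag_mx; apply/rowP => i; rewrite !mxE.
  by rewrite (CrealP _)// ger0_real// sqrtC_ge0.
have ShSh : Sh *m Sh = diag_mx S.
  by rewrite mulmx_diag; congr diag_mx; apply/rowP => i; rewrite !mxE -expr2 sqrtCK.
have -> : A^t* *m diag_mx S *m A = (Sh *m A)^t* *m (Sh *m A).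
  by rewrite adjM Sh_adj -ShSh !mulmxA.
have [U uU ->] := gramC_unitary (Sh *m A).
have pF := psd_gram' (Sh *m A).
have LU : Lh = (sqrtC c)%:M.
  by rewrite -diag_const_mx /Lh elam; congr diag_mx; apply/rowP => i; rewrite !mxE.
rewrite gain_conj//.
have -> X : Lh *m (U *m X *m U^t*) *m Lh = U *m (Lh *m X *m Lh) *m U^t*.
  by rewrite LU !(mul_scalar_mx, mul_mx_scalar) -!(scalemxAl, scalemxAr).
rewrite rho_conj//; last first.
  by rewrite -[X in _ *m X]Lh_adj; apply/psd_congr'/psd_gain.
apply: le_trans (rho_gain_le_diag pF) _.
have -> // : \row_i (lam 0 i * ((Sh *m A *m (Sh *m A)^t*) i i /
      (a + s * (Sh *m A *m (Sh *m A)^t*) i i))) =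
    \row_i (lam 0 i * (S 0 i * l 0 i / (a + s * (S 0 i * l 0 i)))).
apply/rowP => i; rewrite 2!mxE.
have -> // : (Sh *m A *m (Sh *m A)^t*) i i = S 0 i * l 0 i.
rewrite adjM Sh_adj mulmxA -(mulmxA Sh) mul_mx_diag mxE mul_diag_mx !mxE.
by rewrite mulrAC -expr2 sqrtCK.
Qed.

(* Truncating the columns keeps [B *m diag_mx lam *m B^t*], which is all that the
   outer factors see, and shrinks [B *m B^t*], hence enlarges the inverse [T]. *)
Lemma structure_scalar_channel (S : 'rV[C]_n) (g : C) (k : nat) (A : 'M[C]_n) :
  0 <= g -> (forall i : 'I_n, S 0 i = if (i < k)%N then g else 0) ->
  exists2 l : 'rV[C]_n, forall i, 0 <= l 0 i &
  \sum_i l 0 i * (tau * lam 0 i + s) <=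
    \tr (A *m diag_mx (tau *: lam + const_mx s) *m A^t*) /\
  rho (Lh *m gain a s (A^t* *m diag_mx S *m A) *m Lh) <=
    rho (diag_mx (\row_i (lam 0 i * (S 0 i * l 0 i / (a + s * (S 0 i * l 0 i)))))).
Proof.
move=> g0 Sk; pose ek : 'rV[C]_n := \row_i (i < k)%:R.
(* [B] keeps the rows of [A] that the channel transmits; dropping the others saves power and leaves
   the rate unchanged. *)
have [B eB] : exists B, B = diag_mx ek *m A by exists (diag_mx ek *m A).
have Bk (i j : 'I_n) : (k <= i)%N -> B i j = 0.
  by move=> ki; rewrite eB mul_diag_mx !mxE ltnNge ki mul0r.
have [B' [B'k eJ pL]] := truncate_columns lam0 lam_dec Bk.
pose l : 'rV[C]_n := \row_i (B'^t* *m B') i i.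
have ek_adj : (diag_mx ek)^t* = diag_mx ek.
  by rewrite adj_diag; congr diag_mx; apply/rowP => i; rewrite !mxE conjC_nat.
exists l => [i|]; first by rewrite mxE; exact/psd_entry_ge0/psd_gram.
pose D := diag_mx (tau *: lam + const_mx s).
have D0 i : 0 <= (tau *: lam + const_mx s) 0 i.
  by rewrite !mxE addr_ge0 ?mulr_ge0// ltW.
have trD (Y : 'M[C]_n) : \tr (Y *m D *m Y^t*) =
    tau * \tr (Y *m diag_mx lam *m Y^t*) + s * \tr (Y *m Y^t*).
  rewrite /D linearD linearZ /= diag_const_mx mulmxDr mulmxDl mxtraceD.
  by rewrite mul_mx_scalar -scalemxAr -!scalemxAl !mxtraceZ.
split.
  have -> : \sum_i l 0 i * (tau * lam 0 i + s) = \tr (B' *m D *m B'^t*).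
    rewrite -mulmxA mxtrace_mulC -mulmxA mul_diag_mx; apply: eq_bigr => i _.
    by rewrite !mxE mulrC.
  apply: (@le_trans _ _ (\tr (B *m D *m B^t*))).
    rewrite !trD eJ lerD2l; apply: ler_wpM2l; first exact: ltW.
    rewrite -subr_ge0 -raddfB /=.
    exact: psd_tr_ge0.
  apply: ler_sum => i _; have pX := psd_congr' A (psd_diag D0).
  have -> : B *m D *m B^t* = diag_mx ek *m (A *m D *m A^t*) *m diag_mx ek.
    by rewrite eB adjM ek_adj !mulmxA.
  move: (A *m D *m A^t*) pX => X pX; rewrite mul_mx_diag mul_diag_mx !mxE.
  by case: (i < k)%N; rewrite ?mul1r ?mulr1 ?mul0r ?psd_entry_ge0.
have rg : (sqrtC g)^* = sqrtC g by rewrite (CrealP _)// ger0_real// sqrtC_ge0.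
pose F (Y : 'M[C]_n) := sqrtC g *: Y.
have FF (Y : 'M[C]_n) : F Y *m (F Y)^t* = g *: (Y *m Y^t*).
  by rewrite /F adjZ rg -scalemxAl -scalemxAr scalerA -expr2 sqrtCK.
have FF' (Y : 'M[C]_n) : (F Y)^t* *m F Y = g *: (Y^t* *m Y).
  by rewrite /F adjZ rg -scalemxAl -scalemxAr scalerA -expr2 sqrtCK.
have -> : A^t* *m diag_mx S *m A = (F B)^t* *m F B.
  have -> : diag_mx S = g *: (diag_mx ek *m diag_mx ek).
    rewrite mulmx_diag -linearZ /=; congr diag_mx; apply/rowP => i.
    by rewrite !mxE Sk; case: ifP => _; rewrite ?mulr1 ?mulr0.
  by rewrite FF' eB adjM ek_adj -scalemxAr -scalemxAl !mulmxA.
pose T Y := invmx (a%:M + s *: (F Y *m (F Y)^t*)).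
have pFF Y : psd (s *: (F Y *m (F Y)^t*)).
  by apply: psdZ; [exact: ltW|exact: psd_gram'].
have paFF Y : psd (a%:M + s *: (F Y *m (F Y)^t*)).
  by apply: psdD => //; exact/psd_scalar/ltW.
have pT Y : psd (T Y) by exact: psd_inv.
(* A factor of [T B] turns the argument of [rho] into a Gram matrix. With its factors swapped, [B]
   occurs only in [B *m diag_mx lam *m B^t*] besides the fixed [Th], so [B'] may replace it there; a
   second swap restores the order. *)
have [Th eT] := psd_sqrt (pT B).
have -> : Lh *m gain a s ((F B)^t* *m F B) *m Lh =
    (Th^t* *m (F B *m Lh))^t* *m (Th^t* *m (F B *m Lh)).
  by rewrite -(gain_gram a0 s0) -/(T B) eT !adjM trmxCK Lh_adj !mulmxA.
rewrite rho_gramC.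
have -> : (Th^t* *m (F B *m Lh)) *m (Th^t* *m (F B *m Lh))^t* =
    (Th^t* *m (F B' *m Lh)) *m (Th^t* *m (F B' *m Lh))^t*.
  have h Y : (Th^t* *m (F Y *m Lh)) *m (Th^t* *m (F Y *m Lh))^t* =
      g *: (Th^t* *m (Y *m diag_mx lam *m Y^t*) *m Th).
    rewrite !adjM trmxCK Lh_adj !mulmxA -(mulmxA _ Lh Lh) LhLh /F adjZ rg.
    by rewrite -!(scalemxAl, scalemxAr) scalerA -expr2 sqrtCK.
  by rewrite !h eJ.
rewrite -rho_gramC.
have -> : (Th^t* *m (F B' *m Lh))^t* *m (Th^t* *m (F B' *m Lh)) =
    (F B' *m Lh)^t* *m T B *m (F B' *m Lh).
  by rewrite eT !adjM trmxCK !mulmxA.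
(* The inner inverse still comes from [B]; since [B' *m B'^t*] is smaller than [B *m B^t*], passing
   to [T B'] enlarges it. *)
have le : rho ((F B' *m Lh)^t* *m T B *m (F B' *m Lh)) <=
    rho ((F B' *m Lh)^t* *m T B' *m (F B' *m Lh)).
  have -> : T B' = T B + (T B' - T B) by rewrite addrC subrK.
  rewrite mulmxDr mulmxDl; apply: rho_mono; first exact: psd_congr.
  apply/psd_congr/psd_inv_anti => //; try exact: unit_aD.
  rewrite opprD addrACA subrr add0r -scalerBr !FF -scalerBr.
  by apply/psdZ/psdZ => //; exact: ltW.
apply: le_trans le _.
have -> : (F B' *m Lh)^t* *m T B' *m (F B' *m Lh) =
    Lh *m gain a s ((F B')^t* *m F B') *m Lh.
  by rewrite -(gain_gram a0 s0) -/(T B') adjM Lh_adj !mulmxA.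
apply: le_trans (rho_gain_le_diag (psd_gram _)) _.
have -> // : \row_i (lam 0 i * (((F B')^t* *m F B') i i /
      (a + s * ((F B')^t* *m F B') i i))) =
    \row_i (lam 0 i * (S 0 i * l 0 i / (a + s * (S 0 i * l 0 i)))).
apply/rowP => i; rewrite 2!mxE.
have -> // : ((F B')^t* *m F B') i i = S 0 i * l 0 i.
(* [F] scales every column by the root of [g], while [S] vanishes from index [k] on; the two agree
   because [B'] has no columns there. *)
rewrite FF' scale_mxE Sk [l 0 i]mxE; case: ltnP => // ki.
rewrite mul0r [X in _ * X]mxE big1 ?mulr0// => j _.
by rewrite B'k// mulr0.
Qed.

End Structure.

(** * Unitary invariance of a Gaussian matrix *)

Section GaussianMatrixInvariance.
Context {R : realType} {d : measure_display} {T : measurableType d}.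
Variables (P : probability T R) (m n : nat).
Local Notation C := (R[i])%C.
Local Notation MR := (measurableTypeR R).
Local Notation K := (('I_m * 'I_n) * bool)%type.
Local Notation sg := (Num.sqrt (2^-1 : R)).

Definition re_im_entries (Z : T -> 'M[C]_(m, n)) (k : K) (w : T) : MR :=
  if k.2 then complex.Re (Z w k.1.1 k.1.2) else complex.Im (Z w k.1.1 k.1.2).

Definition gaussian_mx (Z : T -> 'M[C]_(m, n)) : Prop :=
  iid_normal P sg (re_im_entries Z).

Lemma gaussian_mx_iid (Z : T -> 'M[C]_(m, n)) :
  iid_std_complex_gaussian P Z -> gaussian_mx Z.
Proof.
move=> [gZ iZ]; split.
  move=> [[i j] b]; have [/measurable_fun_pairP[m1 m2] _] := gZ i j.
  by case: b.
move=> B mB.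
pose J : {set 'I_m * 'I_n} := finset.setTfor _.
have := iZ J (fun ij => B (ij, true) `*` B (ij, false))
  (fun ij => measurableX (mB _) (mB _)).
have -> : \bigcap_(i in [set i | i \in J])
    (re_im (fun w => Z w i.1 i.2) @^-1` (B (i, true) `*` B (i, false))) =
    \bigcap_k (re_im_entries Z k @^-1` B k).
  apply/seteqP; split => w h.
    move=> [ij b] _; have [] := h ij (finset.in_setT _).
    by case: b.
  move=> ij _; split; first exact: (h (ij, true)).
  exact: (h (ij, false)).
move=> ->.
have -> : \prod_k fine (normal_prob (0 : R) sg (B k)) =
    \prod_ij \prod_b fine (normal_prob (0 : R) sg (B (ij, b))).
  by rewrite pair_bigA; apply: eq_bigr => -[ij b].
transitivity (\prod_(ij in J)
   (\prod_b fine (normal_prob (0 : R) sg (B (ij, b))))%:E)%E.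
  apply: eq_bigr => ij _; have [_ ->] := gZ ij.1 ij.2; last exact: measurableX.
  rewrite product_measure1E// big_bool /= EFinM !fineK ?fin_num_measure//.
rewrite [LHS](eq_bigl xpredT); last by move=> ij; exact: finset.in_setT.
by apply: esym; apply: (big_morph EFin) => // x y; rewrite EFinM.
Qed.

Definition preserves_gaussian (U : 'M[C]_m) : Prop :=
  forall Z, gaussian_mx Z -> gaussian_mx (fun w => U *m Z w).

(** Including the adjoint makes the symmetries a group, which later allows a factor to be
    cancelled. *)
Definition gaussian_symmetry (U : 'M[C]_m) : Prop :=
  [/\ U \is unitarymx, preserves_gaussian U & preserves_gaussian (U^t*)].

Lemma gaussian_symmetryM U V :
  gaussian_symmetry U -> gaussian_symmetry V -> gaussian_symmetry (U *m V).
Proof.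
move=> [uU gU gU'] [uV gV gV']; split; first exact: mul_unitarymx.
  move=> Z gZ; under eq_fun do rewrite -mulmxA.
  by apply: gU; exact: gV.
move=> Z gZ; under eq_fun do rewrite adjM -mulmxA.
by apply: gV'; exact: gU'.
Qed.

Definition row_phase (i : 'I_m) (c s : R) : 'M[C]_m :=
  diag_mx (\row_k if k == i then (c +i* s)%C else 1).

Definition givens (p q : 'I_m) (c s : R) : 'M[C]_m :=
  \matrix_(i, j)
    if i == p then (if j == p then c%:C%C else if j == q then (- s)%:C%C else 0)
    else if i == q then (if j == p then s%:C%C else if j == q then c%:C%C else 0)
    else (i == j)%:R.

Lemma row_phaseE k i c s (Z : 'M[C]_(m, k)) a j :
  (row_phase i c s *m Z) a j = (if a == i then (c +i* s)%C else 1) * Z a j.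
Proof. by rewrite mul_diag_mx !mxE. Qed.

Lemma givensE k p q c s (Z : 'M[C]_(m, k)) a j : p != q ->
  (givens p q c s *m Z) a j =
  if a == p then c%:C%C * Z p j - s%:C%C * Z q j
  else if a == q then s%:C%C * Z p j + c%:C%C * Z q j else Z a j.
Proof.
move=> pq; rewrite mxE; have qp : (q == p) = false by rewrite eq_sym (negbTE pq).
have [ap|ap] := eqVneq a p.
  rewrite (bigD1 p)//= (bigD1 q) ?qp//= big1 => [|b /andP[bp bq]].
    by rewrite !mxE ap !eqxx qp addr0 rmorphN mulNr.
  by rewrite mxE ap eqxx (negbTE bp) (negbTE bq) mul0r.
have [aq|aq] := eqVneq a q.
  rewrite (bigD1 p)//= (bigD1 q) ?qp//= big1 => [|b /andP[bp bq]].
    by rewrite !mxE aq qp !eqxx addr0.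
  by rewrite mxE aq qp eqxx (negbTE bp) (negbTE bq) mul0r.
rewrite (bigD1 a)//= big1 => [|b ba].
  by rewrite mxE (negbTE ap) (negbTE aq) eqxx mul1r addr0.
by rewrite mxE (negbTE ap) (negbTE aq) eq_sym (negbTE ba) mul0r.
Qed.

Let sg0 : sg != 0.
Proof. by rewrite gt_eqF// sqrtr_gt0 invr_gt0. Qed.

(** Multiplication by the unit number c + i s rotates the plane of the real and imaginary parts of
    each entry of row [i]. *)
Lemma row_phase_preserves i c s : c ^+ 2 + s ^+ 2 = 1 ->
  preserves_gaussian (row_phase i c s).
Proof.
move=> cs Z gZ.
pose al (j : 'I_n) : K := ((i, j), true); pose be (j : 'I_n) : K := ((i, j), false).
have albe j : al j != be j by rewrite !xpair_eqE andbF.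
have := iid_normal_rotate_columns sg0 (col := fun k : K => k.1.2) (al := al)
  (be := be) (fun=> erefl) (fun=> erefl) albe (enum 'I_n) cs gZ.
rewrite /gaussian_mx; congr iid_normal; apply/funext => -[[a j] b]; apply/funext => w.
rewrite /rotate_columns /re_im_entries /= mem_enum inE row_phaseE /al /be.
rewrite -[((a, j), b) == ((i, j), true)]/((a == i) && (j == j) && (b == true)).
rewrite -[((a, j), b) == ((i, j), false)]/((a == i) && (j == j) && (b == false)).
rewrite eqxx andbT; have [->|ai] /= := eqVneq a i; last by rewrite mul1r.
case: b => /=; case: (Z w i j) => x y /=; first by [].
by rewrite addrC.
Qed.

(** The coefficients are real, so real and imaginary parts are rotated separately, in two passes
    over the columns. *)
Lemma givens_preserves p q c s : p != q -> c ^+ 2 + s ^+ 2 = 1 ->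
  preserves_gaussian (givens p q c s).
Proof.
move=> pq cs Z gZ.
have qp : (q == p) = false by rewrite eq_sym (negbTE pq).
pose al b (j : 'I_n) : K := ((p, j), b); pose be b (j : 'I_n) : K := ((q, j), b).
have albe b j : al b j != be b j by rewrite !xpair_eqE (negbTE pq).
have h b X := @iid_normal_rotate_columns _ _ _ P K sg sg0 _
  (fun k : K => k.1.2) (al b)
  (be b) (fun=> erefl) (fun=> erefl) (albe b) (enum 'I_n) c s X cs.
have := h true _ (h false _ gZ).
rewrite /gaussian_mx; congr iid_normal; apply/funext => -[[a j] b]; apply/funext => w.
rewrite /rotate_columns /re_im_entries /= !mem_enum !inE givensE// /al /be !xpair_eqE !eqxx /=.
have [->|ap] := eqVneq a p; last have [->|aq] := eqVneq a q; rewrite ?eqxx ?qp ?(negbTE pq) /=.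
- case: b => /=; case: (Z w p j) => x y; case: (Z w q j) => x' y' /=; rewrite ?eqxx /=;
  by rewrite !mul0r ?subr0 ?addr0 ?add0r.
- case: b => /=; case: (Z w p j) => x y; case: (Z w q j) => x' y' /=; rewrite ?eqxx /=;
  by rewrite !mul0r ?subr0 ?addr0 ?add0r.
- by case: b.
Qed.

End GaussianMatrixInvariance.

(** * Generating the unitary group by phases and Givens rotations *)

Section UnitaryInvariance.
Context {R : realType} {d : measure_display} {T : measurableType d}.
Variables (P : probability T R) (m n : nat).
Local Notation C := (R[i])%C.
Local Notation sym := (@gaussian_symmetry R d T P m n).

Lemma row_phase_adj i (c s : R) : (@row_phase R m i c s)^t* = row_phase i c (- s).
Proof.
rewrite adj_diag; congr diag_mx; apply/rowP => k; rewrite !mxE.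
by case: ifP => // _; rewrite rmorph1.
Qed.

Lemma row_phase_unitary i (c s : R) : c ^+ 2 + s ^+ 2 = 1 ->
  @row_phase R m i c s \is unitarymx.
Proof.
move=> cs; apply/unitarymxP; rewrite row_phase_adj; apply/matrixP => a b.
rewrite row_phaseE [row_phase _ _ _ _ _]mxE [RHS]mxE mxE.
have [->|ai] := eqVneq a i; last by rewrite mul1r.
case: (i == b); rewrite ?mulr1n ?mulr0n ?mulr0//.
apply/eqP; rewrite eq_complex /= mulrN opprK -!expr2 cs eqxx /=.
by rewrite mulrN [c * s]mulrC addNr.
Qed.

Lemma row_phase_sym i (c s : R) : c ^+ 2 + s ^+ 2 = 1 -> sym (row_phase i c s).
Proof.
move=> cs; split; first exact: row_phase_unitary.
  exact: row_phase_preserves.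
by rewrite row_phase_adj; apply: row_phase_preserves; rewrite sqrrN.
Qed.

Lemma givens_adj p q (c s : R) : p != q ->
  (@givens R m p q c s)^t* = givens p q c (- s).
Proof.
move=> pq; have qp : (q == p) = false by rewrite eq_sym (negbTE pq).
have cr (x : R) : (x%:C%C)^* = x%:C%C :> C by rewrite (CrealP _)// complex_real.
apply/matrixP => a b; rewrite !mxE.
have cases (x : 'I_m) : [\/ x = p, x = q | (x != p) && (x != q)].
  have [->|xp] := eqVneq x p; first exact: Or31.
  by have [->|xq] := eqVneq x q; [exact: Or32|exact: Or33].
case: (cases a) => [->|->|/andP[/negbTE ap /negbTE aq]];
  case: (cases b) => [->|->|/andP[/negbTE bp /negbTE bq]];
  rewrite ?eqxx ?qp ?(negbTE pq) ?ap ?aq ?bp ?bq ?cr ?opprK ?rmorph0//.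
by rewrite eq_sym conjC_nat.
Qed.

Lemma givens_sym p q (c s : R) : p != q -> c ^+ 2 + s ^+ 2 = 1 -> sym (givens p q c s).
Proof.
move=> pq cs; have qp : (q == p) = false by rewrite eq_sym (negbTE pq).
split.
- apply/unitarymxP; rewrite givens_adj//; apply/matrixP => a b.
  have cs' : c%:C%C * c%:C%C + s%:C%C * s%:C%C = 1 :> C.
    by rewrite -!rmorphM -rmorphD -!expr2 cs.
  rewrite givensE// !mxE !eqxx qp !rmorphN /= !opprK.
  have cases (x : 'I_m) : [\/ x = p, x = q | (x != p) && (x != q)].
    have [->|xp] := eqVneq x p; first exact: Or31.
    by have [->|xq] := eqVneq x q; [exact: Or32|exact: Or33].
  case: (cases a) => [->|->|/andP[/negbTE ap /negbTE aq]];
    case: (cases b) => [->|->|/andP[/negbTE bp /negbTE bq]];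
    rewrite ?eqxx ?qp ?(negbTE pq) ?ap ?aq ?bp ?bq ?mulr0 ?subr0 ?addr0//.
  + by rewrite mulrN opprK.
  + by rewrite mulrC subrr.
  + by rewrite eq_sym bp.
  + by rewrite mulrN mulrC subrr.
  + by rewrite addrC.
  + by rewrite eq_sym bq.
- exact: givens_preserves.
- by rewrite givens_adj//; apply: givens_preserves; rewrite ?sqrrN.
Qed.

Lemma phase_exists (z : C) : exists c s : R,
  c ^+ 2 + s ^+ 2 = 1 /\ exists2 r : R, 0 <= r & (c +i* s)%C * z = r%:C%C.
Proof.
case: z => x y; pose r := Num.sqrt (x ^+ 2 + y ^+ 2).
have r2 : r ^+ 2 = x ^+ 2 + y ^+ 2 by rewrite sqr_sqrtr// addr_ge0 ?sqr_ge0.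
have [r0|r0] := eqVneq r 0.
  exists 1, 0; split; first by rewrite expr1n expr0n addr0.
  exists 0 => //; move: r2; rewrite r0 expr0n /= => /esym/eqP.
  rewrite paddr_eq0 ?sqr_ge0// !sqrf_eq0 => /andP[/eqP -> /eqP ->].
  by apply/eqP; rewrite eq_complex /= !mulr0 subrr addr0 eqxx.
exists (x / r), (- y / r); split.
  by rewrite !expr_div_n sqrrN -mulrDl -r2 divff// expf_neq0.
exists r; first exact: sqrtr_ge0.
apply/eqP; rewrite eq_complex /=; apply/andP; split; apply/eqP.
  by apply: (mulIf r0); rewrite -expr2 r2; field.
by field.
Qed.

Lemma gaussian_symmetry1 : sym 1%:M.
Proof.
have p1 : preserves_gaussian P n (1%:M : 'M[C]_m).
  by move=> Z; under [X in _ -> gaussian_mx _ X]eq_fun do rewrite mul1mx.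
split; [|exact: p1|rewrite adj1; exact: p1].
by apply/unitarymxP; rewrite adj1 mulmx1.
Qed.

(** Phases make both entries real and nonnegative, and a real rotation then moves all the weight to
    [j]. The last clause protects columns already reduced to basis vectors. *)
Lemma zero_entry (v : 'cV[C]_m) (i j : 'I_m) : i != j ->
  exists2 g, sym g &
    [/\ (g *m v) i 0 = 0,
        forall k, k != i -> k != j -> (g *m v) k 0 = v k 0 &
        forall k (e : 'cV[C]_m), e i 0 = 0 -> e j 0 = 0 -> (g *m e) k 0 = e k 0].
Proof.
move=> ij; have ji : j != i by rewrite eq_sym.
have [c1 [s1 [cs1 [b b0 eb]]]] := phase_exists (v i 0).
have [c2 [s2 [cs2 [a a0 ea]]]] := phase_exists (v j 0).
have [c [s [cs e0]]] : exists c s : R, c ^+ 2 + s ^+ 2 = 1 /\ s * a + c * b = 0.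
  pose r := Num.sqrt (a ^+ 2 + b ^+ 2).
  have r2 : r ^+ 2 = a ^+ 2 + b ^+ 2 by rewrite sqr_sqrtr// addr_ge0 ?sqr_ge0.
  have [r0|r0] := eqVneq r 0.
    exists 1, 0; split; first by rewrite expr1n expr0n addr0.
    move: r2; rewrite r0 expr0n /= => /esym/eqP.
    rewrite paddr_eq0 ?sqr_ge0// !sqrf_eq0 => /andP[/eqP -> /eqP ->].
    by rewrite mul0r mulr0 addr0.
  exists (a / r), (- b / r); split; last by field.
  by rewrite !expr_div_n sqrrN -mulrDl -r2 divff// expf_neq0.
exists (givens j i c s *m (row_phase j c2 s2 *m row_phase i c1 s1)).
  apply: gaussian_symmetryM; first exact: givens_sym.
  by apply: gaussian_symmetryM; exact: row_phase_sym.
split.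
- rewrite -!mulmxA givensE// (negbTE ij) eqxx !row_phaseE !eqxx (negbTE ji) (negbTE ij).
  by rewrite !mul1r ea eb -!rmorphM -rmorphD e0.
- move=> k ki kj; rewrite -!mulmxA givensE// (negbTE ki) (negbTE kj) !row_phaseE.
  by rewrite (negbTE ki) (negbTE kj) !mul1r.
- move=> k e ei ej; rewrite -!mulmxA givensE// !row_phaseE ei ej !mulr0 subr0 addr0.
  by have [->//|kj] := eqVneq k j; have [->//|ki] := eqVneq k i; rewrite !mul1r.
Qed.

Lemma zero_entries (v : 'cV[C]_m) (j : 'I_m) (s : seq 'I_m) : j \notin s ->
  exists2 g, sym g &
    [/\ forall k, k \in s -> (g *m v) k 0 = 0,
        forall k, k \notin s -> k != j -> (g *m v) k 0 = v k 0 &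
        forall e : 'cV[C]_m, (forall k, k \in j :: s -> e k 0 = 0) -> g *m e = e].
Proof.
elim: s => [|i s IH] js.
  exists 1%:M; first exact: gaussian_symmetry1.
  by split => // [k _ _|e _]; rewrite mul1mx.
move: js; rewrite inE negb_or => /andP[ji js].
have [g sg [g0 g1 g2]] := IH js.
have ij : i != j by rewrite eq_sym.
have [h sh [h0 h1 h2]] := zero_entry (g *m v) ij.
exists (h *m g); first exact: gaussian_symmetryM.
split.
- move=> k; rewrite inE -mulmxA; have [->//|ki /= ks] := eqVneq k i.
  rewrite h1 ?g0//; apply: contra js => /eqP <-; exact: ks.
- move=> k; rewrite inE negb_or => /andP[ki ks] kj.
  by rewrite -mulmxA h1// g1.
- move=> e e0; rewrite -mulmxA g2; last first.
    by move=> k ks; apply: e0; move: ks; rewrite !inE => /orP[->|->]//; rewrite !orbT.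
  by apply/colP => k; rewrite h2// e0// !inE eqxx ?orbT.
Qed.

Lemma gaussian_symmetry_cancel (h V : 'M[C]_m) : sym h -> sym (h *m V) -> sym V.
Proof.
move=> [uh gh gh'] shV; have sh' : sym (h^t*).
  split; [by rewrite trmxC_unitary|exact: gh'|rewrite trmxCK; exact: gh].
have e : h^t* *m (h *m V) = V by rewrite mulmxA (unitarymxV uh) mul1mx.
by rewrite -e; apply: gaussian_symmetryM; [exact: sh'|exact: shV].
Qed.

(* Givens rotations and phases reduce the columns of [U] to basis vectors one
   after the other. *)
Lemma unitary_symmetry (U : 'M[C]_m) : U \is unitarymx -> sym U.
Proof.
(* [j] columns are basis vectors already and [k] remain to be reduced. *)
suff main (k j : nat) : (j + k = m)%N -> forall V : 'M[C]_m, V \is unitarymx ->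
    (forall i : 'I_m, (i < j)%N -> col i V = delta_mx i 0) -> sym V.
  by move=> uU; apply: (main m 0%N).
elim: k j => [|k IH] j jk V uV Vj.
  have -> : V = 1%:M.
    apply/matrixP => a b; have bj : (b < j)%N by move: (ltn_ord b); rewrite -{2}jk addn0.
    by have /colP/(_ a) := Vj b bj; rewrite !mxE andbT.
  exact: gaussian_symmetry1.
have jm : (j < m)%N by rewrite -jk addnS ltnS leq_addr.
pose jo := Ordinal jm; pose u := col jo V.
(* Orthogonality to the earlier columns, which are basis vectors, kills the entries above the
   pivot. *)
have u0 (i : 'I_m) : (i < j)%N -> u i 0 = 0.
  move=> ij; have := unitarymxV uV => /matrixP/(_ i jo).
  rewrite mxE (bigD1 i)//= big1 => [|a ai].
    have /colP/(_ i) := Vj i ij; rewrite !mxE !eqxx => ->.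
    by rewrite rmorph1 mul1r addr0 -val_eqE /= ltn_eqF.
  have /colP/(_ a) := Vj i ij; rewrite !mxE (negbTE ai) /= => ->.
  by rewrite rmorph0 mul0r.
pose s := [seq i : 'I_m <- enum 'I_m | (j < i)%N].
have mem_s (i : 'I_m) : (i \in s) = (j < i)%N by rewrite mem_filter mem_enum andbT.
have js : jo \notin s by rewrite mem_s ltnn.
have [g sg [g0 g1 g2]] := zero_entries u js.
have [c [t [ct [r r0 er]]]] := phase_exists ((g *m u) jo 0).
pose h := row_phase jo c t *m g.
have sh : sym h by apply: gaussian_symmetryM; [exact: row_phase_sym|exact: sg].
have hu : h *m u = r%:C%C *: delta_mx jo 0.
  apply/colP => i; rewrite /h -mulmxA row_phaseE.
  have [->|ij] := eqVneq i jo; first by rewrite er !mxE !eqxx mulr1.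
  rewrite mul1r [RHS]mxE [X in _ = _ * X]mxE (negbTE ij) mulr0.
  have [ji|ji] := ltnP j i; first by rewrite g0// mem_s.
  have i_j : (i < j)%N by rewrite ltn_neqAle ji andbT; exact: ij.
  by rewrite g1 ?mem_s -?leqNgt// u0.
have [uh gh gh'] := sh.
have hcol i : col i (h *m V) = h *m col i V by rewrite !colE mulmxA.
have uhV : h *m V \is unitarymx := mul_unitarymx uh uV.
(* The reduced column has norm one and its only nonzero entry is the nonnegative [r]. *)
have r1 : r = 1.
  have := unitarymxV uhV => /matrixP/(_ jo jo); rewrite [RHS]mxE eqxx.
  have -> : ((h *m V)^t* *m (h *m V)) jo jo = ((h *m u)^t* *m (h *m u)) 0 0.
    by rewrite /u -hcol !mxE; apply: eq_bigr => a _; rewrite !mxE.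
  rewrite hu cV_normE (bigD1 jo)//= big1 => [|i ij].
    rewrite !mxE !eqxx mulr1 addr0 ger0_norm ?ler0c// -rmorphXn.
    by move=> /complexI /eqP; rewrite sqrf_eq1 => /orP[/eqP//|/eqP e]; move: r0; rewrite e ler0N1.
  by rewrite !mxE (negbTE ij) mulr0 normr0 expr0n.
have shV : sym (h *m V).
  apply: (IH j.+1) => //; first by rewrite addSnnS.
  move=> i; rewrite ltnS leq_eqVlt => /orP[/eqP ij|ij].
    have -> : i = jo by apply: val_inj.
    by rewrite hcol hu r1 scale1r.
  rewrite hcol Vj// /h -mulmxA g2.
    apply/colP => k'; rewrite row_phaseE; case: eqVneq => [->|_]; last by rewrite mul1r.
    by rewrite !mxE -val_eqE /= gtn_eqF// mulr0.
  move=> k'; rewrite inE mem_s => /orP[/eqP ->|jk'].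
    by rewrite mxE -val_eqE /= gtn_eqF.
  by rewrite mxE -val_eqE /= gtn_eqF// (ltn_trans ij).
exact: gaussian_symmetry_cancel sh shV.
Qed.

End UnitaryInvariance.

(** * Averaged rate and power *)

Section ComplexMeasurability.
Context {R : realType} {d : measure_display} {T : measurableType d}.
Local Notation C := (R[i])%C.

Definition cmeasurable (f : T -> C) : Prop :=
  measurable_fun setT (fun w => complex.Re (f w)) /\
  measurable_fun setT (fun w => complex.Im (f w)).

Lemma cmeasurable_cst (c : C) : cmeasurable (fun=> c).
Proof. by split. Qed.

Lemma cmeasurableD f g : cmeasurable f -> cmeasurable g ->
  cmeasurable (fun w => f w + g w).
Proof.
move=> [f1 f2] [g1 g2]; split.
  under eq_fun do rewrite raddfD; exact: measurable_funD.
under eq_fun do rewrite raddfD; exact: measurable_funD.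
Qed.

Lemma cmeasurableM f g : cmeasurable f -> cmeasurable g ->
  cmeasurable (fun w => f w * g w).
Proof.
move=> [f1 f2] [g1 g2].
have e w : f w * g w =
  ((complex.Re (f w) * complex.Re (g w) - complex.Im (f w) * complex.Im (g w)) +i*
   (complex.Re (f w) * complex.Im (g w) + complex.Im (f w) * complex.Re (g w)))%C.
  by case: (f w) => ? ?; case: (g w).
split; under eq_fun do rewrite e /=.
  by apply: measurable_funB; exact: measurable_funM.
by apply: measurable_funD; exact: measurable_funM.
Qed.

Lemma cmeasurable_conj f : cmeasurable f -> cmeasurable (fun w => (f w)^*).
Proof.
move=> [f1 f2]; split.
  by rewrite (_ : (fun _ => _) = fun w => complex.Re (f w))//;
    apply/funext => w; case: (f w).
rewrite (_ : (fun _ => _) = fun w => - complex.Im (f w)).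
  exact: measurableT_comp.
by apply/funext => w; case: (f w).
Qed.

Lemma cmeasurable_sum (I : Type) (s : seq I) (Q : pred I) (f : I -> T -> C) :
  (forall i, cmeasurable (f i)) -> cmeasurable (fun w => \sum_(i <- s | Q i) f i w).
Proof.
move=> mf; elim: s => [|i s IH].
  by under eq_fun do rewrite big_nil; exact: cmeasurable_cst.
under eq_fun do rewrite big_cons.
by case: (Q i) => //; exact: cmeasurableD.
Qed.

Lemma cmeasurable_prod (I : Type) (s : seq I) (Q : pred I) (f : I -> T -> C) :
  (forall i, cmeasurable (f i)) -> cmeasurable (fun w => \prod_(i <- s | Q i) f i w).
Proof.
move=> mf; elim: s => [|i s IH].
  by under eq_fun do rewrite big_nil; exact: cmeasurable_cst.
under eq_fun do rewrite big_cons.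
by case: (Q i) => //; exact: cmeasurableM.
Qed.

Definition mxmeasurable m n (F : T -> 'M[C]_(m, n)) : Prop :=
  forall i j, cmeasurable (fun w => F w i j).

Lemma mxmeasurable_cst m n (A : 'M[C]_(m, n)) : mxmeasurable (fun=> A).
Proof. by move=> i j; exact: cmeasurable_cst. Qed.

Lemma mxmeasurableD m n (F G : T -> 'M[C]_(m, n)) :
  mxmeasurable F -> mxmeasurable G -> mxmeasurable (fun w => F w + G w).
Proof.
by move=> mF mG i j; under eq_fun do rewrite mxE; exact: cmeasurableD.
Qed.

Lemma mxmeasurableM m n p (F : T -> 'M[C]_(m, n)) (G : T -> 'M[C]_(n, p)) :
  mxmeasurable F -> mxmeasurable G -> mxmeasurable (fun w => F w *m G w).
Proof.
move=> mF mG i j; under eq_fun do rewrite mxE.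
by apply: cmeasurable_sum => k; exact: cmeasurableM.
Qed.

Lemma mxmeasurable_adj m n (F : T -> 'M[C]_(m, n)) :
  mxmeasurable F -> mxmeasurable (fun w => (F w)^t*).
Proof.
by move=> mF i j; under eq_fun do rewrite !mxE; exact: cmeasurable_conj.
Qed.

Lemma cmeasurable_det n (F : T -> 'M[C]_n) : mxmeasurable F ->
  cmeasurable (fun w => \det (F w)).
Proof.
move=> mF; apply: cmeasurable_sum => s; apply: cmeasurableM.
  exact: cmeasurable_cst.
by apply: cmeasurable_prod => i.
Qed.

Lemma cmeasurable_tr n (F : T -> 'M[C]_n) : mxmeasurable F ->
  cmeasurable (fun w => \tr (F w)).
Proof. by move=> mF; apply: cmeasurable_sum => i. Qed.

End ComplexMeasurability.

(** * Pointwise inequalities for the log-determinant *)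

Section Pointwise.
Context {R : realType} {n p : nat}.
Local Notation C := (R[i])%C.
Variable D : 'M[C]_p.
Hypothesis pD : psd D.

Definition logdet (X : 'M[C]_n) (z : 'M[C]_(n, p)) : R :=
  ln (complex.Re (\det (1%:M + z *m D *m z^t* *m X))).

Definition trace_form (Y : 'M[C]_n) (z : 'M[C]_(n, p)) : R :=
  complex.Re (\tr (Y *m (z *m D *m z^t*))).

(** The matrix inside the determinant is not Hermitian in general. This symmetric form, with [V]
    independent of [X], is the one to which the determinant inequalities apply. *)
Lemma logdet_factor (z : 'M[C]_(n, p)) : exists V : 'M[C]_n,
  z *m D *m z^t* = V *m V^t* /\
  forall X, \det (1%:M + z *m D *m z^t* *m X) = \det (1%:M + V^t* *m X *m V).
Proof.
have [V eV] := psd_sqrt (psd_congr' z pD); exists V; split; [exact: eV|move=> X].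
by rewrite eV -[V *m _ *m X]mulmxA det_1D_mulC.
Qed.

Lemma Re_le (x y : C) : x <= y -> complex.Re x <= complex.Re y.
Proof. by rewrite lecE => /andP[]. Qed.

Lemma ReM_ge0 (x y : C) : 0 <= x -> 0 <= y ->
  complex.Re (x * y) = complex.Re x * complex.Re y.
Proof.
case: x => a b; case: y => c e; rewrite !lecE /= => /andP[/eqP -> _] /andP[/eqP -> _].
by rewrite mul0r subr0.
Qed.

Lemma det_1DM_ge1 (X : 'M[C]_n) z : psd X ->
  1 <= \det (1%:M + z *m D *m z^t* *m X).
Proof.
by move=> pX; have [V [_ ->]] := logdet_factor z; exact/det_1D_ge1/psd_congr.
Qed.

Lemma Re_det_gt0 (X : 'M[C]_n) z : psd X ->
  0 < complex.Re (\det (1%:M + z *m D *m z^t* *m X)).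
Proof.
by move=> pX; apply: lt_le_trans (Re_le (det_1DM_ge1 z pX)); rewrite /= ltr01.
Qed.

Lemma logdet_ge0 (X : 'M[C]_n) z : psd X -> 0 <= logdet X z.
Proof. by move=> pX; apply: ln_ge0; exact: Re_le (det_1DM_ge1 z pX). Qed.

Lemma logdet_leP (X : 'M[C]_n) z (r : R) : psd X ->
  (logdet X z <= r) = (complex.Re (\det (1%:M + z *m D *m z^t* *m X)) <= expR r).
Proof.
move=> pX; have p1 := Re_det_gt0 z pX.
by rewrite -ler_expR /logdet (lnK p1).
Qed.

Lemma expR_logdet (X : 'M[C]_n) z : psd X ->
  expR (logdet X z) = complex.Re (\det (1%:M + z *m D *m z^t* *m X)).
Proof. by move=> pX; rewrite /logdet (lnK (Re_det_gt0 z pX)). Qed.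

Lemma logdet_le (X Y : 'M[C]_n) z : psd X -> psd Y ->
  logdet X z <= logdet (X + Y) z.
Proof.
move=> pX pY; rewrite (logdet_leP z _ pX) (expR_logdet z (psdD pX pY)).
apply: Re_le; have [V [_ h]] := logdet_factor z; rewrite !h mulmxDr mulmxDl addrA.
by apply: det_1D_le; [exact: psd_congr pX|exact: psd_congr pY].
Qed.

Lemma logdet_sub (X Y : 'M[C]_n) z : psd X -> psd Y ->
  logdet (X + Y) z <= logdet X z + logdet Y z.
Proof.
move=> pX pY; rewrite (logdet_leP z _ (psdD pX pY)) expRD.
rewrite (expR_logdet z pX) (expR_logdet z pY).
have h1 := le_trans ler01 (det_1DM_ge1 z pX).
have h2 := le_trans ler01 (det_1DM_ge1 z pY).
rewrite -(ReM_ge0 h1 h2); apply: Re_le.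
have [V [_ h]] := logdet_factor z; rewrite !h mulmxDr mulmxDl addrA.
by apply: det_1D_sub; [exact: psd_congr pX|exact: psd_congr pY].
Qed.

Lemma logdet_mid (X Y : 'M[C]_n) z : psd X -> psd Y ->
  (logdet X z + logdet Y z) / 2 <= logdet (2^-1 *: (X + Y)) z.
Proof.
move=> pX pY; have pM : psd (2^-1 *: (X + Y)).
  by apply: psdZ; [rewrite invr_ge0 ler0n|exact: psdD pX pY].
have h1 := le_trans ler01 (det_1DM_ge1 z pX).
have h2 := le_trans ler01 (det_1DM_ge1 z pY).
have h3 := le_trans ler01 (det_1DM_ge1 z pM).
suff : expR (logdet X z + logdet Y z) <=
    expR (logdet (2^-1 *: (X + Y)) z + logdet (2^-1 *: (X + Y)) z).
  by rewrite ler_expR => h; rewrite ler_pdivrMr// mulr_natr mulr2n.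
rewrite !expRD (expR_logdet z pX) (expR_logdet z pY) (expR_logdet z pM).
rewrite -(ReM_ge0 h1 h2) -(ReM_ge0 h3 h3); apply: Re_le; rewrite -expr2.
have [V [_ h]] := logdet_factor z; rewrite !h.
have -> : 1%:M + V^t* *m (2^-1 *: (X + Y)) *m V =
  2^-1 *: ((1%:M + V^t* *m X *m V) + (1%:M + V^t* *m Y *m V)).
  rewrite -scalemxAr -scalemxAl mulmxDr mulmxDl addrACA [RHS]scalerDr; congr (_ + _).
  by rewrite -raddfD /= scale_scalar_mx mulVf ?pnatr_eq0.
have p1 Q : psd Q -> psd (1%:M + V^t* *m Q *m V).
  by move=> pQ; apply: psdD; [exact: psd1|exact: psd_congr pQ].
apply: det_midpoint; [|exact: p1 pX|exact: p1 pY].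
by apply: unit_aD; [exact: ltr01|exact: psd_congr pX].
Qed.

Lemma trace_form_ge0 (Y : 'M[C]_n) z : psd Y -> 0 <= trace_form Y z.
Proof.
move=> pY; apply: (Re_le (x := 0)); have [V [-> _]] := logdet_factor z.
by rewrite mulmxA mxtrace_mulC mulmxA; apply: psd_tr_ge0; exact: psd_congr pY.
Qed.

(** The inequality 1 + x <= exp x on each eigenvalue. It provides both the integrable majorant and
    the Lipschitz estimate. *)
Lemma logdet_le_trace (Y : 'M[C]_n) z : psd Y -> logdet Y z <= trace_form Y z.
Proof.
move=> pY; rewrite (logdet_leP z _ pY) /trace_form; have [V [-> ->]] := logdet_factor z.
rewrite mulmxA mxtrace_mulC mulmxA.
have [l l0 [-> /(_ 1 1)]] := psd_eigen (psd_congr V pY).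
rewrite scale1r => ->.
pose r i := complex.Re (l 0 i).
have lr i : l 0 i = (r i)%:C%C.
  by have := l0 i; rewrite lecE => /andP[/eqP /= i0 _]; apply/eqP; rewrite eq_complex /= i0 !eqxx.
have -> : \sum_i l 0 i = (\sum_i r i)%:C%C.
  by rewrite rmorph_sum; apply: eq_bigr.
have -> : \prod_i (1 + 1 * l 0 i) = (\prod_i (1 + r i))%:C%C.
  by rewrite rmorph_prod; apply: eq_bigr => i _; rewrite mul1r rmorphD rmorph1 lr.
rewrite /= expR_sum; apply: ler_prod => i _; rewrite expR_ge1Dx andbT.
by rewrite addr_ge0//; have := Re_le (l0 i).
Qed.

Lemma logdet_conj (U X : 'M[C]_n) z : U \is unitarymx ->
  logdet (U *m X *m U^t*) z = logdet X (U^t* *m z).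
Proof.
move=> uU; rewrite /logdet adjM trmxCK; congr (ln (complex.Re _)).
rewrite -[RHS](det_conj_unitary _ uU); congr determinant.
by rewrite mulmxDr mulmxDl mulmx1 (unitarymxK uU) !mulmxA (unitarymxK uU) mul1mx.
Qed.

Lemma trace_form_conj (U Y : 'M[C]_n) z : U \is unitarymx ->
  trace_form (U *m Y *m U^t*) z = trace_form Y (U^t* *m z).
Proof.
move=> uU; rewrite /trace_form adjM trmxCK; congr (complex.Re _).
by rewrite -!mulmxA mxtrace_mulC !mulmxA.
Qed.

End Pointwise.

(** A crude bound by the sum of squared moduli of the entries of [z], which is enough for
    integrability once second moments are finite. *)
Lemma norm_tr_sandwich_le (C : numClosedFieldType) n p (Y : 'M[C]_n) (D : 'M[C]_p)
    (z : 'M[C]_(n, p)) :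
  `|\tr (Y *m (z *m D *m z^t*))| <=
  (\sum_i \sum_j `|Y i j|) * (\sum_k \sum_l `|D k l|) * \sum_i \sum_k `|z i k| ^+ 2.
Proof.
set S := \sum_i \sum_k `|z i k| ^+ 2.
have S1 i k : `|z i k| ^+ 2 <= S.
  rewrite /S (bigD1 i)//= (bigD1 k)//= -addrA lerDl addr_ge0//.
    by apply: sumr_ge0 => *; rewrite exprn_ge0.
  by apply: sumr_ge0 => *; apply: sumr_ge0 => *; rewrite exprn_ge0.
have S2 i k j l : `|z i k| * `|z j l| <= S.
  have h : 0 <= (`|z i k| - `|z j l|) ^+ 2.
    by rewrite real_exprn_even_ge0// realB// ger0_real.
  have -> : `|z i k| * `|z j l| =
    (`|z i k| ^+ 2 + `|z j l| ^+ 2 - (`|z i k| - `|z j l|) ^+ 2) / 2 by field.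
  rewrite ler_pdivrMr// mulr_natr mulr2n.
  by rewrite lerBlDr ler_wpDr// lerD.
set KD := \sum_k \sum_l `|D k l|.
rewrite -mulrA mulr_suml; apply: (le_trans (ler_norm_sum _ _ _)).
apply: ler_sum => i _; rewrite mxE mulr_suml.
apply: (le_trans (ler_norm_sum _ _ _)); apply: ler_sum => j _.
rewrite normrM ler_wpM2l// /KD exchange_big /= mulr_suml.
rewrite mxE; apply: (le_trans (ler_norm_sum _ _ _)); apply: ler_sum => l _.
rewrite normrM mxE mulr_suml; apply: (@le_trans _ _ ((\sum_k `|z j k * D k l|) * `|(z^t*) l i|)).
  by rewrite ler_wpM2r// ler_norm_sum.
rewrite mulr_suml; apply: ler_sum => k _.
rewrite normrM mulrAC mulrC ler_wpM2l// !mxE norm_conjC.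
exact: S2.
Qed.

Section Moments.
Context {R : realType} {d : measure_display} {T : measurableType d}.
Variable (P : probability T R).

Lemma iid_normal_second_moment (K : finType) (sg : R) (X : K -> T -> measurableTypeR R) k :
  sg != 0 -> iid_normal P sg X ->
  (\int[P]_w ((X k w) ^+ 2)%:E < +oo)%E.
Proof.
move=> sg0 [mX iX].
have law A : measurable A -> pushforward P (X k) A = normal_prob (0 : R) sg A.
  move=> mA; have := iX (fun i => if i == k then A else setT).
  have -> : \bigcap_i (X i @^-1` (if i == k then A else setT)) = X k @^-1` A.
    apply/seteqP; split => w; first by move=> /(_ k I) /=; rewrite eqxx.
    by move=> h i _ /=; case: eqVneq => // ->.
  rewrite /pushforward => -> => [|i]; last by case: ifP.
  rewrite (bigD1 k)//= eqxx big1 => [|i ik].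
    by rewrite mulr1 fineK// fin_num_measure.
  by rewrite (negbTE ik) probability_setT.
have msq : measurable_fun setT (fun x : measurableTypeR R => (x ^+ 2)%:E).
  by apply/measurable_EFinP; exact: measurable_funX.
have <- : (\int[pushforward P (X k)]_x (x ^+ 2)%:E = \int[P]_w ((X k w) ^+ 2)%:E)%E.
  apply: (@ge0_integral_pushforward _ _ _ _ R _ (mX k) P setT
    (fun x : measurableTypeR R => (x ^+ 2)%:E)) => // x _.
  by rewrite lee_fin sqr_ge0.
rewrite (eq_measure_integral (normal_prob (0 : R) sg)).
  exact: normal_second_moment.
by move=> A mA _; exact: law.
Qed.

End Moments.

(** * Integrability and invariance of the averages *)

Section GaussianAverages.
Context {R : realType} {d : measure_display} {T : measurableType d}.
Variables (P : probability T R) (n p : nat).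
Local Notation C := (R[i])%C.
Local Notation MR := (measurableTypeR R).
Local Notation K := (('I_n * 'I_p) * bool)%type.
Variables (D : 'M[C]_p) (Z : T -> 'M[C]_(n, p)).
Hypotheses (pD : psd D) (gZ : gaussian_mx P Z).

Lemma mxmeasurable_gaussian (Z' : T -> 'M[C]_(n, p)) : gaussian_mx P Z' -> mxmeasurable Z'.
Proof.
by move=> [mZ _] i j; split; [exact: (mZ ((i, j), true))|exact: (mZ ((i, j), false))].
Qed.

Let tup_mx (t : #|{: K}|.-tuple MR) : 'M[C]_(n, p) :=
  \matrix_(i, j) (tnth t (enum_rank ((i, j), true)) +i*
                  tnth t (enum_rank ((i, j), false)))%C.

Let mxmeasurable_tup_mx : mxmeasurable tup_mx.
Proof.
by move=> i j; split; under eq_fun do rewrite mxE /=; exact: measurable_tnth.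
Qed.

Let tup_mxK (Z' : T -> 'M[C]_(n, p)) (w : T) : tup_mx (family_tuple (re_im_entries Z') w) = Z' w.
Proof.
apply/matrixP => i j; rewrite mxE !tnth_mktuple !enum_rankK /re_im_entries /=.
by case: (Z' w i j).
Qed.

(** Measurability of [f] is expressed by composing it with entrywise measurable matrices on an
    arbitrary space; it is applied to [tup_mx], which decodes the tuple of real coordinates. *)
Lemma gaussian_integral_unitary (f : 'M[C]_(n, p) -> R) (U : 'M[C]_n) :
  U \is unitarymx -> (forall z, 0 <= f z) ->
  (forall d' (T' : measurableType d') (F : T' -> 'M[C]_(n, p)),
     mxmeasurable F -> measurable_fun setT (f \o F)) ->
  (\int[P]_w (f (U *m Z w))%:E = \int[P]_w (f (Z w))%:E)%E.
Proof.
move=> uU f0 mf; have [_ gU _] := unitary_symmetry P p uU.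
have mft : measurable_fun setT (fun t => (f (tup_mx t))%:E).
  by apply/measurable_EFinP; exact: mf mxmeasurable_tup_mx.
have := iid_normal_integral (gU Z gZ) gZ mft (fun t => f0 _).
under eq_integral do rewrite tup_mxK.
by under [X in _ = X -> _]eq_integral do rewrite tup_mxK.
Qed.

Lemma measurable_logdet (X : 'M[C]_n) d' (T' : measurableType d') (F : T' -> 'M[C]_(n, p)) :
  mxmeasurable F -> measurable_fun setT (logdet D X \o F).
Proof.
move=> mF; apply: measurableT_comp; first exact: measurable_ln.
suff : cmeasurable (fun w => \det (1%:M + F w *m D *m (F w)^t* *m X)) by case.
apply/cmeasurable_det/mxmeasurableD; first exact: mxmeasurable_cst.
apply: mxmeasurableM; last exact: mxmeasurable_cst.
apply: mxmeasurableM; last exact: mxmeasurable_adj.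
by apply: mxmeasurableM; last exact: mxmeasurable_cst.
Qed.

Lemma measurable_trace_form (Y : 'M[C]_n) d' (T' : measurableType d')
    (F : T' -> 'M[C]_(n, p)) :
  mxmeasurable F -> measurable_fun setT (trace_form D Y \o F).
Proof.
move=> mF.
suff : cmeasurable (fun w => \tr (Y *m (F w *m D *m (F w)^t*))) by case.
apply/cmeasurable_tr/mxmeasurableM; first exact: mxmeasurable_cst.
apply: mxmeasurableM; last exact: mxmeasurable_adj.
by apply: mxmeasurableM; last exact: mxmeasurable_cst.
Qed.

Lemma trace_form_le_norm (Y : 'M[C]_n) : exists k : R, 0 <= k /\ forall z,
  psd Y -> trace_form D Y z <=
  k * \sum_i \sum_j (complex.Re (z i j) ^+ 2 + complex.Im (z i j) ^+ 2).
Proof.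
pose KC : C := (\sum_i \sum_j `|Y i j|) * (\sum_k \sum_l `|D k l|).
have KC0 : 0 <= KC.
  by rewrite mulr_ge0//; do 2! (apply: sumr_ge0 => ? _).
exists (complex.Re KC); split; first exact: Re_le KC0.
move=> z pY; have h := norm_tr_sandwich_le Y D z.
set S := \sum_i _; rewrite -/KC in h.
have eS : \sum_i \sum_k `|z i k| ^+ 2 = S%:C%C.
  rewrite rmorph_sum; apply: eq_bigr => i _; rewrite rmorph_sum; apply: eq_bigr => j _.
  by rewrite -add_Re2_Im2.
rewrite eS in h; have S0 : 0 <= S%:C%C.
  by rewrite -eS; do 2! (apply: sumr_ge0 => ? _); rewrite exprn_ge0.
have -> : complex.Re KC * S = complex.Re (KC * S%:C%C) by rewrite (ReM_ge0 KC0 S0).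
apply: Re_le; apply: le_trans h.
have t0 : 0 <= \tr (Y *m (z *m D *m z^t*)).
  have [V eV] := psd_sqrt (psd_congr' z pD).
  by rewrite eV mulmxA mxtrace_mulC mulmxA; apply: psd_tr_ge0; exact: psd_congr pY.
by rewrite (ger0_norm t0).
Qed.

Lemma integrable_trace_form (Y : 'M[C]_n) : psd Y ->
  P.-integrable setT (fun w => (trace_form D Y (Z w))%:E).
Proof.
move=> pY; have mZ := mxmeasurable_gaussian gZ.
have [k [k0 h]] := trace_form_le_norm Y.
pose g w := \sum_i \sum_j (complex.Re (Z w i j) ^+ 2 + complex.Im (Z w i j) ^+ 2).
have iX (kk : K) : P.-integrable setT (fun w => ((re_im_entries Z kk w) ^+ 2)%:E).
  have [mX _] := gZ; apply/integrableP; split.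
    by apply/measurable_EFinP; apply: measurable_funX; exact: mX.
  have s0 : Num.sqrt (2^-1 : R) != 0 by rewrite gt_eqF// sqrtr_gt0 invr_gt0.
  under eq_integral do rewrite /= ger0_norm ?sqr_ge0//.
  exact: iid_normal_second_moment s0 gZ.
have ig : P.-integrable setT (fun w => (g w)%:E).
  under eq_fun do rewrite /g -sumEFin.
  apply: integrable_sum => // i _; under eq_fun do rewrite -sumEFin.
  apply: integrable_sum => // j _; under eq_fun do rewrite EFinD.
  by apply: integrableD => //; [exact: (iX ((i, j), true))|exact: (iX ((i, j), false))].
have ikg : P.-integrable setT (fun w => (k * g w)%:E).
  by under eq_fun do rewrite EFinM; exact: integrableZl.
apply: (le_integrable _ _ _ ikg) => //.
  by apply/measurable_EFinP; exact: measurable_trace_form mZ.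
move=> w _; rewrite /= lee_fin (ger0_norm (trace_form_ge0 pD (Z w) pY)).
by apply: le_trans (ler_norm _); exact: h.
Qed.

Lemma integrable_logdet (X : 'M[C]_n) : psd X ->
  P.-integrable setT (fun w => (logdet D X (Z w))%:E).
Proof.
move=> pX; apply: (le_integrable _ _ _ (integrable_trace_form pX)) => //.
  by apply/measurable_EFinP; exact: measurable_logdet (mxmeasurable_gaussian gZ).
move=> w _; rewrite /= lee_fin (ger0_norm (trace_form_ge0 pD (Z w) pX)).
by rewrite (ger0_norm (logdet_ge0 pD (Z w) pX)); exact: logdet_le_trace.
Qed.

Definition avg_logdet (X : 'M[C]_n) : R := (\int[P]_w logdet D X (Z w))%R.
Definition avg_trace (Y : 'M[C]_n) : R := (\int[P]_w trace_form D Y (Z w))%R.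

Lemma avg_logdet_conj (U X : 'M[C]_n) : U \is unitarymx -> psd X ->
  avg_logdet (U *m X *m U^t*) = avg_logdet X.
Proof.
move=> uU pX; have uU' : U^t* \is unitarymx by rewrite trmxC_unitary.
have e := gaussian_integral_unitary uU' (fun z => logdet_ge0 pD z pX)
  (fun _ _ _ => @measurable_logdet X _ _ _).
transitivity (fine (\int[P]_w (logdet D X (U^t* *m Z w))%:E)%E).
  apply: (congr1 fine); apply: eq_integral => w _; apply: (congr1 EFin).
  exact: (logdet_conj D X (Z w) uU).
exact: (congr1 fine e).
Qed.

Lemma avg_trace_conj (U Y : 'M[C]_n) : U \is unitarymx -> psd Y ->
  avg_trace (U *m Y *m U^t*) = avg_trace Y.
Proof.
move=> uU pY; have uU' : U^t* \is unitarymx by rewrite trmxC_unitary.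
have e := gaussian_integral_unitary uU' (fun z => trace_form_ge0 pD z pY)
  (fun _ _ _ => @measurable_trace_form Y _ _ _).
transitivity (fine (\int[P]_w (trace_form D Y (U^t* *m Z w))%:E)%E).
  apply: (congr1 fine); apply: eq_integral => w _; apply: (congr1 EFin).
  exact: (trace_form_conj D Y (Z w) uU).
exact: (congr1 fine e).
Qed.

Lemma avg_logdet_mono (X Y : 'M[C]_n) : psd X -> psd Y ->
  avg_logdet X <= avg_logdet (X + Y).
Proof.
move=> pX pY; apply: le_Rintegral => //.
- exact: integrable_logdet pX.
- exact: integrable_logdet (psdD pX pY).
- by move=> w _; exact: logdet_le.
Qed.

Lemma avg_logdet_mid (X Y : 'M[C]_n) : psd X -> psd Y ->
  (avg_logdet X + avg_logdet Y) / 2 <= avg_logdet (2^-1 *: (X + Y)).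
Proof.
move=> pX pY; have iX := integrable_logdet pX; have iY := integrable_logdet pY.
have pM : psd (2^-1 *: (X + Y)).
  by apply: psdZ; [rewrite invr_ge0 ler0n|exact: psdD pX pY].
have iXY : P.-integrable setT (EFin \o (fun w => logdet D X (Z w) + logdet D Y (Z w))).
  by rewrite /comp; under eq_fun do rewrite EFinD; exact: integrableD.
rewrite /avg_logdet -RintegralD// -RintegralZr//.
apply: le_Rintegral => //.
- by rewrite /comp; under eq_fun do rewrite EFinM; exact: integrableZr.
- exact: integrable_logdet pM.
- by move=> w _; exact: logdet_mid.
Qed.

Lemma avg_logdet_sub (X Y : 'M[C]_n) : psd X -> psd Y ->
  avg_logdet (X + Y) <= avg_logdet X + avg_trace Y.
Proof.
move=> pX pY; have iX := integrable_logdet pX; have iY := integrable_trace_form pY.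
rewrite /avg_logdet -RintegralD//; apply: le_Rintegral => //.
- exact: integrable_logdet (psdD pX pY).
- by rewrite /comp; under eq_fun do rewrite EFinD; exact: integrableD.
- move=> w _; apply: le_trans (logdet_sub pD (Z w) pX pY) _.
  by rewrite lerD2l; exact: logdet_le_trace.
Qed.

End GaussianAverages.

(** * The average trace and the continuity of the averaged rate *)

Section TraceAverage.
Context {R : realType} {d : measure_display} {T : measurableType d}.
Variables (P : probability T R) (n p : nat).
Local Notation C := (R[i])%C.
Variables (D : 'M[C]_p) (Z : T -> 'M[C]_(n, p)).
Hypotheses (pD : psd D) (gZ : gaussian_mx P Z).
Local Notation avg_trace := (avg_trace P D Z).
Local Notation avg_logdet := (avg_logdet P D Z).

Lemma psd_delta (i : 'I_n) : psd (delta_mx i i : 'M[C]_n).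
Proof.
have -> : (delta_mx i i : 'M[C]_n) = (delta_mx 0 i : 'rV[C]_n)^t* *m delta_mx 0 i.
  by rewrite trmx_delta map_delta_mx mul_delta_mx.
exact: psd_gram.
Qed.

(** Conjugation by the transposition of [i] and [j], a unitary matrix, exchanges the two coordinate
    projections. *)
Lemma avg_trace_delta (i j : 'I_n) :
  avg_trace (delta_mx i i) = avg_trace (delta_mx j j).
Proof.
pose s := perm.tperm i j; pose U : 'M[C]_n := perm_mx s.
have Uadj : U^t* = perm_mx s.
  by rewrite tr_perm_mx map_perm_mx perm.tpermV.
have uU : U \is unitarymx.
  by apply/unitarymxP; rewrite Uadj -perm_mxM perm.tperm2 perm_mx1.
rewrite -(avg_trace_conj pD gZ uU (psd_delta i)); congr avg_trace.
rewrite Uadj -[s in _ *m perm_mx s]perm.tpermV -col_permE -row_permE.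
apply/matrixP => a b; rewrite !mxE.
have h (c : 'I_n) : (s c == i) = (c == j).
  by rewrite -(perm.tpermR i j) (inj_eq perm.perm_inj).
by rewrite !h.
Qed.

Lemma trace_form_diag (l : 'rV[C]_n) z : (forall i, 0 <= l 0 i) ->
  trace_form D (diag_mx l) z =
  \sum_i complex.Re (l 0 i) * trace_form D (delta_mx i i) z.
Proof.
move=> l0; have pW := psd_congr' z pD.
have tr_diag (l' : 'rV[C]_n) (X : 'M[C]_n) :
    \tr (diag_mx l' *m X) = \sum_i l' 0 i * X i i.
  by rewrite mul_diag_mx; apply: eq_bigr => i _; rewrite mxE.
rewrite /trace_form; move: (z *m D *m z^t*) pW => W pW.
rewrite tr_diag raddf_sum; apply: eq_bigr => i _.
have -> : (delta_mx i i : 'M[C]_n) = diag_mx (delta_mx 0 i).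
  apply/matrixP => a b; rewrite !mxE /=.
  have [->|ab] := eqVneq a b; first by rewrite mulr1n andbb.
  rewrite mulr0n; case: eqP => //= ai; case: eqP => //= bi.
  by rewrite ai bi eqxx in ab.
rewrite tr_diag (bigD1 i)//= big1 => [|j ji].
  by rewrite mxE !eqxx mul1r addr0; exact: (ReM_ge0 (l0 i) (psd_entry_ge0 i pW)).
by rewrite mxE (negbTE ji) andbF mul0r.
Qed.

(** By unitary invariance E[Z D Z^H] acts as a multiple of the identity: diagonalize Y, then use
    that all coordinate projections have the same average [tau]. *)
Lemma avg_trace_scalar : exists2 tau : R, 0 <= tau &
  forall Y : 'M[C]_n, psd Y -> avg_trace Y = tau * complex.Re (\tr Y).
Proof.
have [tau [tau0 htau]] : exists tau : R, 0 <= tau /\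
    forall i : 'I_n, avg_trace (delta_mx i i) = tau.
  (* In dimension zero there is no projection to average, and the value 0 is taken. *)
  have [i0|] := pickP 'I_n => [_|n0]; last by exists 0; split => // i; have := n0 i.
  exists (avg_trace (delta_mx i0 i0)); split; last by move=> i; exact: avg_trace_delta.
  by apply: Rintegral_ge0 => w _; exact: (trace_form_ge0 pD (Z w) (psd_delta i0)).
exists tau => // Y /psd_spectral[U [l [uU l0 ->]]].
rewrite (avg_trace_conj pD gZ uU (psd_diag l0)) (tr_conj_unitary _ uU) mxtrace_diag.
rewrite raddf_sum mulr_sumr /avg_trace.
under eq_Rintegral do rewrite (trace_form_diag _ l0).
have iE (i : 'I_n) := integrable_trace_form pD gZ (psd_delta i).
have iL (i : 'I_n) : P.-integrable setT
    (fun w => (complex.Re (l 0 i) * trace_form D (delta_mx i i) (Z w))%:E).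
  under eq_fun do rewrite EFinM.
  by apply: integrableZl; [exact: measurableT|exact: (iE i)].
elim: (index_enum _) => [|i r IH].
  by under eq_Rintegral do rewrite big_nil; rewrite big_nil Rintegral_cst// mul0r.
under eq_Rintegral do rewrite big_cons.
rewrite big_cons RintegralD; first last.
- rewrite /comp; under eq_fun do rewrite -sumEFin.
  by apply: integrable_sum => // j _; exact: iL.
- exact: iL.
- by [].
rewrite IH RintegralZl//; last exact: iE.
by congr (_ + _); have := htau i; rewrite /avg_trace => ->; rewrite mulrC.
Qed.

(* The positive part of [y' - y] is what has to be added to pass above [y']. *)
Lemma avg_logdet_diag_lipschitz : exists2 k : R, 0 <= k &
  forall y y' : 'rV[R]_n, nonneg_row y -> nonneg_row y' ->
  avg_logdet (realdiag y') <= avg_logdet (realdiag y) + k * \sum_i `|y' 0 i - y 0 i|.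
Proof.
have [tau tau0 htau] := avg_trace_scalar; exists tau => // y y' y0 y0'.
pose e : 'rV[R]_n := \row_i Num.max 0 (y' 0 i - y 0 i).
pose f : 'rV[R]_n := \row_i (y 0 i + e 0 i - y' 0 i).
have e0 : nonneg_row e by move=> i; rewrite mxE le_max lexx.
have f0 : nonneg_row f.
  by move=> i; rewrite !mxE; case: (leP 0 (y' 0 i - y 0 i)) => h; lra.
have pr (l : 'rV[R]_n) : nonneg_row l -> psd (realdiag l).
  by move=> l0; apply: psd_diag => i; rewrite mxE ler0c.
have rD (l l' : 'rV[R]_n) : realdiag l + realdiag l' = realdiag (l + l').
  rewrite /realdiag -raddfD; congr diag_mx; apply/rowP => i.
  by rewrite !mxE rmorphD.
have h : y + e = y' + f.
  by apply/rowP => i; rewrite !mxE addrC [in RHS]addrC subrK addrC.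
apply: (@le_trans _ _ (avg_logdet (realdiag y' + realdiag f))).
  exact: (avg_logdet_mono pD gZ (pr _ y0') (pr _ f0)).
rewrite rD -h -rD.
apply: le_trans (avg_logdet_sub pD gZ (pr _ y0) (pr _ e0)) _.
rewrite lerD2l (htau _ (pr _ e0)) mxtrace_diag ler_wpM2l// raddf_sum.
apply: ler_sum => i _; rewrite !mxE /=.
by rewrite ge_max normr_ge0 ler_norm.
Qed.

End TraceAverage.

(** * The relay problem *)

(** Extreme value theorem: the constraints are closed conditions, and each positive cost [c 0 i]
    bounds the coordinate by [Pm / c 0 i]. Since [y] is nonnegative everywhere, the estimate on [g]
    makes [g \o y] continuous on the whole space. *)
Lemma ratio_max_exists (R : realType) (n : nat) (c : 'rV[R]_n)
    (y : 'rV[R]_n -> 'rV[R]_n) (g : 'rV[R]_n -> R) (k q Pm Rm : R) :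
  (forall i, 0 < c 0 i) -> 0 < q ->
  (forall i, continuous (fun l : 'rV[R]_n => y l 0 i : R)) ->
  (forall l, nonneg_row (y l)) ->
  (forall u v : 'rV[R]_n, nonneg_row u -> nonneg_row v ->
     g v <= g u + k * \sum_i `|v 0 i - u 0 i|) ->
  (exists2 l : 'rV[R]_n, nonneg_row l &
     \sum_i l 0 i * c 0 i <= Pm /\ Rm <= g (y l)) ->
  exists2 l : 'rV[R]_n, nonneg_row l &
    [/\ \sum_i l 0 i * c 0 i <= Pm, Rm <= g (y l) &
    forall l' : 'rV[R]_n, nonneg_row l' -> \sum_i l' 0 i * c 0 i <= Pm ->
      Rm <= g (y l') ->
      g (y l') / (\sum_i l' 0 i * c 0 i + q) <= g (y l) / (\sum_i l 0 i * c 0 i + q)].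
Proof.
move=> c0 q0 cy y0 lip [l0 l00 [l0P l0R]].
have coord i : continuous (fun l : 'rV[R]_n => l 0 i : R) by exact: coord_continuous.
have csum (h : 'I_n -> 'rV[R]_n -> R) : (forall i, continuous (h i)) ->
    continuous (fun l => \sum_i h i l).
  by move=> ch; apply: continuous_big => // ; exact: add_continuous.
have cphi : continuous (g \o y).
  move=> l; pose e l' := k * \sum_i `|y l' 0 i - y l 0 i|.
  have ce : e l' @[l' --> l] --> 0.
    have -> : 0 = e l by rewrite /e big1 ?mulr0// => i _; rewrite subrr normr0.
    suff : continuous e by exact.
    move=> x; apply: continuousM; first exact: cst_continuous.
    apply: (csum (fun i l' => `|y l' 0 i - y l 0 i|)) => i l'.
    apply: (continuous_comp (f := fun l' => y l' 0 i - y l 0 i) (g := Num.norm)).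
      by apply: continuousB; [exact: cy|exact: cst_continuous].
    exact: norm_continuous.
  have c1 : g (y l) - e l' @[l' --> l] --> g (y l).
    by rewrite -[X in _ --> X]subr0; exact: (cvgB (cvg_cst _) ce).
  have c2 : g (y l) + e l' @[l' --> l] --> g (y l).
    by rewrite -[X in _ --> X]addr0; exact: (cvgD (cvg_cst _) ce).
  apply: (squeeze_cvgr _ c1 c2); apply: nearW => l'.
  rewrite lerBlDr /e lip//= andbT.
  by under eq_bigr do rewrite distrC; exact: lip.
(* Positive parts keep the cost nonnegative off the feasible set too, so the denominator never
   vanishes and the ratio is continuous everywhere. *)
pose m (l : 'rV[R]_n) := \sum_i Num.max 0 (l 0 i) * c 0 i.
have mE l : nonneg_row l -> m l = \sum_i l 0 i * c 0 i.
  by move=> l_0; apply: eq_bigr => i _; rewrite max_r.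
have cm : continuous m.
  apply: (csum (fun i l => Num.max 0 (l 0 i) * c 0 i)) => i l.
  apply: (continuousM (s := fun l : 'rV[R]_n => Num.max 0 (l 0 i))
    (t := cst (c 0 i))); last exact: cst_continuous.
  apply: (continuous_max (f := cst 0) (g := fun l : 'rV[R]_n => l 0 i)).
    exact: cst_continuous.
  exact: coord.
have m0 l : 0 <= m l.
  by apply: sumr_ge0 => i _; rewrite mulr_ge0 ?le_max ?lexx// ltW.
pose A : set 'rV[R]_n := [set l | nonneg_row l /\ (m l <= Pm /\ Rm <= g (y l))].
have pre (h : 'rV[R]_n -> R) (B : set R) : continuous h -> closed B -> closed (h @^-1` B).
  by move=> ch; apply: preimage_closed => l _; exact: ch.
have Acl : closed A.
  have -> : A = (\bigcap_i [set l : 'rV[R]_n | 0 <= l 0 i]) `&`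
      ([set l | m l <= Pm] `&` [set l | Rm <= (g \o y) l]).
    apply/seteqP; split => l [h1 h2]; split => // i; first by move=> _; exact: h1.
    exact: (h1 i I).
  apply: closedI; last apply: closedI.
  - apply: closed_bigI => i _.
    exact: (pre (fun l : 'rV[R]_n => l 0 i) _ (coord i) (@closed_ge _ 0)).
  - exact: (pre m _ cm (@closed_le _ Pm)).
  - exact: (pre (g \o y) _ cphi (@closed_ge _ Rm)).
have Ac : compact A.
  apply: (subclosed_compact Acl (rV_compact (A := fun i => `[0, Pm / c 0 i]%classic) _)).
    by move=> i; exact: segment_compact.
  move=> l [l_0 [lP _]] i; rewrite /= in_itv/= l_0 ler_pdivlMr//.
  apply: le_trans lP; rewrite mE// (bigD1 i)//= lerDl.
  by apply: sumr_ge0 => j _; rewrite mulr_ge0// ltW.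
have A0 : A !=set0 by exists l0; split => //; rewrite mE.
pose f l := g (y l) / (m l + q).
have cf : {within A, continuous f}.
  apply: continuous_subspaceT => l.
  have mq : m l + q != 0 by rewrite gt_eqF// ltr_wpDl.
  have cmq : {for l, continuous (fun l => m l + q)}.
    by apply: continuousD; [exact: cm|exact: cst_continuous].
  exact: (continuousM (s := g \o y) (t := fun l => (m l + q)^-1) (@cphi l)
    (continuousV (s := fun l => m l + q) mq cmq)).
have [l /set_mem[l_0 [lP lR]] lmax] := EVT_max_rV A0 Ac cf.
exists l => //; split; [by rewrite -mE|by []|] => l' l_0' lP' lR'.
have := lmax l'; rewrite /f !mE//; apply; apply/mem_set; split => //.
by rewrite mE.
Qed.

Section RelayIdentities.
Context {R : realType}.
Local Notation C := (R[i])%C.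

Lemma psdmxP n (Q : 'M[C]_n) : psdmx Q -> psd Q.
Proof.
move=> [/is_hermitianmxP h p]; split; last exact: p.
by move: h; rewrite expr0 scale1r => <-.
Qed.

Definition complex_row n (l : 'rV[R]_n) : 'rV[C]_n := map_mx (fun x : R => x%:C%C) l.

Lemma sqrtC_real (x : R) : 0 <= x -> sqrtC (x%:C%C) = (Num.sqrt x)%:C%C :> C.
Proof.
move=> x0; rewrite -{1}(sqr_sqrtr x0) rmorphXn /=.
by rewrite sqrCK// ler0c sqrtr_ge0.
Qed.

Lemma realdiag_sqrt n (l : 'rV[R]_n) : nonneg_row l ->
  realdiag (sqrt_row l) = diag_mx (map_mx sqrtC (complex_row l)).
Proof.
by move=> l0; congr diag_mx; apply/rowP => i; rewrite !mxE sqrtC_real.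
Qed.

Lemma realdiag_adj n (l : 'rV[R]_n) : (realdiag l)^t* = realdiag l.
Proof.
rewrite adj_diag; congr diag_mx; apply/rowP => i; rewrite !mxE.
by rewrite (CrealP _)// complex_real.
Qed.

Lemma realdiag_sqrt_sqr n (l : 'rV[R]_n) : nonneg_row l ->
  realdiag (sqrt_row l) *m realdiag (sqrt_row l) = realdiag l.
Proof.
move=> l0; rewrite mulmx_diag; congr diag_mx; apply/rowP => i.
by rewrite !mxE -rmorphM -expr2 sqr_sqrtr.
Qed.

Lemma evd_sqrt_adj n (U : 'M[C]_n) (l : 'rV[R]_n) : (evd_sqrt U l)^t* = evd_sqrt U l.
Proof. by rewrite /evd_sqrt !adjM trmxCK realdiag_adj mulmxA. Qed.

(* The diagonal of [Lambda_G] padded with zeros to the full dimension. *)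
Definition gram_row m n (s : 'rV[R]_(minn m n)) : 'rV[R]_n :=
  \row_i \sum_k s 0 k *+ (k == i :> nat).

Lemma rectdiag_gram m n (s : 'rV[R]_(minn m n)) : nonneg_row s ->
  (rectdiag (sqrt_row s))^t* *m rectdiag (sqrt_row s) = realdiag (gram_row s).
Proof.
move=> s0; set wl := widen_ord (geq_minl m n); set wr := widen_ord (geq_minr m n).
have -> : (rectdiag (sqrt_row s))^t* =
    \sum_k (sqrt_row s 0 k)%:C%C *: delta_mx (wr k) (wl k).
  rewrite /rectdiag (big_morph (fun A : 'M[C]_(m, n) => A^t*) (@adjD C m n) (@adj0 C m n)).
  apply: eq_bigr => k _.
  by rewrite adjZ trmx_delta map_delta_mx (CrealP _)// complex_real.
have -> : (\sum_k (sqrt_row s 0 k)%:C%C *: delta_mx (wr k) (wl k)) *m rectdiag (sqrt_row s) =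
    \sum_k (s 0 k)%:C%C *: delta_mx (wr k) (wr k).
  rewrite mulmx_suml; apply: eq_bigr => k _; rewrite mulmx_sumr (bigD1 k)//= big1.
    rewrite addr0 -scalemxAl -scalemxAr scalerA mul_delta_mx -rmorphM mxE -expr2.
    by rewrite sqr_sqrtr.
  move=> k' kk'; rewrite -scalemxAl -scalemxAr mul_delta_mx_cond.
  have -> : (wl k == wl k') = false by rewrite -val_eqE /= eq_sym; exact: negbTE.
  by rewrite mulr0n !scaler0.
apply/matrixP => i j; rewrite summxE !mxE rmorph_sum -sumrMnl; apply: eq_bigr => k _.
rewrite !mxE -!val_eqE /= [k == i :> nat]eq_sym raddfMn /=.
have [->|ij] := eqVneq (i : nat) j; first by rewrite andbb mulr_natr mulr1n.
rewrite mulr0n; case: eqP => [ik|]; rewrite ?mulr0//=; case: eqP => [jk|]; rewrite ?mulr0//.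
by rewrite ik jk eqxx in ij.
Qed.

Lemma unitary_gram m n p (F : 'M[C]_(m, n)) (U : 'M[C]_m) (S : 'M[C]_(n, p)) :
  U \is unitarymx -> (U *m F *m S)^t* *m (U *m F *m S) = S^t* *m (F^t* *m F) *m S.
Proof. by move=> uU; rewrite !adjM !mulmxA mulmxKtV. Qed.

End RelayIdentities.

(** * Rate and relay power in rotated coordinates *)

Section Relay.
Context {R : realType} {d : measure_display} {T : measurableType d}.
Local Notation C := (R[i])%C.
Variables (P : probability T R) (NS NR ND : nat) (sigR2 sigD2 : R).
Hypotheses (sR0 : 0 < sigR2) (sD0 : 0 < sigD2).
Variables (Ur : 'M[C]_NR) (lr : 'rV[R]_NR) (Rth : 'M[C]_NS).
Hypotheses (uUr : Ur \is unitarymx) (lr0 : nonneg_row lr).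
Variables (G : 'M[C]_(ND, NR)) (UG : 'M[C]_ND) (lG : 'rV[R]_(minn ND NR)) (VG : 'M[C]_NR).
Hypotheses (uUG : UG \is unitarymx) (uVG : VG \is unitarymx) (lG0 : nonneg_row lG).
Hypothesis eG : G = UG *m rectdiag (sqrt_row lG) *m VG^t*.
Variable Q : 'M[C]_NS.
Hypothesis pQ : psd Q.
Hypothesis Rth_adj : Rth^t* = Rth.

Let Lh : 'M[C]_NR := realdiag (sqrt_row lr).
Let S : 'M[C]_NR := realdiag (gram_row lG).
Let D : 'M[C]_NS := Rth *m Q *m Rth.
Let a : C := (sigD2%:C)%C.
Let s : C := (sigR2%:C)%C.

Let a0 : 0 < a. Proof. by rewrite ltcR. Qed.
Let s0 : 0 < s. Proof. by rewrite ltcR. Qed.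

Let pD : psd D.
Proof. by have := psd_congr Rth pQ; rewrite Rth_adj. Qed.

(** The matrix A' of the overview; the claimed structure of A says that it is diagonal and
    nonnegative. *)
Definition relay_core (A : 'M[C]_NR) : 'M[C]_NR := VG^t* *m A *m Ur.

Let channel (z : 'M[C]_(NR, NS)) := evd_sqrt Ur lr *m z *m Rth.

Let channel_cov z : channel z *m Q *m (channel z)^t* =
  Ur *m (Lh *m ((Ur^t* *m z) *m D *m (Ur^t* *m z)^t*) *m Lh) *m Ur^t*.
Proof.
have -> : (channel z)^t* = Rth *m z^t* *m evd_sqrt Ur lr.
  by rewrite /channel (adjM _ Rth) (adjM _ z) Rth_adj evd_sqrt_adj mulmxA.
by rewrite /channel /D /evd_sqrt -/Lh adjM trmxCK !mulmxA.
Qed.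

Lemma relay_gram (A : 'M[C]_NR) :
  (G *m A *m Ur)^t* *m (G *m A *m Ur) = (relay_core A)^t* *m S *m relay_core A.
Proof.
have -> : G *m A *m Ur = UG *m rectdiag (sqrt_row lG) *m relay_core A.
  by rewrite eG /relay_core !mulmxA.
rewrite (unitary_gram _ _ uUG) (rectdiag_gram lG0); reflexivity.
Qed.

(** After [det_ratio_gain], Sylvester's identity moves [Ur] and then [Lh] from the channel
    covariance to the side of the gain. *)
Lemma inst_rateE (A : 'M[C]_NR) (z : 'M[C]_(NR, NS)) :
  inst_rate sigR2 sigD2 G (channel z) Q A =
  logdet D (Lh *m gain a s ((relay_core A)^t* *m S *m relay_core A) *m Lh)
    (Ur^t* *m z).
Proof.
rewrite /inst_rate /logdet; congr (ln (complex.Re _)).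
have uUr' : Ur^t* \is unitarymx by rewrite trmxC_unitary; exact: uUr.
pose F := G *m A.
have e1 : G *m relay_cov sigR2 (channel z) Q A *m G^t* =
    F *m (channel z *m Q *m (channel z)^t* + s%:M) *m F^t*.
  rewrite /relay_cov; move: (_ + _) => K.
  by rewrite /F adjM !mulmxA; reflexivity.
have e2 : G *m A *m A^t* *m G^t* = F *m F^t*.
  by rewrite /F adjM !mulmxA; reflexivity.
rewrite e1 e2.
rewrite (det_ratio_gain a0 s0) channel_cov.
rewrite -relay_gram (adjM (G *m A)) -/F.
have -> : Ur^t* *m F^t* *m (F *m Ur) = Ur^t* *m (F^t* *m F) *m (Ur^t*)^t*.
  by rewrite trmxCK !mulmxA; reflexivity.
rewrite (gain_conj a0 s0 uUr' (psd_gram F)) trmxCK.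
move: (gain a s (F^t* *m F)) => g; move: (Ur^t* *m z *m D *m _) => W.
transitivity (\det (1%:M + Ur *m (Lh *m W *m Lh *m Ur^t* *m g))).
  by rewrite !mulmxA.
rewrite det_1D_mulC.
transitivity (\det (1%:M + Lh *m (W *m Lh *m Ur^t* *m g *m Ur))).
  by rewrite !mulmxA.
by rewrite det_1D_mulC !mulmxA.
Qed.

Lemma relay_tr_covE (A : 'M[C]_NR) (z : 'M[C]_(NR, NS)) :
  complex.Re (\tr (relay_cov sigR2 (channel z) Q A)) =
  trace_form D (Lh *m ((A *m Ur)^t* *m (A *m Ur)) *m Lh) (Ur^t* *m z) +
  sigR2 * complex.Re (\tr (A *m A^t*)).
Proof.
have -> : relay_cov sigR2 (channel z) Q A =
    A *m (channel z *m Q *m (channel z)^t*) *m A^t* + s *: (A *m A^t*).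
  rewrite /relay_cov; move: (_ *m _ *m (channel z)^t*) => K.
  by rewrite mulmxDr mulmxDl mul_mx_scalar -scalemxAl; reflexivity.
rewrite mxtraceD mxtraceZ raddfD /=; congr (_ + _); last first.
  by case: (\tr _) => x y /=; rewrite mul0r subr0; reflexivity.
rewrite /trace_form channel_cov; congr (complex.Re _).
move: (Ur^t* *m z *m D *m _) => W.
transitivity (\tr ((A *m Ur *m Lh *m W) *m (Lh *m (A *m Ur)^t*))).
  by rewrite adjM !mulmxA; reflexivity.
by rewrite mxtrace_mulC !mulmxA; reflexivity.
Qed.

Variable Z : T -> 'M[C]_(NR, NS).
Hypothesis gZ : gaussian_mx P Z.

(** Absorbing U_r^H into the Gaussian matrix keeps it Gaussian, and the averages below are taken
    over this rotated matrix. *)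
Let Z' w : 'M[C]_(NR, NS) := Ur^t* *m Z w.

Let gZ' : gaussian_mx P Z'.
Proof. by have [_ _ h] := unitary_symmetry P NS uUr; exact: h. Qed.

Lemma rateE (A : 'M[C]_NR) :
  rate P sigR2 sigD2 G (fun w => channel (Z w)) Q A =
  avg_logdet P D Z' (Lh *m gain a s ((relay_core A)^t* *m S *m relay_core A) *m Lh).
Proof.
rewrite /rate unlock /avg_logdet /Rintegral; apply: (congr1 fine).
apply: eq_integral => w _; apply: (congr1 EFin); exact: inst_rateE.
Qed.

Lemma relay_powerE (tau : R) (A : 'M[C]_NR) :
  (forall Y : 'M[C]_NR, psd Y -> avg_trace P D Z' Y = tau * complex.Re (\tr Y)) ->
  relay_power P sigR2 (fun w => channel (Z w)) Q A =
  complex.Re (\tr (relay_core A *m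
    diag_mx (tau%:C%C *: complex_row lr + const_mx s) *m (relay_core A)^t*)).
Proof.
move=> htau; rewrite /relay_power unlock.
have pY : psd (Lh *m ((A *m Ur)^t* *m (A *m Ur)) *m Lh).
  have := psd_congr Lh (psd_gram (A *m Ur)).
  by rewrite [Lh^t*]realdiag_adj.
pose cst_ := sigR2 * complex.Re (\tr (A *m A^t*)).
transitivity (\int[P]_w (trace_form D (Lh *m ((A *m Ur)^t* *m (A *m Ur)) *m Lh) (Z' w)
    + cst_)).
  rewrite /Rintegral; apply: (congr1 fine).
  apply: eq_integral => w _; apply: (congr1 EFin); exact: relay_tr_covE.
rewrite RintegralD; [|exact: measurableT|exact: (integrable_trace_form pD gZ' pY)|]; last first.
  by apply: (@finite_measure_integrable_cst _ _ _ P); exact: measurableT.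
have -> : \int[P]_w cst_ = cst_.
  have := Rintegral_cst P (measurableT : measurable [set: T]) cst_.
  move=> e; apply: (etrans e); rewrite -[RHS]mulr1; apply: (congr1 ( *%R cst_)).
  exact: (congr1 fine (probability_setT P)).
have := htau _ pY; rewrite /avg_trace => ->.
have -> : \tr (Lh *m ((A *m Ur)^t* *m (A *m Ur)) *m Lh) =
    \tr (relay_core A *m realdiag lr *m (relay_core A)^t*).
  have -> : relay_core A = VG^t* *m (A *m Ur) by rewrite mulmxA; reflexivity.
  rewrite -(realdiag_sqrt_sqr lr0) -/Lh; move: (A *m Ur) => A2.
  transitivity (\tr ((Lh *m A2^t*) *m (A2 *m Lh))).
    by rewrite !mulmxA; reflexivity.
  rewrite mxtrace_mulC.
  transitivity (\tr (VG^t* *m (A2 *m Lh *m (Lh *m A2^t*)) *m (VG^t*)^t*)).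
    by rewrite tr_conj_unitary; [reflexivity|rewrite trmxC_unitary; exact: uVG].
  by rewrite adjM !mulmxA; reflexivity.
rewrite /cst_; have -> : \tr (A *m A^t*) = \tr (relay_core A *m (relay_core A)^t*).
  have eUr := unitarymxK uUr; have eV := unitarymxK uVG.
  rewrite /relay_core (adjM _ Ur) (adjM _ A) trmxCK.
  rewrite !mulmxA -(mulmxA (VG^t* *m A) Ur) eUr mulmx1.
  rewrite [RHS]mxtrace_mulC !mulmxA eV mul1mx.
  by reflexivity.
move: (relay_core A) => B.
rewrite linearD linearZ /= diag_const_mx mulmxDr mulmxDl mxtraceD.
rewrite mul_mx_scalar -scalemxAr -!scalemxAl !mxtraceZ raddfD /=.
rewrite -/(realdiag lr).
move: (\tr (B *m realdiag lr *m B^t*)) (\tr (B *m B^t*)) => [x1 x2] [y1 y2] /=.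
by rewrite !mul0r !subr0; reflexivity.
Qed.

End Relay.

(** * Domination of every relay matrix by a structured one *)

Section RelayStructure.
Context {R : realType} {d : measure_display} {T : measurableType d}.
Local Notation C := (R[i])%C.
Variables (P : probability T R) (NS NR ND : nat) (sigR2 sigD2 : R).
Hypotheses (sR0 : 0 < sigR2) (sD0 : 0 < sigD2).
Variables (Ur : 'M[C]_NR) (lr : 'rV[R]_NR) (Rth : 'M[C]_NS).
Hypotheses (uUr : Ur \is unitarymx) (lr0 : nonneg_row lr) (lr_dec : decreasing_row lr).
Variables (G : 'M[C]_(ND, NR)) (UG : 'M[C]_ND) (lG : 'rV[R]_(minn ND NR)) (VG : 'M[C]_NR).
Hypotheses (uUG : UG \is unitarymx) (uVG : VG \is unitarymx) (lG0 : nonneg_row lG).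
Hypothesis eG : G = UG *m rectdiag (sqrt_row lG) *m VG^t*.
Variable Q : 'M[C]_NS.
Hypothesis pQ : psd Q.
Hypothesis Rth_adj : Rth^t* = Rth.
Variable Z : T -> 'M[C]_(NR, NS).
Hypothesis gZ : gaussian_mx P Z.

Let D : 'M[C]_NS := Rth *m Q *m Rth.
Let Z' w : 'M[C]_(NR, NS) := Ur^t* *m Z w.
Let H w := evd_sqrt Ur lr *m Z w *m Rth.

Let pD : psd D.
Proof. by have := psd_congr Rth pQ; rewrite Rth_adj. Qed.

Let gZ' : gaussian_mx P Z'.
Proof. by have [_ _ h] := unitary_symmetry P NS uUr; exact: h. Qed.

Let gr : 'rV[R]_NR := gram_row lG.

Let gr0 : nonneg_row gr.
Proof. by move=> i; rewrite mxE; apply: sumr_ge0 => k _; rewrite mulrn_wge0. Qed.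

Definition structured_relay (l : 'rV[R]_NR) : 'M[C]_NR :=
  VG *m realdiag (sqrt_row l) *m Ur^t*.

(* [Num.max 0] makes this continuous in [l] without a sign condition. *)
Definition mode_snr (l : 'rV[R]_NR) : 'rV[R]_NR :=
  \row_i (lr 0 i * (gr 0 i * Num.max 0 (l 0 i) /
          (sigD2 + sigR2 * (gr 0 i * Num.max 0 (l 0 i))))).

Lemma mode_snr_ge0 l : nonneg_row (mode_snr l).
Proof.
move=> i; rewrite mxE mulr_ge0// divr_ge0 ?mulr_ge0// ?le_max ?lexx//.
by rewrite addr_ge0 ?(ltW sD0)// mulr_ge0 ?(ltW sR0)// mulr_ge0// le_max lexx.
Qed.

Lemma mode_snr_continuous i : continuous (fun l : 'rV[R]_NR => mode_snr l 0 i : R).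
Proof.
move=> l.
have cpos : {for l, continuous (fun l : 'rV[R]_NR => gr 0 i * Num.max 0 (l 0 i))}.
  apply: (continuousM (s := cst (gr 0 i)) (t := fun l : 'rV[R]_NR => Num.max 0 (l 0 i))).
    exact: cst_continuous.
  apply: (continuous_max (f := cst 0) (g := fun l : 'rV[R]_NR => l 0 i)).
    exact: cst_continuous.
  exact: coord_continuous.
have cden : {for l, continuous (fun l : 'rV[R]_NR =>
    sigD2 + sigR2 * (gr 0 i * Num.max 0 (l 0 i)))}.
  apply: (continuousD (f := cst sigD2)
    (g := fun l : 'rV[R]_NR => sigR2 * (gr 0 i * Num.max 0 (l 0 i)))).
    exact: cst_continuous.
  apply: (continuousM (s := cst sigR2)
    (t := fun l : 'rV[R]_NR => gr 0 i * Num.max 0 (l 0 i))) => //.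
  exact: cst_continuous.
have den0 : sigD2 + sigR2 * (gr 0 i * Num.max 0 (l 0 i)) != 0.
  rewrite gt_eqF// ltr_wpDr// mulr_ge0 ?(ltW sR0)// mulr_ge0//.
  by rewrite le_max lexx.
rewrite (_ : (fun _ => _) = (fun l : 'rV[R]_NR => lr 0 i * (gr 0 i * Num.max 0 (l 0 i) /
    (sigD2 + sigR2 * (gr 0 i * Num.max 0 (l 0 i)))))); last first.
  by apply/funext => l'; rewrite mxE.
apply: (continuousM (s := cst (lr 0 i)) (t := fun l : 'rV[R]_NR =>
  gr 0 i * Num.max 0 (l 0 i) / (sigD2 + sigR2 * (gr 0 i * Num.max 0 (l 0 i))))).
  exact: cst_continuous.
apply: (continuousM (s := fun l : 'rV[R]_NR => gr 0 i * Num.max 0 (l 0 i))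
  (t := fun l : 'rV[R]_NR => (sigD2 + sigR2 * (gr 0 i * Num.max 0 (l 0 i)))^-1)) => //.
exact: (continuousV (s := fun l : 'rV[R]_NR =>
  sigD2 + sigR2 * (gr 0 i * Num.max 0 (l 0 i))) den0 cden).
Qed.

Lemma structured_core l : relay_core Ur VG (structured_relay l) = realdiag (sqrt_row l).
Proof.
rewrite /relay_core /structured_relay !mulmxA (unitarymxV uVG) mul1mx.
by rewrite -mulmxA (unitarymxV uUr) mulmx1; reflexivity.
Qed.

Lemma mode_snrE (l : 'rV[R]_NR) : nonneg_row l ->
  realdiag (mode_snr l) = diag_mx (\row_i (complex_row lr 0 i *
    (complex_row gr 0 i * complex_row l 0 i /
      (sigD2%:C%C + sigR2%:C%C * (complex_row gr 0 i * complex_row l 0 i))))).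
Proof.
move=> l0; congr diag_mx; apply/rowP => i; rewrite !mxE max_r//.
by rewrite !(rmorphM, rmorphD, fmorphV).
Qed.

Lemma rate_structured (l : 'rV[R]_NR) : nonneg_row l ->
  rate P sigR2 sigD2 G H Q (structured_relay l) =
  avg_logdet P D Z' (realdiag (mode_snr l)).
Proof.
move=> l0; rewrite (rateE P sR0 sD0 lr uUr uUG lG0 eG Q Rth_adj Z).
rewrite structured_core (mode_snrE l0).
have -> : (realdiag (sqrt_row l))^t* *m realdiag (gram_row lG) *m realdiag (sqrt_row l) =
    diag_mx (\row_i (complex_row gr 0 i * complex_row l 0 i)).
  rewrite realdiag_adj !mulmx_diag; congr diag_mx; apply/rowP => i; rewrite !mxE.
  by rewrite mulrAC -rmorphM -expr2 sqr_sqrtr// mulrC.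
have gl0 i : 0 <= (\row_i (complex_row gr 0 i * complex_row l 0 i)) 0 i.
  rewrite mxE [complex_row gr 0 i]mxE [complex_row l 0 i]mxE -rmorphM ler0c.
  exact: (mulr_ge0 (gr0 i) (l0 i)).
have a0 : 0 < sigD2%:C%C by rewrite ltcR.
have s0 : 0 < sigR2%:C%C by rewrite ltcR.
rewrite (gain_diag a0 s0 gl0) !mulmx_diag; congr (avg_logdet P D Z' (diag_mx _)).
apply/rowP => i; rewrite !mxE.
by rewrite mulrAC -rmorphM -expr2 sqr_sqrtr.
Qed.

Variable tau : R.
Hypothesis tau0 : 0 <= tau.
Hypothesis htau : forall Y : 'M[C]_NR, psd Y ->
  avg_trace P D Z' Y = tau * complex.Re (\tr Y).

Lemma power_structured (l : 'rV[R]_NR) : nonneg_row l ->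
  relay_power P sigR2 H Q (structured_relay l) = \sum_i l 0 i * (tau * lr 0 i + sigR2).
Proof.
move=> l0.
rewrite (relay_powerE sigR2 uUr lr0 uVG pQ Rth_adj gZ (structured_relay l) htau).
rewrite structured_core realdiag_adj !mulmx_diag mxtrace_diag raddf_sum /=.
apply: eq_bigr => i _; rewrite !mxE /=.
rewrite ?(mulr0, mul0r, subr0, addr0).
by rewrite mulrAC -expr2 sqr_sqrtr//.
Qed.

Hypothesis scalar_case : is_scalar_mx (diag_mx lG) \/ is_scalar_mx (diag_mx lr).

Lemma structured_relay_improves (A : 'M[C]_NR) : exists2 l : 'rV[R]_NR, nonneg_row l &
  \sum_i l 0 i * (tau * lr 0 i + sigR2) <= relay_power P sigR2 H Q A /\
  rate P sigR2 sigD2 G H Q A <= avg_logdet P D Z' (realdiag (mode_snr l)).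
Proof.
rewrite (rateE P sR0 sD0 lr uUr uUG lG0 eG Q Rth_adj Z).
rewrite (relay_powerE sigR2 uUr lr0 uVG pQ Rth_adj gZ A htau).
rewrite (realdiag_sqrt lr0) -/Z' -/D.
pose a := sigD2%:C%C; pose s := sigR2%:C%C.
have a0 : 0 < a by rewrite ltcR.
have s0 : 0 < s by rewrite ltcR.
have t0 : 0 <= tau%:C%C by rewrite ler0c.
have lam0 i : 0 <= complex_row lr 0 i by rewrite mxE ler0c.
have S0 i : 0 <= complex_row gr 0 i by rewrite [complex_row gr 0 i]mxE ler0c; exact: gr0.
(* The abstract reduction yields a nonnegative row over [C]; nonnegativity makes its entries real,
   so taking real parts loses nothing. *)
suff : exists2 l : 'rV[C]_NR, (forall i, 0 <= l 0 i) &
    \sum_i l 0 i * (tau%:C%C * complex_row lr 0 i + s) <=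
      \tr (relay_core Ur VG A *m diag_mx (tau%:C%C *: complex_row lr + const_mx s) *m
        (relay_core Ur VG A)^t*) /\
    avg_logdet P D Z' (diag_mx (map_mx sqrtC (complex_row lr)) *m
      gain a s ((relay_core Ur VG A)^t* *m diag_mx (complex_row gr) *m relay_core Ur VG A) *m
      diag_mx (map_mx sqrtC (complex_row lr))) <=
    avg_logdet P D Z' (diag_mx (\row_i (complex_row lr 0 i * (complex_row gr 0 i * l 0 i /
      (a + s * (complex_row gr 0 i * l 0 i)))))).
  move=> [l l0 [pw rt]].
  have lE : l = complex_row (\row_i complex.Re (l 0 i)).
    by apply/rowP => i; rewrite !mxE (RRe_real (ger0_real (l0 i))).
  have nl : nonneg_row (\row_i complex.Re (l 0 i)).
    by move=> i; rewrite mxE -ler0c (RRe_real (ger0_real (l0 i))).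
  exists (\row_i complex.Re (l 0 i)); first exact: nl.
  split.
    apply: le_trans (Re_le pw); rewrite raddf_sum /= le_eqVlt; apply/orP; left; apply/eqP.
    apply: eq_bigr => i _; rewrite !mxE; case: (l 0 i) => x y /=.
    by rewrite ?(mulr0, mul0r, subr0, addr0).
  by rewrite (mode_snrE nl) -lE.
have rc U X := @avg_logdet_conj _ _ _ P _ _ D Z' pD gZ' U X.
have rm X Y := @avg_logdet_mid _ _ _ P _ _ D Z' pD gZ' X Y.
have ro X Y := @avg_logdet_mono _ _ _ P _ _ D Z' pD gZ' X Y.
case: scalar_case => /is_scalar_mxP [c ec].
- have lam_dec (i j : 'I_NR) : (i <= j)%N -> complex_row lr 0 j <= complex_row lr 0 i.
    by move=> ij; rewrite !mxE lecR; exact: lr_dec.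
  have lGc k : lG 0 k = c.
    by have := congr1 (fun M : 'M[R]_(minn ND NR) => M k k) ec; rewrite !mxE eqxx.
  (* The common value [c] is nonnegative as soon as there is a singular value. If [minn ND NR] is
     zero, [c] is arbitrary, hence the maximum with 0. *)
  apply: (structure_scalar_channel rc rm ro a0 s0 t0 lam0 lam_dec
    (g := (Num.max 0 c)%:C%C) (k := minn ND NR)).
    by rewrite ler0c le_max lexx.
  move=> i; rewrite !mxE; case: ltnP => hi.
    rewrite (bigD1 (Ordinal hi))//= eqxx big1 ?addr0 ?lGc.
      by rewrite max_r// -(lGc (Ordinal hi)); exact: lG0.
    move=> j /eqP nj; case: eqP => // ji.
    by case: nj; apply: val_inj; exact: ji.
  rewrite big1// => j _; case: eqP => // ji.
  by have := ltn_ord j; rewrite ji ltnNge hi.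
- apply: (structure_scalar_correlation rc rm ro tau%:C%C a0 s0 lam0 (c := c%:C%C)) => //.
  move=> i; rewrite mxE; congr (_%:C)%C.
  by have := congr1 (fun M : 'M[R]_NR => M i i) ec; rewrite !mxE eqxx.
Qed.

End RelayStructure.

Local Open Scope complex_scope.
Local Open Scope sesquilinear_scope.

Theorem proposition4 (R : realType) (d : measure_display)
    (T : measurableType d) (P : probability T R) (NS NR ND : nat)
    (sigR2 sigD2 Pc PSmax PRmax RSmin : R)
    (Z : T -> 'M[R[i]]_(NR, NS))
    (Rr Ur : 'M[R[i]]_NR) (lr : 'rV[R]_NR)
    (Rt Ut : 'M[R[i]]_NS) (lt : 'rV[R]_NS)
    (G : 'M[R[i]]_(ND, NR)) (UG : 'M[R[i]]_ND)
    (lG : 'rV[R]_(minn ND NR)) (VG : 'M[R[i]]_NR)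
    (H : T -> 'M[R[i]]_(NR, NS)) :
  0 < sigR2 -> 0 < sigD2 -> 0 < Pc -> 0 < PSmax -> 0 < PRmax -> 0 <= RSmin ->
  iid_std_complex_gaussian P Z ->
  psdmx Rr -> is_evd Rr Ur lr ->
  psdmx Rt -> is_evd Rt Ut lt ->
  (forall w, H w = evd_sqrt Ur lr *m Z w *m evd_sqrt Ut lt) ->
  is_svd G UG lG VG ->
  is_scalar_mx (diag_mx lG) \/ is_scalar_mx (diag_mx lr) ->
  forall (Q : 'M[R[i]]_NS) (lQ : 'rV[R]_NS),
    is_evd Q Ut lQ ->
    (exists A : 'M[R[i]]_NR,
       feasible P sigR2 sigD2 PSmax PRmax RSmin G H Q A) ->
    exists2 lA : 'rV[R]_NR, nonneg_row lA &
      optimal_relay P sigR2 sigD2 Pc PSmax PRmax RSmin G H Q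
        (VG *m realdiag (sqrt_row lA) *m Ur ^t*).
Proof.
move=> sR0 sD0 Pc0 _ PRmax0 RSmin0 iZ _ [uUr lr0 lr_dec _] _ [uUt lt0 _ _] eH
  [uUG uVG lG0 _ eG] scal Q lQ [_ lQ0 _ eQ] [A0 fA0].
have pQ : psd Q.
  by have [_ _ /psdmxP pQ _] := fA0; exact: pQ.
have radj := evd_sqrt_adj Ut lt.
have gZ := gaussian_mx_iid iZ.
have eHf : H = fun w => evd_sqrt Ur lr *m Z w *m evd_sqrt Ut lt by apply/funext => w; exact: eH.
set Rth := evd_sqrt Ut lt in radj eHf.
set D := Rth *m Q *m Rth.
set Z' : T -> 'M[R[i]]_(NR, NS) := fun w => Ur^t* *m Z w.
have pD : psd D by have := psd_congr Rth pQ; rewrite radj.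
have gZ' : gaussian_mx P Z' by have [_ _ h] := unitary_symmetry P NS uUr; exact: h.
have [tau tau0 htau] := avg_trace_scalar pD gZ'.
have [k _ hk] := avg_logdet_diag_lipschitz pD gZ'.
pose y := mode_snr sigR2 sigD2 lr lG.
pose g l := avg_logdet P D Z' (realdiag l).
pose c : 'rV[R]_NR := \row_i (tau * lr 0 i + sigR2).
have c0 i : 0 < c 0 i by rewrite mxE ltr_wpDl// mulr_ge0.
(* The part of the consumed power that does not depend on the relay matrix; it is positive and keeps
   denominators away from zero. *)
pose q := source_power Q + Pc.
have q0 : 0 < q by rewrite ltr_wpDl// (Re_le (psd_tr_ge0 pQ)).
have powE l : nonneg_row l -> relay_power P sigR2 H Q (structured_relay Ur VG l) =
    \sum_i l 0 i * c 0 i.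
  move=> l0; rewrite eHf (power_structured sigR2 uUr lr0 uVG pQ radj gZ htau l0).
  by apply: eq_bigr => i _; rewrite [c 0 i]mxE.
have rateS l : nonneg_row l -> rate P sigR2 sigD2 G H Q (structured_relay Ur VG l) = g (y l).
  by move=> l0; rewrite eHf (rate_structured P sR0 sD0 uUr lr0 uUG uVG lG0 eG Q radj Z l0).
have imp A : exists2 l : 'rV[R]_NR, nonneg_row l &
    \sum_i l 0 i * c 0 i <= relay_power P sigR2 H Q A /\
    rate P sigR2 sigD2 G H Q A <= g (y l).
  have [l l0 [pw rt]] := structured_relay_improves sR0 sD0 uUr lr0 lr_dec uUG uVG lG0 eG
    pQ radj gZ tau0 htau scal A.
  exists l; first exact: l0.
  rewrite eHf; split; last exact: rt.
  apply: le_trans pw; rewrite le_eqVlt; apply/orP; left; apply/eqP.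
  by apply: eq_bigr => i _; rewrite [c 0 i]mxE.
have [l l0 [pl rl optl]] : exists2 l : 'rV[R]_NR, nonneg_row l &
    [/\ \sum_i l 0 i * c 0 i <= PRmax, RSmin <= g (y l) & forall l' : 'rV[R]_NR,
      nonneg_row l' -> \sum_i l' 0 i * c 0 i <= PRmax -> RSmin <= g (y l') ->
      g (y l') / (\sum_i l' 0 i * c 0 i + q) <= g (y l) / (\sum_i l 0 i * c 0 i + q)].
  apply: (ratio_max_exists (k := k) c0 q0).
  - by move=> i; exact: (mode_snr_continuous sR0 sD0 lG0).
  - by move=> l; exact: (mode_snr_ge0 sR0 sD0 lr0 lG0 l).
  - by move=> u v u0 v0; exact: (hk u v u0 v0).
  (* The feasible matrix is replaced by a structured one with no more power and no less rate, so the
     structured search set is nonempty. *)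
  - have [l l0 [pw rt]] := imp A0; have [pA _ _ rA] := fA0.
    by exists l; [exact: l0|split; [exact: le_trans pw pA|exact: le_trans rA rt]].
exists l; first exact: l0.
rewrite /optimal_relay /feasible /energy_efficiency -/(structured_relay Ur VG l).
rewrite (powE l l0) (rateS l l0).
have [_ sQ psdQ _] := fA0.
split; first by split; [exact: pl|exact: sQ|exact: psdQ|exact: rl].
move=> A [pA _ _ rA]; have [l' l'0 [pw rt]] := imp A.
have ps0 (v : 'rV[R]_NR) : nonneg_row v -> 0 <= \sum_i v 0 i * c 0 i.
  by move=> v0; apply: sumr_ge0 => i _; exact: (mulr_ge0 (v0 i) (ltW (c0 i))).
have := optl l' l'0 (le_trans pw pA) (le_trans rA rt); rewrite -!addrA -/q.
apply: le_trans; have p' := ps0 l' l'0.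
have p1 : 0 < \sum_i l' 0 i * c 0 i + q by rewrite ltr_wpDl.
have p2 : 0 < relay_power P sigR2 H Q A + q by rewrite ltr_wpDl// (le_trans p').
(* The larger numerator and smaller denominator can be combined because the rate of [A] is at least
   [RSmin], which is nonnegative. *)
apply: ler_pM.
- exact: le_trans RSmin0 rA.
- by rewrite invr_ge0 ltW.
- exact: rt.
- by rewrite lef_pV2 ?posrE// lerD2r.
Qed.
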